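(* Let $k\geq 2$ be an integer and let $s>0$ be a real number with $s\neq 1+\frac1k$. Let $\theta_{k,s}$ be the infimum of all $(k,s)$-admissible exponents (defined in the context). Then $$\theta_{k,s}\leq\begin{cases}\left(\frac{k+1}{2}\right)\delta_k & \text{if } s<1+\frac1k,\\ \left(\frac12+\frac{1}{2(s-1)}\right)\delta_k & \text{if } 1+\frac1k<s<2,\\ \delta_k & \text{if } s\geq 2,\end{cases}$$ where $\delta_2=\frac{105}{317}$ and, for $k\geq 3$, $$\delta_k=\frac{1}{k+1}\left(1-\frac{3k^3-6k^2-k+4}{3k^5+15k^4+33k^3+21k^2+14k+10}\right)<\frac{1}{k+1}.$$
   Context: For an integer $k\ge 2$, $\mu_k(n)$ is the indicator function of the $k$-free integers, i.e. those divisible by no $k$th power of a prime. Write $e(\alpha)=e^{2\pi i\alpha}$, and for $1\le K\leq N$ set $$S_k(\alpha;K)=\sum_{N-K<n\leq N}\mu_k(n)e(n\alpha).$$ For $s>0$, $s\ne 1+\frac1k$, an exponent $\theta$ is called $(k,s)$-admissible if, whenever $N^{\theta}\ll K\leq N$, one has $$\int_0^1|S_k(\alpha;K)|^s\,d\alpha\asymp\begin{cases}K^{\frac{s}{k+1}} & \text{if } s<1+\frac1k,\\ K^{s-1} & \text{if } s>1+\frac1k,\end{cases}$$ where the implicit constants may depend on $k$, $s$ and $\theta$. Here $K\gg N^\theta$ means $K\ge cN^\theta$ for a fixed constant $c>0$ (on which the implicit constants may also depend), and the estimate is asserted for all sufficiently large $N$; $f\asymp g$ means $f\ll g$ and $g\ll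 f$. *)

(* Defs.v *)
From HB Require Import structures.
From mathcomp Require Import all_boot all_order all_algebra.
From mathcomp Require Import complex.
From mathcomp Require Import all_classical all_reals all_analysis.

Set Implicit Arguments.
Unset Strict Implicit.
Unset Printing Implicit Defensive.

Import Order.TTheory GRing.Theory Num.Theory.
Import numFieldNormedType.Exports.

Local Open Scope classical_set_scope.
Local Open Scope ring_scope.

(* 0 is not k-free in this sense: it is divisible by every prime power. *)
Definition kfree (k : nat) : set nat :=
  [set n | forall p : nat, prime p -> ~~ (p ^ k %| n)%N].

Definition mu (R : realType) (k n : nat) : R := \1_(kfree k) n.

Definition expe (R : realType) (alpha : R) : R[i] :=
  Complex (cos (2 * pi * alpha)) (sin (2 * pi * alpha)).

(* For 0 <= N the bound n < (Num.truncn N).+1 on the natural number n says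
   n <= N.  The parameters N and K are real, not necessarily integers. *)
Definition expsum (R : realType) (k : nat) (N K alpha : R) : R[i] :=
  \sum_(0 <= n < (Num.truncn N).+1 | N - K < n%:R)
     real_complex R (mu R k n) * expe (n%:R * alpha).

Definition moment (R : realType) (k : nat) (s N K : R) : \bar R :=
  \int[@lebesgue_measure R]_(alpha in `[0, 1])
     (Normc.normc (expsum k N K alpha) `^ s)%:E.

(* Only meant for s != 1 + 1/k. *)
Definition moment_order (R : realType) (k : nat) (s K : R) : R :=
  if s < 1 + k%:R^-1 then K `^ (s / (k%:R + 1)) else K `^ (s - 1).

Definition admissible (R : realType) (k : nat) (s theta : R) : Prop :=
  forall c : R, 0 < c ->
  exists C1 C2 N0 : R, [/\ 0 < C1, 0 < C2 &
    forall N K : R, N0 <= N -> 1 <= K -> K <= N -> c * N `^ theta <= K ->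
      ((C1 * moment_order k s K)%:E <= moment k s N K)%E /\
      (moment k s N K <= (C2 * moment_order k s K)%:E)%E].

(* The infimum is taken in the extended reals: the infimum of the empty set is
   +oo there, whereas the real-valued [inf] would return 0. *)
Definition theta_inf (R : realType) (k : nat) (s : R) : \bar R :=
  ereal_inf [set theta%:E | theta in admissible k s].

Definition delta (R : realType) (k : nat) : R :=
  if k == 2%N then 105 / 317
  else let x : R := k%:R in
    1 / (x + 1) *
    (1 - (3 * x ^+ 3 - 6 * x ^+ 2 - x + 4) /
         (3 * x ^+ 5 + 15 * x ^+ 4 + 33 * x ^+ 3 + 21 * x ^+ 2 + 14 * x + 10)).

Definition theta_bound (R : realType) (k : nat) (s : R) : R :=
  if s < 1 + k%:R^-1 then (k%:R + 1) / 2 * delta R k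
  else if s < 2 then (1 / 2 + 1 / (2 * (s - 1))) * delta R k
  else delta R k.

(* Main.v *)
Require Import Defs.
From HB Require Import structures.
From mathcomp Require Import all_boot all_order all_algebra.
From mathcomp Require Import complex.
From mathcomp Require Import all_classical all_reals all_analysis.
From mathcomp Require Import measurable_realfun.
From mathcomp Require Import zify ring lra.

(** It suffices to show that all exponents above [theta_bound k s] are admissible
    ([admissible_above]). Write [D = K ^ (1 / (k + 1))]. Moebius inversion expresses the sum
    over the [k]-free integers of the window (N - K, N] through the sums over the multiples
    of [d ^ k] in the window, with the weights [moebius d]. The terms with [d <= Z], where
    [Z] has the size of [D], form the main part [main_sum]; the others form a remainder, whose
    coefficients are [rem_coef].

    The remainder is small in mean square. By Parseval's identity its mean square counts
    pairs [d, d' > Z] together with common multiples of [d ^ k] and [d' ^ k] in the window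
    ([rem_coef_L2]). Pairs with [lcm(d, d') ^ k <= K] contribute about [K Z ^ (1 - k) = D ^ 2].
    The others are governed by the integers [e > K ^ (1 / k)] such that [e ^ k] has a
    multiple in the window. For these the fractional part of [N / e ^ k] is tiny. Among
    three of them that lie close together the integral parts of [N / e ^ k] therefore have a
    vanishing second difference, which the curvature of [N / t ^ k] permits only if two of
    the three are very close ([three_hits]). This yields a bound [K ^ w] for the remainder
    as soon as [theta w > delta k] ([tail_small]), and [theta_bound k s] is the threshold at
    which this is no more than the expected order of magnitude: one needs [w = 2 / (k + 1)]
    below the critical order [1 + 1 / k] and [w = 2 (s - 1) / s] above it.

    For the upper bound the interval of the multiples of [d ^ k] is split into dyadic
    layers. The layer of scale [2 ^ j] is the difference of two smoothed intervals, so its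
    exponential sum is dominated by a Fejer kernel with mean value [O(1)], its coefficients
    live near the two ends of the window, and it occurs only for [2 ^ j d ^ k <= K].
    Interpolation between the first and the second moment shows that the layer [j] of [main_sum]
    has an [s]th moment of order [K ^ (1 / k) 2 ^ (j (s - 1 - 1 / k))]. This is a geometric
    progression in [j] that is dominated by [2 ^ j = D] for [s < 1 + 1 / k] and by
    [2 ^ j = K] for [s > 1 + 1 / k]; either way the result is [moment_order k s K]
    ([moment_main_sum]). Outside [1 <= s < 2] the first moment or the mean square of [expsum]
    suffices ([moment_upper]).

    For [s > 1 + 1 / k] the lower bound comes from the neighbourhood of [0], where the terms
    do not cancel ([expsum_arc_lower]), because the [k]-free integers have positive density
    in the window ([kfree_count]).

    For [s < 1 + 1 / k] it suffices to bound the first moment from below by a multiple of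
    [D] ([mean_expsum_lower]); the other orders follow by interpolation. Average over the
    translates by the fractions [a / q ^ k] with [q] squarefree and [a] primitive. No
    [k]-free integer is divisible by a [k]th power other than 1, so the average multiplies
    [expsum] by the sign [moebius q]; but it nearly annihilates [main_sum] when [q > Z]
    ([main_sum_prim_average]). Hence the remainder has to be large on the average over the arcs
    of length [1 / (8 K)] that start at these fractions. For denominators [q] of size [c D]
    these arcs have total length of order [c ^ (k + 1)] and, if [c] is small, rarely overlap
    ([arc_overlap]), so that the mean value of the remainder is at least of order [c D]. The
    mean value of [main_sum] is at most of order [sqrt (Z D)] ([mean_main_sum]), which is smaller if
    [Z / D] is small compared with [c ^ 2]. *)

Set Implicit Arguments.
Unset Strict Implicit.
Unset Printing Implicit Defensive.

Import Order.TTheory GRing.Theory Num.Theory.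
Import numFieldNormedType.Exports.

Local Open Scope ring_scope.
Local Notation expe := Defs.expe.
Local Notation nc := Normc.normc.

(** * The Moebius function *)

Definition sqfree (n : nat) : bool := (0 < n)%N && all (fun p => logn p n == 1%N) (primes n).

Definition moebius (R : realType) (n : nat) : R :=
  if sqfree n then (-1) ^+ size (primes n) else 0.

Lemma normr_moebius_le1 (R : realType) n : `|moebius R n| <= 1.
Proof. by rewrite /moebius; case: ifP => _; rewrite ?normr0 ?ler01 // normrX normrN1 expr1n. Qed.

Lemma moebius1 (R : realType) : moebius R 1 = 1.
Proof. by rewrite /moebius /sqfree /= expr0. Qed.

Lemma sqfreeP n : reflect ((0 < n)%N /\ forall p, prime p -> ~~ (p ^ 2 %| n)%N) (sqfree n).
Proof.
rewrite /sqfree; apply: (iffP andP) => -[n0 H]; split => //.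
  move=> p pp; apply/negP => h; rewrite (pfactor_dvdn _ pp n0) in h.
  have pn : p \in primes n by rewrite -logn_gt0; lia.
  by move/allP: H => /(_ p pn) /eqP; lia.
apply/allP => p; rewrite -logn_gt0 => l0.
have pp : prime p by move: l0; rewrite lognE; case: (prime p).
have := H p pp; rewrite (pfactor_dvdn _ pp n0); lia.
Qed.

Lemma moebius_sq0 (R : realType) p n : prime p -> (p ^ 2 %| n)%N -> moebius R n = 0.
Proof.
move=> pp h; rewrite /moebius; case: sqfreeP => // -[_ H].
by have := H p pp; rewrite h.
Qed.

Lemma moebius_mulp (R : realType) p e : prime p -> (0 < e)%N -> ~~ (p %| e)%N ->
  moebius R (p * e) = - moebius R e.
Proof.
move=> pp e0 npe; have p0 := prime_gt0 pp.
have cop : coprime p e by rewrite prime_coprime.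
have sz : size (primes (p * e)) = (size (primes e)).+1.
  rewrite -[RHS]/(size (p :: primes e)); apply: perm_size; apply: uniq_perm.
  - exact: primes_uniq.
  - by rewrite /= primes_uniq andbT mem_primes (negbTE npe) !andbF.
  - by move=> q; rewrite primesM // inE primes_prime // inE.
have -> : moebius R (p * e) =
  if sqfree e then (-1) ^+ (size (primes e)).+1 else 0.
  rewrite /moebius sz; congr (if _ then _ else _).
  rewrite /sqfree muln_gt0 p0 e0 /=; apply/allP/allP => H q hq.
    have := H q; rewrite primesM // hq orbT => /(_ isT).
    rewrite lognM // (_ : logn q p = 0%N) // logn_prime // .
    by apply/eqP; rewrite eqb0; apply: contraNneq npe => <-; move: hq; rewrite mem_primes => /and3P[].
  move: hq; rewrite primesM // primes_prime // inE => /orP[/eqP ->|hq].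
    by rewrite lognM // logn_prime // eqxx logn_coprime.
  rewrite lognM // logn_prime //; have /eqP -> := H q hq.
  rewrite (_ : (q == p) = false) //; apply: contraNF npe => /eqP <-.
  by move: hq; rewrite mem_primes => /and3P[].
by rewrite /moebius; case: ifP => _; rewrite ?oppr0 // exprS mulN1r.
Qed.

(** The involution [e <-> p e] on the divisors of [q] that are not divisible by
    [p ^ 2] reverses the sign of the Moebius function. *)
Lemma sum_moebius_cancel (R : realType) p q (F : nat -> R) :
  prime p -> (p %| q)%N -> (0 < q)%N ->
  (forall e, (p * e %| q)%N -> ~~ (p %| e)%N -> F (p * e)%N = F e) ->
  \sum_(e <- divisors q) moebius R e * F e = 0.
Proof.
move=> pp /dvdnP[r]; rewrite mulnC => qE q0 HF; have p0 := prime_gt0 pp.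
have r0 : (0 < r)%N by move: q0; rewrite qE muln_gt0 => /andP[].
rewrite (bigID (fun e => (p %| e)%N)) /=.
have -> : \sum_(e <- divisors q | (p %| e)%N) moebius R e * F e =
  \sum_(e <- divisors r) moebius R (p * e) * F (p * e)%N.
  rewrite -big_filter -(big_map (muln p) xpredT (fun e => moebius R e * F e)).
  apply: perm_big; apply: uniq_perm.
  - by rewrite filter_uniq // divisors_uniq.
  - rewrite map_inj_uniq ?divisors_uniq // => x y /eqP.
    by rewrite eqn_pmul2l // => /eqP.
  move=> x; rewrite mem_filter -dvdn_divisors //.
  apply/andP/mapP => [[/dvdnP[y ->]]|[y]].
    by rewrite qE mulnC dvdn_pmul2l // => yr; exists y => //; rewrite -dvdn_divisors.
  by rewrite -dvdn_divisors // => yr ->; rewrite dvdn_mulr // qE dvdn_pmul2l.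
have -> : \sum_(e <- divisors q | ~~ (p %| e)%N) moebius R e * F e =
  \sum_(e <- divisors r | ~~ (p %| e)%N) moebius R e * F e.
  rewrite -big_filter -[RHS]big_filter; apply: perm_big; apply: uniq_perm;
    rewrite ?filter_uniq ?divisors_uniq // => x.
  rewrite !mem_filter -!dvdn_divisors //.
  case: (boolP (p %| x)%N) => //= npx.
  by rewrite qE Gauss_dvdr // coprime_sym prime_coprime.
rewrite (bigID (fun e => (p %| e)%N)) /= big_seq_cond big1 ?add0r; last first.
  move=> e /andP[_ pe]; rewrite (@moebius_sq0 _ p) ?mul0r //.
  by rewrite expnS expn1 dvdn_mul.
rewrite -big_split /= big_seq_cond big1 // => e /andP[].
rewrite -dvdn_divisors // => er npe.
rewrite moebius_mulp //; last by case: (e) er r0 => //; rewrite dvd0n => /eqP ->.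
by rewrite HF ?mulNr ?subrr ?addNr // qE dvdn_pmul2l.
Qed.

Lemma sum_divisors_only (R : realType) q (F : nat -> R) e0 :
  (0 < q)%N -> (e0 %| q)%N -> (forall e, (e %| q)%N -> e != e0 -> F e = 0) ->
  \sum_(e <- divisors q) F e = F e0.
Proof.
move=> q0 e0q HF; rewrite (bigD1_seq e0) ?divisors_uniq -?dvdn_divisors //= big_seq_cond big1 ?addr0 //.
by move=> e /andP[]; rewrite -dvdn_divisors // => eq ne; apply: HF.
Qed.

(** For [q = a = n] this is the convolution identity for the indicator of the
    [k]-free integers; in general it detects the fractions [a / q ^ k] that
    cannot be rewritten with a smaller [k]th power as denominator. *)
Lemma sum_moebius_kpow (R : realType) k q a : (0 < q)%N ->
  \sum_(e <- divisors q) moebius R e * (e ^ k %| a)%N%:R =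
  (all (fun e => (e ^ k %| a)%N ==> (e == 1%N)) (divisors q))%:R :> R.
Proof.
move=> q0; case: allP => [H|/allP].
  rewrite (@sum_divisors_only _ _ _ 1%N) //; first by rewrite moebius1 exp1n dvd1n mulr1.
  move=> e eq ne; case: (boolP (e ^ k %| a)%N) => [ea|]; last by rewrite mulr0.
  by have := H e; rewrite -dvdn_divisors // => /(_ eq); rewrite ea (negbTE ne).
rewrite -has_predC => /hasP[e]; rewrite -dvdn_divisors // => eq /=.
rewrite negb_imply => /andP[ea ne].
have e_gt0 : (0 < e)%N by case: (e) eq q0 => //; rewrite dvd0n => /eqP ->.
have e1 : (1 < e)%N by rewrite ltn_neqAle eq_sym ne.
have pp := pdiv_prime e1; have pe := pdiv_dvd e.
apply: (@sum_moebius_cancel _ (pdiv e)) => //; first exact: dvdn_trans eq.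
move=> f _ npf; congr (_%:R); congr (nat_of_bool _).
rewrite expnMn Gauss_dvd ?coprimeXl ?coprimeXr ?prime_coprime //.
by rewrite (dvdn_trans (dvdn_exp2r k pe) ea).
Qed.

(** Choose a prime [p] that occurs in [q] to a higher power than in [d].  Cancelling one factor [p]
    in [q / e] then does not change the greatest common divisor with [d], so that
    [sum_moebius_cancel] applies. *)
Lemma sum_moebius_gcd (R : realType) k q d : (0 < q)%N -> (0 < d)%N -> ~~ (q %| d)%N ->
  \sum_(e <- divisors q) moebius R e * (gcdn d (q %/ e) ^ k)%:R = 0.
Proof.
move=> q0 d0 nqd.
have [p pp lt] : exists2 p, prime p & (logn p d < logn p q)%N.
  case: (pselect (forall p, prime p -> (logn p q <= logn p d)%N)) => [H|].
    move: nqd; rewrite -[X in ~~ X]negbK; case/negP; apply/negPn.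
    by apply/dvdn_partP => // p; rewrite mem_primes => /and3P[pp _ _]; rewrite p_part pfactor_dvdn // H.
  move=> /existsNP[p /not_implyP[pp /negP]]; rewrite -ltnNge; by exists p.
have pq : (p %| q)%N by rewrite -[p]expn1 pfactor_dvdn //; lia.
apply: (@sum_moebius_cancel _ p) => // e peq npe; congr ((_ ^ k)%N%:R).
have p0 := prime_gt0 pp.
have e0 : (0 < e)%N by case: (e) peq npe => //; rewrite dvdn0.
case/dvdnP: peq => f qE.
have f0 : (0 < f)%N by move: q0; rewrite qE; case: (f).
have -> : (q %/ (p * e) = f)%N by rewrite qE mulnK // muln_gt0 p0.
have -> : (q %/ e = p * f)%N by rewrite qE mulnA mulnK // mulnC.
have lq : (logn p d <= logn p f)%N.
  have lpp : logn p p = 1%N by rewrite logn_prime // eqxx.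
  have lpe : logn p e = 0%N by rewrite logn_coprime // prime_coprime.
  by move: lt; rewrite qE lognM ?muln_gt0 ?p0 // lognM // lpp lpe; lia.
apply/eqP; rewrite eqn_dvd dvdn_gcd dvdn_gcdl /= dvdn_mull ?dvdn_gcdr //=.
rewrite dvdn_gcd dvdn_gcdl /=.
set g := gcdn d (p * f).
have g0 : (0 < g)%N by rewrite gcdn_gt0 d0.
apply/dvdn_partP => // r; rewrite mem_primes => /and3P[rp _ _].
rewrite p_part pfactor_dvdn //.
have [->|nrp] := eqVneq r p.
  apply: leq_trans lq; apply: dvdn_leq_log => //; exact: dvdn_gcdl.
have : (logn r g <= logn r (p * f))%N.
  by apply: dvdn_leq_log; [rewrite muln_gt0 p0 | exact: dvdn_gcdr].
have -> : logn r (p * f) = logn r f.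
  by rewrite lognM // [logn r p](_ : _ = 0%N) // logn_prime // (negbTE nrp).
by [].
Qed.

(** * The divisor bound *)

Lemma le_powR2 (R : realType) (r x y : R) : 0 <= r -> 0 <= x -> x <= y -> x `^ r <= y `^ r.
Proof. by move=> r0 x0 xy; apply: ge0_ler_powR => //; rewrite nnegrE // (le_trans x0). Qed.

Lemma size_divisors_mulp p m n : prime p -> (0 < n)%N -> m = (n`_p^')%N ->
  (size (divisors n) <= (logn p n).+1 * size (divisors m))%N.
Proof.
move=> pp n0 mE.
pose l := [seq (p ^ i * d)%N | i <- iota 0 (logn p n).+1, d <- divisors m].
have <- : size l = ((logn p n).+1 * size (divisors m))%N by rewrite size_allpairs size_iota.
apply: uniq_leq_size; first exact: divisors_uniq.
move=> x; rewrite -dvdn_divisors // => xn.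
have x0 : (0 < x)%N by case: (x) xn n0 => //; rewrite dvd0n => /eqP ->.
apply/allpairsP; exists (logn p x, (x`_p^')%N); split.
- by move: (dvdn_leq_log p n0 xn); rewrite -ltnS => h; have := mem_iota 0 (logn p n).+1 (logn p x); rewrite h /= => ->.
- by rewrite -dvdn_divisors mE ?part_gt0 // partn_dvd.
- by rewrite -p_part partnC.
Qed.

(** [size (divisors n) / n ^ eps] is a product of local factors; this is the passage from the
    part of [n] prime to [p] to [n] itself, where [c] bounds the factor at [p]. *)
Lemma divisor_step (R : realType) (eps x : R) (c : R) p m n : prime p -> (0 < n)%N -> m = (n`_p^')%N ->
  0 < eps -> 1 <= c ->
  (forall a : nat, (a.+1)%:R <= c * (p%:R `^ eps) ^+ a) ->
  (size (divisors m))%:R <= x * m%:R `^ eps ->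
  (size (divisors n))%:R <= c * x * n%:R `^ eps.
Proof.
move=> pp n0 mE e0 c1 Hc Hm.
have p0 : 0 <= p%:R :> R by [].
have -> : n%:R `^ eps = (p%:R `^ eps) ^+ (logn p n) * m%:R `^ eps.
  rewrite -{1}(partnC p n0) -mE natrM powRM // p_part natrX; congr (_ * _).
  by rewrite -powR_mulrn // -powRrM mulrC powRrM powR_mulrn ?powR_ge0.
have : (size (divisors n))%:R <= ((logn p n).+1%:R * (size (divisors m))%:R) :> R.
  by rewrite -natrM ler_nat size_divisors_mulp.
move/le_trans; apply.
have -> : c * x * (p%:R `^ eps ^+ logn p n * m%:R `^ eps) =
  (c * p%:R `^ eps ^+ logn p n) * (x * m%:R `^ eps) by ring.
by apply: ler_pM.
Qed.

(** If all primes dividing [n] satisfy [p ^ eps >= 2], the local factors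
    [(a + 1) / p ^ (a eps)] are at most one. *)
Lemma divisor_bound_rough (R : realType) (eps : R) (P0 : nat) : 0 < eps ->
  2 <= P0%:R `^ eps -> forall n, (0 < n)%N -> (forall p, prime p -> (p %| n)%N -> (P0 <= p)%N) ->
  (size (divisors n))%:R <= n%:R `^ eps.
Proof.
move=> e0 HP n; elim/ltn_ind: n => n IH n0 Hn.
have [n1|n1] := leqP n 1.
  have -> : n = 1%N by lia.
  by rewrite /= powR1.
have pp := pdiv_prime n1; have pn := pdiv_dvd n.
have mn : (n`_(pdiv n)^' < n)%N.
  rewrite -[X in (_ < X)%N](partnC (pdiv n) n0) ltn_Pmull ?part_gt0 // p_part_gt1 mem_primes pp n0 pn //.
have Hm := IH _ mn (part_gt0 _ _).
rewrite -[X in _ <= X]mul1r -[X in _ <= X * _]mul1r.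
apply: (@divisor_step _ eps 1 1 (pdiv n) (n`_(pdiv n)^')%N n) => //; last first.
  rewrite mul1r; apply: Hm => p' pp' pm; apply: Hn => //.
  by apply: dvdn_trans pm _; exact: dvdn_part.
move=> a; rewrite mul1r.
have H2 : 2 <= (pdiv n)%:R `^ eps.
  apply: le_trans HP _; apply: le_powR2 => //; first exact: ltW.
  by rewrite ler_nat; apply: Hn.
apply: (@le_trans _ _ (2 ^+ a)); last by rewrite lerXn2r // nnegrE.
by rewrite -natrX ler_nat; exact: ltn_expl.
Qed.

(** Only the primes below [2 ^ (1 / eps)] have local factors that may exceed one, and each of
    these factors is bounded; [j] counts how many small integers have been taken into account. *)
Theorem divisor_bound (R : realType) (eps : R) : 0 < eps ->
  exists2 C : R, 1 <= C & forall n, (0 < n)%N -> (size (divisors n))%:R <= C * n%:R `^ eps.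
Proof.
move=> e0.
pose P0 := (Num.truncn (2 `^ eps^-1 : R)).+1.
have HP : 2 <= P0%:R `^ eps.
  have h : (2 : R) `^ eps^-1 <= P0%:R.
    by apply: ltW; rewrite /P0; apply: truncnS_gt.
  have -> : (2 : R) = (2 `^ eps^-1) `^ eps by rewrite -powRrM mulVf ?gt_eqF // powRr1.
  by apply: le_powR2 => //; apply: ltW.
pose y : R := 2 `^ eps - 1.
have y0 : 0 < y by rewrite /y subr_gt0; have := gt0_ltr_powR e0 (ler01 : 1 \in Num.nneg) (ler0n R 2 : 2 \in Num.nneg) (ltr1n R 2); rewrite powR1.
pose c := Num.max 1 y^-1.
have c1 : 1 <= c by rewrite /c le_max lexx.
have cy : 1 <= c * y by rewrite -ler_pdivrMr // div1r /c le_max lexx orbT.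
have Hc p : prime p -> forall a : nat, a.+1%:R <= c * (p%:R `^ eps) ^+ a.
  move=> pp a; have p2 : 1 + y <= p%:R `^ eps.
    rewrite /y addrC subrK; apply: le_powR2 => //; first exact: ltW.
    by rewrite ler_nat prime_gt1.
  apply: (@le_trans _ _ (c * (1 + y) ^+ a)); last first.
    rewrite ler_wpM2l ?(le_trans ler01) // lerXn2r ?nnegrE //; lra.
  elim: a => [|a IH]; first by rewrite expr0 mulr1.
  rewrite exprSr mulrA mulrDr mulr1 -natr1; apply: lerD => //.
  have h1 : 1 <= (1 + y) ^+ a by rewrite exprn_ege1 //; lra.
  nra.
(* all primes dividing [n] are at least [P0 - j] *)
suff H j : (j <= P0)%N -> forall n, (0 < n)%N ->
    (forall p, prime p -> (p %| n)%N -> (P0 - j <= p)%N) ->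
    (size (divisors n))%:R <= c ^+ j * n%:R `^ eps.
  exists (c ^+ P0); first by rewrite exprn_ege1.
  by move=> n n0; apply: H => // p _ _; rewrite subnn.
elim: j => [_ n n0|j IH jP n n0 Hn].
  by rewrite subn0 => Hn; rewrite expr0 mul1r; apply: (divisor_bound_rough e0 HP).
have IHj := IH (ltnW jP).
have [pp|npp] := boolP (prime (P0 - j.+1)%N); last first.
  apply: (@le_trans _ _ (c ^+ j * n%:R `^ eps)); last first.
    rewrite ler_wpM2r ?powR_ge0 // exprS ler_peMl // exprn_ge0 //; lra.
  apply: IHj => // p pp pn; have := Hn _ pp pn.
  rewrite leq_eqVlt => /orP[/eqP E|]; last by lia.
  by rewrite E pp in npp.
rewrite exprS; apply: (@divisor_step _ eps (c ^+ j) c (P0 - j.+1) (n`_(P0 - j.+1)^')%N n) => //; first exact: Hc.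
apply: IHj; first exact: part_gt0.
move=> p pp' pm; have pn : (p %| n)%N by apply: dvdn_trans pm _; exact: dvdn_part.
have := Hn _ pp' pn; rewrite leq_eqVlt => /orP[/eqP E|]; last by lia.
have /(pnatP _ (part_gt0 _ _)) /(_ p pp' pm) := part_pnat ((P0 - j.+1)%N)^' n.
by rewrite !inE E eqxx.
Qed.

(** * Divided differences of negative powers *)

Lemma le_exprn2 (R : realDomainType) (x y : R) n : 0 <= x -> x <= y -> x ^+ n <= y ^+ n.
Proof. by move=> x0 xy; rewrite lerXn2r // nnegrE // (le_trans x0). Qed.

Lemma subrXX_ge (R : realDomainType) (u v : R) n : 0 <= v -> v <= u ->
  (u - v) * u ^+ n <= u ^+ n.+1 - v ^+ n.+1.
Proof.
move=> v0 vu; rewrite mulrBl -exprS lerB // exprS ler_wpM2l // lerXn2r // nnegrE //.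
exact: le_trans vu.
Qed.

Lemma subrXX_le (R : realDomainType) (u v : R) n : 0 <= v -> v <= u ->
  u ^+ n.+1 - v ^+ n.+1 <= n.+1%:R * (u - v) * u ^+ n.
Proof.
move=> v0 vu; have u0 := le_trans v0 vu.
elim: n => [|n IH]; first by rewrite !expr1 expr0 mulr1 mul1r.
have -> : u ^+ n.+2 - v ^+ n.+2 = u * (u ^+ n.+1 - v ^+ n.+1) + (u - v) * v ^+ n.+1.
  by rewrite !(exprS _ n.+1); ring.
have h1 := ler_wpM2l u0 IH.
have h2 : (u - v) * v ^+ n.+1 <= (u - v) * u ^+ n.+1.
  by rewrite ler_wpM2l ?subr_ge0 // lerXn2r // nnegrE.
apply: le_trans (lerD h1 h2) _.
rewrite -(natr1 n.+1) (exprS u n) le_eqVlt; apply/orP; left; apply/eqP; ring.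
Qed.

(** The left-hand side is [(y - x) (z - y) (z - x)] times the second divided
    difference of [t ^ - k] at [x, y, z], which lies between multiples of
    [z ^ - (k + 2)] and of [x ^ - (k + 2)]. *)
Lemma divided_difference_bounds (R : realFieldType) (x y z : R) k :
  0 < x -> x < y -> y < z -> (0 < k)%N ->
  (y - x) * (z - y) * (z - x) * z^-1 ^+ (k + 2) <=
    (z - y) * x^-1 ^+ k - (z - x) * y^-1 ^+ k + (y - x) * z^-1 ^+ k <=
  (k ^ 2)%:R * ((y - x) * (z - y) * (z - x) * x^-1 ^+ (k + 2)).
Proof.
move=> x0 xy yz + ; have y0 := lt_trans x0 xy; have z0 := lt_trans y0 yz.
set P := (y - x) * (z - y) * (z - x).
have P0 : 0 <= P by rewrite /P; do 2?[apply: mulr_ge0]; lra.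
pose u := x^-1; pose v := y^-1; pose w := z^-1.
have w0 : 0 < w by rewrite invr_gt0.
have vw : w <= v by rewrite lef_pV2 ?posrE // ltW.
have uv : v <= u by rewrite lef_pV2 ?posrE // ltW.
have v0 : 0 < v by lra.
have u0 : 0 < u by lra.
pose D j := (z - y) * u ^+ j - (z - x) * v ^+ j + (y - x) * w ^+ j.
have xE : x = u^-1 by rewrite invrK.
have yE : y = v^-1 by rewrite invrK.
have zE : z = w^-1 by rewrite invrK.
have DS j : D j.+1 = w * D j + (z - y) * (z - x) * w * (u ^+ j.+1 - v ^+ j.+1).
  rewrite /D !exprS xE yE zE; field; rewrite !gt_eqF //.
have uvE : u - v = (y - x) * (u * v).
  by rewrite xE yE; field; rewrite !gt_eqF.
have zyx : 0 <= (z - y) * (z - x) by apply: mulr_ge0; lra.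
have wu : w <= u by apply: le_trans uv.
have low j : P * w ^+ (j + 2) <= (z - y) * (z - x) * (u ^+ j.+1 - v ^+ j.+1).
  have h1 : w ^+ (j + 2) <= u * v * u ^+ j.
    rewrite addnC exprD expr2; apply: ler_pM; rewrite ?mulr_ge0 ?exprn_ge0 ?(ltW w0) //.
      by apply: ler_pM; rewrite ?(ltW w0).
    by rewrite lerXn2r // nnegrE ltW.
  have h2 : (y - x) * w ^+ (j + 2) <= u ^+ j.+1 - v ^+ j.+1.
    apply: le_trans (subrXX_ge _ (ltW v0) uv); rewrite uvE -mulrA ler_wpM2l //; lra.
  have -> : P * w ^+ (j + 2) = (z - y) * (z - x) * ((y - x) * w ^+ (j + 2)).
    by rewrite /P; ring.
  exact: ler_wpM2l.
have upp j : (z - y) * (z - x) * (u ^+ j.+1 - v ^+ j.+1) <= j.+1%:R * (P * u ^+ (j + 2)).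
  have h1 : u * v * u ^+ j <= u ^+ (j + 2).
    rewrite addnC exprD expr2 ler_wpM2r ?exprn_ge0 ?(ltW u0) // ler_wpM2l // ltW //.
  have h2 : u ^+ j.+1 - v ^+ j.+1 <= j.+1%:R * ((y - x) * u ^+ (j + 2)).
    apply: le_trans (subrXX_le _ (ltW v0) uv) _; rewrite uvE -mulrA ler_wpM2l //.
    by rewrite -mulrA ler_wpM2l //; lra.
  have -> : j.+1%:R * (P * u ^+ (j + 2)) = (z - y) * (z - x) * (j.+1%:R * ((y - x) * u ^+ (j + 2))).
    by rewrite /P; ring.
  exact: ler_wpM2l.
suff H j : P * w ^+ (j.+1 + 2) <= D j.+1 <= (j.+1 ^ 2)%:R * (P * u ^+ (j.+1 + 2)).
  by move=> k0; have := H k.-1; rewrite prednK.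
elim: j => [|j /andP[IH1 IH2]].
  have D0 : D 0%N = 0 by rewrite /D !expr0; ring.
  rewrite DS D0 mulr0 add0r exp1n mul1r.
  have -> : (z - y) * (z - x) * w * (u ^+ 1 - v ^+ 1) = w * ((z - y) * (z - x) * (u ^+ 1 - v ^+ 1)) by ring.
  have -> : P * w ^+ (1 + 2) = w * (P * w ^+ (0 + 2)) by rewrite (_ : 1 + 2 = (0 + 2).+1)%N // [w ^+ _.+1]exprS; ring.
  have -> : P * u ^+ (1 + 2) = u * (P * u ^+ (0 + 2)) by rewrite (_ : 1 + 2 = (0 + 2).+1)%N // [u ^+ _.+1]exprS; ring.
  apply/andP; split; first by rewrite ler_wpM2l ?(ltW w0) //; exact: low.
  apply: ler_pM; rewrite ?(ltW w0) //.
    by apply: mulr_ge0 => //; rewrite subr_ge0 !expr1.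
  by have := upp 0%N; rewrite mul1r.
have Dj0 : 0 <= D j.+1.
  by apply: le_trans IH1; rewrite mulr_ge0 ?exprn_ge0 ?(ltW w0).
rewrite DS.
have -> : (z - y) * (z - x) * w * (u ^+ j.+2 - v ^+ j.+2) =
   w * ((z - y) * (z - x) * (u ^+ j.+2 - v ^+ j.+2)) by ring.
have l := low j.+1; have up := upp j.+1.
rewrite -mulrDr.
have E1 (t : R) : t ^+ (j.+2 + 2) = t * t ^+ (j.+1 + 2) by rewrite -exprS.
rewrite !E1; apply/andP; split.
  rewrite mulrCA ler_wpM2l ?(ltW w0) //; apply: (le_trans l); lra.
apply: (@le_trans _ _ (u * (D j.+1 + (z - y) * (z - x) * (u ^+ j.+2 - v ^+ j.+2)))).
  apply: ler_wpM2r => //; apply: addr_ge0 => //; apply: mulr_ge0 => //.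
  by rewrite subr_ge0 lerXn2r // nnegrE ltW.
have -> : (j.+2 ^ 2)%:R * (P * (u * u ^+ (j.+1 + 2))) = u * ((j.+2 ^ 2)%:R * (P * u ^+ (j.+1 + 2))) by ring.
rewrite ler_wpM2l ?(ltW u0) //.
apply: le_trans (lerD IH2 up) _.
rewrite -mulrDl -natrD ler_wpM2r //; first by rewrite mulr_ge0 ?exprn_ge0 ?(ltW u0).
by rewrite ler_nat -!mulnn mulSn mulnS; clear; lia.
Qed.

(** * Counting integers that satisfy gap conditions *)

Lemma count_fiber (R : realType) (P : pred nat) (f : nat -> nat) (J : nat) (c : nat -> R) (s : seq nat) :
  (forall x, P x -> (f x < J)%N) ->
  (forall j, (j < J)%N -> (count (fun x => P x && (f x == j)) s)%:R <= c j) ->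
  (count P s)%:R <= \sum_(0 <= j < J) c j.
Proof.
move=> HP Hc.
apply: (@le_trans _ _ (\sum_(0 <= j < J) (count (fun x => P x && (f x == j)) s)%:R)); last first.
  by rewrite big_nat_cond [X in _ <= X]big_nat_cond; apply: ler_sum => j /andP[/andP[_ jJ] _]; apply: Hc.
rewrite -natr_sum ler_nat; elim: s {Hc} => //= x s IH.
rewrite big_split /= leq_add //; case: (boolP (P x)) => //= Px.
by rewrite (bigD1_seq (f x)) ?iota_uniq ?mem_index_iota ?HP //= eqxx.
Qed.

Lemma size_diam (R : realType) (s : seq nat) (w : R) : uniq s -> 0 <= w ->
  (forall x y, x \in s -> y \in s -> (x <= y)%N -> (y - x)%:R <= w) ->
  (size s)%:R <= 1 + w.
Proof.
move=> us w0 H.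
case: (pselect (exists x, x \in s)) => [ex|nex]; last first.
  have -> : size s = 0%N; last by rewrite addr_ge0.
  by case: (s) nex => // a l []; exists a; rewrite mem_head.
case: (ex_minnP ex) => a sa Ha.
have : (size s <= size (iota a (Num.truncn w).+1))%N.
  apply: uniq_leq_size => // x xs; rewrite mem_iota Ha //=.
  have := H _ _ sa xs (Ha _ xs).
  by rewrite -truncn_ge_nat //; have := Ha _ xs; lia.
rewrite size_iota -(ler_nat R) => /le_trans; apply.
by rewrite -natr1 addrC lerD2l truncn_le.
Qed.

Lemma count_diam (R : realType) (P : pred nat) B (w : R) : 0 <= w ->
  (forall x y, P x -> P y -> (x <= y)%N -> (y - x)%:R <= w) ->
  (count P (iota 0 B))%:R <= 1 + w.
Proof.
move=> w0 H; rewrite -size_filter; apply: size_diam => //.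
  by rewrite filter_uniq ?iota_uniq.
by move=> x y; rewrite !mem_filter => /andP[Px _] /andP[Py _]; exact: H.
Qed.

Lemma count_multiples (R : realType) (P : pred nat) B q (L : R) : 0 <= L -> (0 < q)%N ->
  (forall x, P x -> (q %| x)%N) ->
  (forall x y, P x -> P y -> (x <= y)%N -> (y - x)%:R <= L) ->
  (count P (iota 0 B))%:R <= L / q%:R + 1.
Proof.
move=> L0 q0 Hq H; rewrite -size_filter -(size_map (fun n => n %/ q)%N) addrC.
have q0' : 0 < q%:R :> R by rewrite ltr0n.
apply: size_diam; last 1 first.
- move=> x y /mapP[x']; rewrite mem_filter => /andP[Px _] -> /mapP[y'].
  rewrite mem_filter => /andP[Py _] -> xy.
  rewrite ler_pdivlMr // -natrM mulnBl !divnK ?Hq //; apply: H => //.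
  by rewrite -(divnK (Hq _ Px)) -(divnK (Hq _ Py)) leq_mul2r xy orbT.
- rewrite map_inj_in_uniq ?filter_uniq ?iota_uniq // => x y.
  rewrite !mem_filter => /andP[Px _] /andP[Py _] E.
  by rewrite -(divnK (Hq _ Px)) -(divnK (Hq _ Py)) E.
- by rewrite divr_ge0.
Qed.

(** Apply the hypothesis to the least element, any element and the greatest element: every
    element lies within [rho] of one of the two extreme ones. *)
Lemma count_near_ends (R : realType) (P : pred nat) B (rho : R) : 0 <= rho ->
  (forall x y z, P x -> P y -> P z -> (x < y)%N -> (y < z)%N ->
    (y - x)%:R * (z - y)%:R <= rho ^+ 2) ->
  (count P (iota 0 B))%:R <= 2 * (rho + 1).
Proof.
move=> w0 H; rewrite -size_filter; set s := [seq x <- _ | _].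
have us : uniq s by rewrite filter_uniq ?iota_uniq.
have Ps x : x \in s -> P x by rewrite mem_filter => /andP[].
case: (pselect (exists x, x \in s)) => [ex|nex]; last first.
  have -> : size s = 0%N; last by rewrite mulr_ge0 // addr_ge0.
  by case: (s) nex => // a l []; exists a; rewrite mem_head.
have bd x : x \in s -> (x <= B)%N by rewrite mem_filter mem_iota => /andP[_]; lia.
case: (ex_minnP ex) => a sa Ha.
case: (ex_maxnP ex bd) => b sb Hb.
have [r [rS rle]] : exists r : nat, rho < r.+1%:R /\ r%:R <= rho.
  by exists (Num.truncn rho); rewrite truncnS_gt truncn_le.
have : (size s <= size (iota a r.+1 ++ iota (b - r) r.+1))%N.
  apply: uniq_leq_size => // x xs; rewrite mem_cat !mem_iota Ha //=.
  have xb := Hb _ xs; have ax := Ha _ xs.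
  case: (ltnP x (a + r.+1)) => //= h1; rewrite leq_subLR.
  case: (leqP b (r + x)) => h2 /=; first by lia.
  have := H _ _ _ (Ps _ sa) (Ps _ xs) (Ps _ sb) ltac:(lia) ltac:(lia).
  have g1 : rho < (x - a)%:R.
    by apply: (lt_le_trans rS); rewrite ler_nat; lia.
  have g2 : rho < (b - x)%:R.
    by apply: (lt_le_trans rS); rewrite ler_nat; lia.
  by rewrite expr2 => h; exfalso; nra.
rewrite size_cat !size_iota -(ler_nat R) => /le_trans; apply.
by rewrite natrD -natr1; lra.
Qed.

Lemma sum_count (R : realType) (P : pred nat) B : \sum_(0 <= n < B) (P n)%:R = (count P (iota 0 B))%:R :> R.
Proof.
rewrite -natr_sum; congr (_%:R); rewrite /index_iota subn0.
by elim: (iota 0 B) => [|a s IH]; rewrite ?big_nil // big_cons /= IH.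
Qed.

Lemma harmonic_le (R : realType) (M : nat) : (0 < M)%N ->
  \sum_(1 <= m < M.+1) (m%:R : R)^-1 <= 1 + ln M%:R.
Proof.
elim: M => // M IH _; case: (posnP M) => [->|M0].
  by rewrite big_nat1 ln1 addr0 invr1.
rewrite big_nat_recr //=; have := IH M0.
have M0' : 0 < M%:R :> R by rewrite ltr0n.
have M1' : 0 < M.+1%:R :> R by [].
have : ln (M%:R / M.+1%:R) <= M%:R / M.+1%:R - 1 :> R.
  rewrite {1}(_ : M%:R / M.+1%:R = 1 + (M%:R / M.+1%:R - 1)); last by ring.
  apply: le_ln1Dx; rewrite ltrBDr addrC subrr divr_gt0 //.
rewrite ln_div ?posrE //.
have -> : M%:R / M.+1%:R - 1 = - M.+1%:R^-1 :> R.
  by rewrite -natr1; field; rewrite natr1 gt_eqF.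
move=> h1 h2; apply: le_trans (lerD h2 (lexx _)) _.
by move: (ln M%:R) (ln M.+1%:R) (M.+1%:R^-1) h1 => a b c h1; lra.
Qed.

(** * Powers with a multiple in a short window *)

(** Equivalently, [e ^ k] has a multiple in the window (N - K, N]: only its largest multiple
    up to [N] has to be tested. *)
Definition hit (R : realType) (N K : R) (k e : nat) : bool :=
  N - K < (e ^ k * (Num.truncn N %/ e ^ k))%:R.

Lemma hit_bounds (R : realType) (N K : R) k e : 0 <= K <= N -> (0 < k)%N -> hit N K k e ->
  [/\ (0 < e)%N, (0 < Num.truncn N %/ e ^ k)%N,
     N - K < e%:R ^+ k * (Num.truncn N %/ e ^ k)%:R &
     e%:R ^+ k * (Num.truncn N %/ e ^ k)%:R <= N].
Proof.
move=> /andP[K0 KN] k0 h.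
have h' : N - K < e%:R ^+ k * (Num.truncn N %/ e ^ k)%:R by rewrite -natrX -natrM.
have le : e%:R ^+ k * (Num.truncn N %/ e ^ k)%:R <= N.
  rewrite -natrX -natrM; apply: (@le_trans _ _ (Num.truncn N)%:R); last first.
    by rewrite truncn_le (le_trans K0).
  by rewrite ler_nat mulnC leq_trunc_div.
have NK : 0 <= N - K by rewrite subr_ge0.
split => //; rewrite lt0n; apply/eqP => E.
  by move: h'; rewrite E expr0n gtn_eqF //= mul0r; lra.
by move: h'; rewrite E mulr0; lra.
Qed.

(** Sort the hits by the quotient [j] of [N] by [e ^ k].  For a fixed [j] all values [j e ^ k]
    lie in the window, which confines [e] to an interval of length [kap / j]. *)
Lemma count_hits_large (R : realType) (N K kap y : R) k B : (2 <= k)%N -> 0 <= K <= N ->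
  1 <= y -> 0 <= kap <= y -> K <= kap ^+ k -> 1 <= N ->
  (count (fun e => (y < e%:R) && hit N K k e) (iota 0 B))%:R <=
  N / y ^+ k + kap * (1 + ln N).
Proof.
move=> k2 KN y1 /andP[kap0 kapy] Kkap N1.
have k0 : (0 < k)%N by rewrite (leq_trans _ k2).
have y0 : 0 < y by lra.
have yk j : 1 <= y ^+ j by rewrite exprn_ege1.
have yk0 j : 0 < y ^+ j by rewrite exprn_gt0.
pose M := Num.truncn (N / y ^+ k).
have N0 : 0 <= N / y ^+ k by rewrite divr_ge0 ?ltW //; lra.
have MN : M%:R <= N / y ^+ k by rewrite truncn_le.
pose c (j : nat) : R := if j == 0%N then 0 else 1 + kap / j%:R.
have := @count_fiber R (fun e => (y < e%:R) && hit N K k e)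
  (fun e => Num.truncn N %/ e ^ k)%N M.+1 c (iota 0 B).
move=> /(_ _ _)/le_trans; apply.
- move=> e /andP[ye he]; have [e0 q0 h1 h2] := hit_bounds KN k0 he.
  rewrite ltnS truncn_ge_nat // ler_pdivlMr // mulrC.
  by apply: le_trans h2; rewrite ler_wpM2r // le_exprn2 // ltW.
- move=> j _; rewrite /c; case: eqP => [->|/eqP j0].
    rewrite (@eq_count _ _ pred0) ?count_pred0 // => e /=.
    apply/negP => /andP[/andP[_ he] /eqP E].
    by have [_ + _ _] := hit_bounds KN k0 he; rewrite E.
  have j0' : 0 < j%:R :> R by rewrite ltr0n lt0n.
  apply: count_diam; first by rewrite divr_ge0.
  move=> x z /andP[/andP[yx hx] /eqP qx] /andP[/andP[yz hz] /eqP qz] xz.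
  have [_ _ h1 _] := hit_bounds KN k0 hx; have [_ _ _ h2] := hit_bounds KN k0 hz.
  rewrite qx in h1; rewrite qz in h2.
  have xz' : x%:R <= z%:R :> R by rewrite ler_nat.
  have := @subrXX_ge R z%:R x%:R k.-1 (ler0n _ _) xz'; rewrite prednK // => h3.
  rewrite natrB // ler_pdivlMr //.
  have h4 : (z%:R - x%:R) * j%:R * y ^+ k.-1 <= kap * y ^+ k.-1.
    apply: (@le_trans _ _ K).
      apply: (@le_trans _ _ ((z%:R ^+ k - x%:R ^+ k) * j%:R)); last by rewrite mulrBl; lra.
      rewrite mulrAC ler_wpM2r ?(ltW j0') //; apply: le_trans h3.
      by rewrite ler_wpM2l ?subr_ge0 // le_exprn2 // ltW.
    apply: (le_trans Kkap); by rewrite -{1}(prednK k0) exprS ler_wpM2l // le_exprn2.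
  by move: h4; rewrite ler_pM2r.
rewrite big_ltn // {1}/c eqxx add0r.
have -> : \sum_(1 <= i < M.+1) c i = \sum_(1 <= i < M.+1) (1 + kap * i%:R^-1).
  by apply: eq_big_nat => i /andP[i1 _]; rewrite /c gtn_eqF.
rewrite big_split /= sumr_const_nat subn1 /= -mulr_sumr.
apply: lerD => //; rewrite ler_wpM2l //.
have [M0|M0] := posnP M; first by rewrite M0 big_geq // addr_ge0 // ln_ge0.
apply: (le_trans (harmonic_le _ M0)); rewrite lerD2l ler_ln ?posrE ?ltr0n //; last by lra.
apply: (le_trans MN); rewrite ler_pdivrMr // ler_peMr //; lra.
Qed.

Lemma intr_norm_lt1 (R : numDomainType) (d : int) : `|d%:~R : R| < 1 -> d = 0.
Proof. by rewrite -intr_norm (ltr_int _ _ 1); lia. Qed.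

(** Three hits in a short window give an integral second difference of absolute
    value less than one; it vanishes, and the curvature of [N / t ^ k] then
    forces the middle one to lie near one of the outer two. *)
Lemma three_hits (R : realType) (N K y0 y1 A : R) k e1 e2 e3 : (0 < k)%N -> 0 <= K <= N -> 0 < N ->
  0 < y0 -> y0 < e1%:R -> (e1 < e2)%N -> (e2 < e3)%N -> e3%:R <= y1 -> e3%:R - e1%:R <= A ->
  hit N K k e1 -> hit N K k e2 -> hit N K k e3 ->
  (k ^ 2)%:R * A ^+ 3 * N * y0^-1 ^+ (k + 2) + A * (K * y0^-1 ^+ k) < 1 ->
  (e2 - e1)%:R * (e3 - e2)%:R <= K * y1 ^+ (k + 2) / (y0 ^+ k * N).
Proof.
move=> k0 KN N0 y00 ye1 e12 e23 ey1 eA h1 h2 h3 Hs.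
have /andP[K0 _] := KN.
pose m e := (Num.truncn N %/ e ^ k)%N.
pose th e := N * e%:R^-1 ^+ k - (m e)%:R.
have x12 : e1%:R < e2%:R :> R by rewrite ltr_nat.
have x23 : e2%:R < e3%:R :> R by rewrite ltr_nat.
have thP e : y0 < e%:R -> hit N K k e -> 0 <= th e <= K * y0^-1 ^+ k.
  move=> ye he; have [e0 _ a1 a2] := hit_bounds KN k0 he.
  have ek : 0 < e%:R ^+ k :> R by rewrite exprn_gt0 // ltr0n.
  rewrite /th exprVn; apply/andP; split.
    by rewrite subr_ge0 ler_pdivlMr // mulrC.
  apply: (@le_trans _ _ (K * (e%:R ^+ k)^-1)).
    by rewrite ler_pdivlMr // mulrBl mulfVK ?gt_eqF //; move: a1; rewrite mulrC; lra.
  by rewrite exprVn ler_wpM2l // lef_pV2 ?posrE ?ek ?exprn_gt0 // le_exprn2 // ltW.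
have /andP[t1 t1'] := thP _ ye1 h1.
have /andP[t2 t2'] := thP _ (lt_trans ye1 x12) h2.
have /andP[t3 t3'] := thP _ (lt_trans ye1 (lt_trans x12 x23)) h3.
have x0 : 0 < e1%:R :> R by lra.
have /andP[] := divided_difference_bounds x0 x12 x23 k0.
set x := e1%:R in x0 x12 ye1 eA *; set y := e2%:R in x12 x23 *.
set z := e3%:R in x23 ey1 eA *.
set P := (_ - _) * _ * _; set Num := (_ - _ + _) => win_lo up.
pose Dl : int := (e3%:Z - e2%:Z) * (m e1)%:Z - (e3%:Z - e1%:Z) * (m e2)%:Z + (e2%:Z - e1%:Z) * (m e3)%:Z.
pose br := (z - y) * th e1 - (z - x) * th e2 + (y - x) * th e3.
have DlE : Dl%:~R = N * Num - br.
  rewrite /Dl /Num /br /th !intrD !intrM !intrN !intrM !intrB.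
  by rewrite -!pmulrn; ring.
set dl := K * y0^-1 ^+ k in t1' t2' t3' Hs.
have dl0 : 0 <= dl by lra.
have br1 : br <= (z - x) * dl.
  have -> : (z - x) * dl = (z - y) * dl + (y - x) * dl by ring.
  rewrite /br; have : 0 <= (z - x) * th e2 by apply: mulr_ge0 => //; lra.
  have : (z - y) * th e1 <= (z - y) * dl by apply: ler_wpM2l => //; lra.
  have : (y - x) * th e3 <= (y - x) * dl by apply: ler_wpM2l => //; lra.
  lra.
have br2 : - ((z - x) * dl) <= br.
  rewrite /br; have : (z - x) * th e2 <= (z - x) * dl by apply: ler_wpM2l => //; lra.
  have : 0 <= (z - y) * th e1 by apply: mulr_ge0 => //; lra.
  have : 0 <= (y - x) * th e3 by apply: mulr_ge0 => //; lra.
  lra.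
have P0 : 0 < P by rewrite /P; do ![apply: mulr_gt0]; lra.
have A0 : 0 < A by lra.
have zxdl : (z - x) * dl <= A * dl by apply: ler_wpM2r.
have z0 : 0 < z by lra.
have Num0 : 0 < Num.
  by apply: lt_le_trans win_lo; rewrite mulr_gt0 // exprn_gt0 // invr_gt0.
have NumU : N * Num <= (k ^ 2)%:R * A ^+ 3 * N * y0^-1 ^+ (k + 2).
  have -> : (k ^ 2)%:R * A ^+ 3 * N * y0^-1 ^+ (k + 2) = N * ((k ^ 2)%:R * (A ^+ 3 * y0^-1 ^+ (k + 2))) by ring.
  rewrite ler_wpM2l ?(ltW N0) //; apply: (le_trans up); rewrite ler_wpM2l //.
  apply: ler_pM; rewrite ?(ltW P0) ?exprn_ge0 ?invr_ge0 ?(ltW x0) //.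
    rewrite !exprS expr0 mulr1 mulrA.
    have g1 : 0 <= y - x <= A by clear - x12 x23 eA; lra.
    have g2 : 0 <= z - y <= A by clear - x12 x23 eA; lra.
    have g3 : 0 <= z - x <= A by clear - x12 x23 eA; lra.
    move: g1 g2 g3 => /andP[? ?] /andP[? ?] /andP[? ?].
    by apply: ler_pM; rewrite ?mulr_ge0 //; apply: ler_pM.
  by rewrite le_exprn2 ?invr_ge0 ?(ltW x0) // lef_pV2 ?posrE // ltW.
have D1 : `|Dl%:~R : R| < 1.
  rewrite DlE ltr_norml; have : 0 < N * Num by rewrite mulr_gt0.
  by move: br1 br2 zxdl NumU Hs; lra.
have Dl0 : Dl = 0 by apply: intr_norm_lt1 D1.
have NE : N * Num <= (z - x) * dl.
  by move: DlE; rewrite Dl0 /= => DlE; lra.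
have fin : N * ((y - x) * (z - y) * z^-1 ^+ (k + 2)) <= dl.
  have zx : 0 < z - x by lra.
  rewrite -(ler_pM2r zx) [X in _ <= X]mulrC; apply: le_trans NE.
  have -> : N * ((y - x) * (z - y) * z^-1 ^+ (k + 2)) * (z - x) = N * (P * z^-1 ^+ (k + 2)).
    by rewrite /P; ring.
  by apply: ler_wpM2l; first exact: ltW.
have -> : (e2 - e1)%:R = y - x by rewrite natrB // ltnW.
have -> : (e3 - e2)%:R = z - y by rewrite natrB // ltnW.
rewrite ler_pdivlMr ?mulr_gt0 ?exprn_gt0 //.
have zk : 0 < z ^+ (k + 2) by rewrite exprn_gt0.
have yk : 0 < y0 ^+ k by rewrite exprn_gt0.
have -> : (y - x) * (z - y) * (y0 ^+ k * N) =
  N * ((y - x) * (z - y) * z^-1 ^+ (k + 2)) * (z ^+ (k + 2) * y0 ^+ k).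
  by rewrite exprVn; field; rewrite gt_eqF.
apply: (@le_trans _ _ (dl * (z ^+ (k + 2) * y0 ^+ k))).
  by rewrite ler_wpM2r // mulr_ge0 // ltW.
have -> : dl * (z ^+ (k + 2) * y0 ^+ k) = K * z ^+ (k + 2).
  by rewrite /dl exprVn; field; rewrite gt_eqF.
by rewrite ler_wpM2l // le_exprn2 // ltW.
Qed.

Lemma sub_same_quotient A a c : (0 < A)%N -> (c %/ A = a %/ A)%N -> (c - a <= A)%N.
Proof. by move=> A0; have := divn_eq a A; have := divn_eq c A; have := ltn_pmod c A0; lia. Qed.

(** Cut [(y0, y1]] into blocks of length [A].  In each block [three_hits] shows that all hits
    lie near the first or the last one. *)
Lemma count_hits_middle (R : realType) (N K y0 y1 rho : R) (A : nat) k B : (0 < k)%N -> 0 <= K <= N -> 0 < N ->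
  0 < y0 -> 0 <= y1 -> (0 < A)%N -> 0 <= rho ->
  (k ^ 2)%:R * A%:R ^+ 3 * N * y0^-1 ^+ (k + 2) + A%:R * (K * y0^-1 ^+ k) < 1 ->
  K * y1 ^+ (k + 2) <= rho ^+ 2 * (y0 ^+ k * N) ->
  (count (fun e => [&& y0 < e%:R, e%:R <= y1 & hit N K k e]) (iota 0 B))%:R <=
  (y1 / A%:R + 1) * (2 * (rho + 1)).
Proof.
move=> k0 KN N0 y00 y10 A0 r0 H1 H2.
have A0' : 0 < A%:R :> R by rewrite ltr0n.
have d0 : 0 <= y1 / A%:R by rewrite divr_ge0.
pose J := Num.truncn (y1 / A%:R).
have := @count_fiber R (fun e => [&& y0 < e%:R, e%:R <= y1 & hit N K k e])
  (fun e => e %/ A)%N J.+1 (fun=> 2 * (rho + 1)) (iota 0 B).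
move=> /(_ _ _)/le_trans; apply.
- move=> e /and3P[_ ey _]; rewrite ltnS truncn_ge_nat // ler_pdivlMr // -natrM.
  by apply: le_trans ey; rewrite ler_nat leq_trunc_div.
- move=> j _; apply: count_near_ends => // a b c.
  move=> /andP[/and3P[ya _ ha] /eqP aj] /andP[/and3P[_ _ hb] _] /andP[/and3P[_ cy hc] /eqP cj] ab bc.
  have ca : c%:R - a%:R <= A%:R :> R.
    rewrite -natrB ?ler_nat; last by rewrite ltnW // (ltn_trans ab).
    by apply: sub_same_quotient A0 _; rewrite aj cj.
  apply: le_trans (three_hits k0 KN N0 y00 ya ab bc cy ca ha hb hc H1) _.
  by rewrite ler_pdivrMr // mulr_gt0 // exprn_gt0.
rewrite sumr_const_nat subn0 -[X in X <= _]mulr_natl; apply: ler_wpM2r.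
  by rewrite mulr_ge0 // addr_ge0.
by rewrite -natr1 lerD2r truncn_le.
Qed.

Lemma powR_absorb (R : realType) (C a b : R) : a < b ->
  exists2 N0 : R, 1 <= N0 & forall N, N0 <= N -> C * N `^ a <= N `^ b.
Proof.
move=> ab; have d0 : 0 < b - a by rewrite subr_gt0.
pose M := Num.max C 1; have M1 : 1 <= M by rewrite /M le_max lexx orbT.
exists (M `^ (b - a)^-1).
  have := le_powR2 (ltW (_ : 0 < (b - a)^-1)) ler01 M1; rewrite powR1; apply; by rewrite invr_gt0.
move=> N hN; have N0 : 0 < N by apply: lt_le_trans hN; rewrite powR_gt0 // (lt_le_trans _ M1).
have -> : N `^ b = N `^ (b - a) * N `^ a.
  by rewrite -powRD ?subrK // (gt_eqF N0) implybT.
apply: ler_wpM2r; first exact: powR_ge0.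
apply: (@le_trans _ _ M); first by rewrite /M le_max lexx.
have -> : M = (M `^ (b - a)^-1) `^ (b - a).
  by rewrite -powRrM mulVf ?gt_eqF // powRr1 // (le_trans _ M1).
by apply: le_powR2 hN; [exact: ltW|exact: powR_ge0].
Qed.

Lemma ln_le_powR (R : realType) (eps N : R) : 0 < eps -> 1 <= N -> ln N <= eps^-1 * N `^ eps.
Proof.
move=> e0 N1; have N0 : 0 < N by rewrite (lt_le_trans _ N1).
rewrite -ler_pdivrMl ?invr_gt0 // invrK -ln_powR ltW // ln_sublinear // powR_gt0 //.
Qed.

Lemma powR_root_exp (R : realType) (K : R) k : 0 <= K -> (0 < k)%N -> (K `^ k%:R^-1) ^+ k = K.
Proof.
move=> K0 k0; rewrite -powR_mulrn ?powR_ge0 // -powRrM mulVf ?powRr1 //.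
by rewrite pnatr_eq0 -lt0n.
Qed.

Lemma lt_root_exp (R : realType) (K : R) k e : 0 <= K -> (0 < k)%N ->
  (K < e%:R ^+ k) = (K `^ k%:R^-1 < e%:R).
Proof.
move=> K0 k0; rewrite -[X in X < _ ^+ k](powR_root_exp K0 k0).
by apply: ltr_pXn2r; rewrite ?nnegrE ?powR_ge0.
Qed.

Lemma count_le_bound (R : realType) (y : R) B : 0 <= y ->
  (count (fun e : nat => (0 < e)%N && (e%:R <= y)) (iota 0 B))%:R <= y.
Proof.
move=> y0; apply: (@le_trans _ _ (Num.truncn y)%:R); last by rewrite truncn_le.
rewrite ler_nat -size_filter -[X in (_ <= X)%N](size_iota 1).
apply: uniq_leq_size; first by rewrite filter_uniq // iota_uniq.
move=> e; rewrite mem_filter mem_iota => /andP[/andP[e0 ey] _].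
by rewrite mem_iota e0 add1n ltnS truncn_ge_nat.
Qed.

Definition tail_hit (R : realType) (N K : R) k e := (K < e%:R ^+ k) && hit N K k e.

(** Integers up to [N ^ (1 / (k + 1))] are counted trivially. *)
Lemma tail_hits_any (R : realType) (N K : R) k B : (2 <= k)%N -> 1 <= K -> K <= N ->
  (count (tail_hit N K k) (iota 0 B))%:R <=
  2 * N `^ (k%:R + 1)^-1 + K `^ k%:R^-1 * (1 + ln N).
Proof.
move=> k2 K1 KN; have k0 : (0 < k)%N by rewrite (leq_trans _ k2).
have N1 : 1 <= N by apply: le_trans KN.
have N0 : 0 < N by lra.
have KN' : 0 <= K <= N by rewrite KN andbT; lra.
set Q := N `^ _; set kap := K `^ _.
have Q1 : 1 <= Q by have := le_powR2 (_ : 0 <= (k%:R + 1)^-1) ler01 N1; rewrite powR1; apply; rewrite invr_ge0 addr_ge0.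
have Qk : N / Q ^+ k = Q.
  apply/(canLR (mulfK _)); first by rewrite gt_eqF // exprn_gt0 // (lt_le_trans _ Q1).
  by rewrite -exprS /Q natr1 powR_root_exp // ltW.
pose y := Num.max Q kap.
have y1 : 1 <= y by rewrite /y le_max Q1.
pose p1 (e : nat) := (0 < e)%N && (e%:R <= Q).
pose p2 e := (y < e%:R) && hit N K k e.
have h : (count (tail_hit N K k) (iota 0 B) <= count p1 (iota 0 B) + count p2 (iota 0 B))%N.
  rewrite -count_predUI; apply: leq_trans (leq_addr _ _); apply: sub_count => e /andP[/= Ke he].
  have [e0 _ _ _] := hit_bounds KN' k0 he.
  rewrite /p1 /p2 e0 he andbT /=; case: (leP e%:R Q) => //= Qe.
  by rewrite /y gt_max Qe -lt_root_exp // (le_trans _ K1).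
move: h; rewrite -(ler_nat R) natrD => /le_trans; apply.
have -> : 2 * Q + kap * (1 + ln N) = Q + (Q + kap * (1 + ln N)) by ring.
apply: lerD; first by apply: count_le_bound; rewrite (le_trans _ Q1).
have := @count_hits_large R N K kap y k B k2 KN' y1 _ _ N1 => /(_ _ _)/le_trans; apply.
- by rewrite powR_ge0 /y le_max lexx orbT.
- by rewrite powR_root_exp // (le_trans _ K1).
rewrite lerD2r -[X in _ <= X]Qk ler_wpM2l ?(ltW N0) // lef_pV2 ?posrE ?exprn_gt0 ?(lt_le_trans _ y1) ?(lt_le_trans _ Q1) //.
by apply: le_exprn2; rewrite ?(le_trans _ Q1) // /y le_max lexx.
Qed.

(** The three ranges [e <= N ^ a0], [N ^ a0 < e <= N ^ a1] and [e > N ^ a1] are treated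
    trivially, by [count_hits_middle] with blocks of length [N ^ al] and [rho = N ^ r], and by
    [count_hits_large].  The hypotheses on the exponents say that the conditions of
    [three_hits] hold and that each range contributes at most [N ^ b]. *)
Lemma tail_hits_short (R : realType) k (a0 a1 al r tau b : R) : (2 <= k)%N ->
  0 <= a0 -> 0 <= a1 -> 0 < al -> 0 <= r -> 0 <= 2^-1 + tau ->
  3 * al + 1 - (k%:R + 2) * a0 < 0 -> al + 2^-1 + tau - k%:R * a0 < 0 ->
  2^-1 + tau + (k%:R + 2) * a1 - k%:R * a0 - 1 <= 2 * r ->
  al <= a1 -> a0 <= b -> a1 - al + r <= b -> 1 - k%:R * a1 <= b ->
  exists2 N0 : R, 1 <= N0 & forall N K B, N0 <= N -> 1 <= K -> K <= N -> K <= N `^ (2^-1 + tau) ->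
   (count (tail_hit N K k) (iota 0 B))%:R <= 14 * N `^ b + K `^ k%:R^-1 * (1 + ln N).
Proof.
move=> k2 a00 a10 al0 r0 tau0 H1 H2 H3 ala1 a0b ab1 ab2.
have k0 : (0 < k)%N by rewrite (leq_trans _ k2).
have [M1 M1_1 HM1] := @powR_absorb R (4 * (k ^ 2)%:R) (3 * al + 1 - (k%:R + 2) * a0) 0 H1.
have [M2 M2_1 HM2] := @powR_absorb R 4 (al + 2^-1 + tau - k%:R * a0) 0 H2.
exists (Num.max M1 M2); first by rewrite le_max M1_1.
move=> N K B; rewrite ge_max => /andP[NM1 NM2] K1 KN Ktau.
have N1 : 1 <= N by apply: le_trans KN.
have N0 : 0 < N by lra.
have Nne : N != 0 by rewrite gt_eqF.
have KN' : 0 <= K <= N by rewrite KN andbT; lra.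
have ND x y : N `^ (x + y) = N `^ x * N `^ y by rewrite powRD // Nne implybT.
have NX x j : (N `^ x) ^+ j = N `^ (j%:R * x) by rewrite -powR_mulrn ?powR_ge0 // -powRrM mulrC.
have Npos x : 0 < N `^ x by rewrite powR_gt0.
have Nle x z : x <= z -> N `^ x <= N `^ z by move=> xz; apply: ler_powR.
have N1le x : 0 <= x -> 1 <= N `^ x by move=> x0; rewrite -(powRr0 N); apply: Nle.
pose y0 := N `^ a0; pose y1 := N `^ a1.
set kap := K `^ _.
pose y := Num.max y1 kap.
pose A := Num.truncn (N `^ al).
have A1 : 1 <= N `^ al by apply: N1le; exact: ltW.
have A0 : (0 < A)%N by rewrite truncn_gt0.
have AN : A%:R <= N `^ al by rewrite truncn_le powR_ge0.
have AN2 : N `^ al <= 2 * A%:R.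
  have : N `^ al < A.+1%:R by apply: truncnS_gt.
  have : 1 <= A%:R :> R by rewrite ler1n.
  by rewrite -natr1; lra.
pose p1 (e : nat) := (0 < e)%N && (e%:R <= y0).
pose p2 (e : nat) := [&& y0 < e%:R, e%:R <= y1 & hit N K k e].
pose p3 e := (y < e%:R) && hit N K k e.
have h : (count (tail_hit N K k) (iota 0 B) <=
   count p1 (iota 0 B) + (count p2 (iota 0 B) + count p3 (iota 0 B)))%N.
  apply: (@leq_trans (count p1 (iota 0 B) + count (predU p2 p3) (iota 0 B))%N); last first.
    by rewrite leq_add2l -count_predUI leq_addr.
  rewrite -count_predUI; apply: leq_trans (leq_addr _ _); apply: sub_count => e /andP[/= Ke he].
  have [e0 _ _ _] := hit_bounds KN' k0 he.
  rewrite /p1 /p2 /p3 e0 he !andbT /=; case: (leP e%:R y0) => //= Qe; case: (leP e%:R y1) => //= Qe1.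
  by rewrite /y gt_max Qe1 -lt_root_exp // (le_trans _ K1).
move: h; rewrite -(ler_nat R) !natrD => /le_trans; apply.
have -> : 14 * N `^ b + kap * (1 + ln N) = N `^ b + (12 * N `^ b + (N `^ b + kap * (1 + ln N))) by ring.
apply: lerD.
  by apply: le_trans (Nle _ _ a0b); apply: count_le_bound; exact: powR_ge0.
apply: lerD; last first.
  have y1_1 : 1 <= y by rewrite /y le_max N1le.
  have := @count_hits_large R N K kap y k B k2 KN' y1_1 _ _ N1 => /(_ _ _)/le_trans; apply.
  - by rewrite powR_ge0 /y le_max lexx orbT.
  - by rewrite powR_root_exp // (le_trans _ K1).
  rewrite lerD2r; apply: le_trans (Nle _ _ ab2).
  rewrite ND powRr1 ?(ltW N0) // powRN -NX ler_wpM2l ?(ltW N0) // lef_pV2 ?posrE ?exprn_gt0 ?(lt_le_trans _ y1_1) //.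
  by apply: le_exprn2; rewrite ?(ltW (Npos _)) // /y le_max lexx.
have := @count_hits_middle R N K y0 y1 (N `^ r) A k B k0 KN' N0 (Npos _) (ltW (Npos _)) A0 (ltW (Npos _)).
move=> /(_ _ _)/le_trans; apply.
- have i1 : (k ^ 2)%:R * A%:R ^+ 3 * N * y0^-1 ^+ (k + 2) <= 4^-1.
    apply: (@le_trans _ _ ((k ^ 2)%:R * N `^ (3 * al + 1 - (k%:R + 2) * a0))); last first.
      by have := HM1 _ NM1; rewrite powRr0; lra.
    rewrite exprVn NX natrD ND powRN ND powRr1 ?(ltW N0) // -NX.
    have : A%:R ^+ 3 <= (N `^ al) ^+ 3 by exact: le_exprn2.
    move: (A%:R ^+ 3) ((N `^ al) ^+ 3) => u v uv; rewrite !mulrA.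
    by rewrite ler_wpM2r ?invr_ge0 ?(ltW (Npos _)) // ler_wpM2r ?(ltW N0) // ler_wpM2l //.
  have i2 : A%:R * (K * y0^-1 ^+ k) <= 4^-1.
    apply: (@le_trans _ _ (N `^ (al + 2^-1 + tau - k%:R * a0))); last first.
      by have := HM2 _ NM2; rewrite powRr0; lra.
    rewrite exprVn NX -(addrA al) ND ND powRN -mulrA; apply: ler_pM => //.
      by rewrite mulr_ge0 ?invr_ge0 ?(ltW (Npos _)) //; lra.
    by rewrite ler_wpM2r ?invr_ge0 ?(ltW (Npos _)).
  lra.
- apply: (@le_trans _ _ (N `^ (2^-1 + tau) * N `^ ((k%:R + 2) * a1))).
    rewrite /y1 NX natrD; apply: ler_wpM2r => //; exact: ltW.
  have -> : (N `^ r) ^+ 2 * (y0 ^+ k * N) = N `^ (2 * r + (k%:R * a0 + 1)).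
    by rewrite /y0 !NX !ND powRr1 // ltW.
  by rewrite -ND; apply: Nle; lra.
have e1 : y1 / A%:R + 1 <= 3 * N `^ (a1 - al).
  have -> : N `^ (a1 - al) = y1 / N `^ al by rewrite ND powRN.
  have : 1 <= y1 / N `^ al by rewrite ler_pdivlMr // mul1r; apply: Nle.
  have : y1 / A%:R <= 2 * (y1 / N `^ al).
    rewrite mulrCA ler_wpM2l ?(ltW (Npos _)) // -[2]invrK -invfM lef_pV2 ?posrE ?ltr0n ?mulr_gt0 ?invr_gt0 //.
    lra.
  lra.
have e2 : 2 * (N `^ r + 1) <= 4 * N `^ r by have := N1le _ r0; lra.
apply: (@le_trans _ _ ((3 * N `^ (a1 - al)) * (4 * N `^ r))).
  apply: ler_pM => //; first by rewrite addr_ge0 // divr_ge0 // ?(ltW (Npos _)).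
  by rewrite mulr_ge0 // addr_ge0 // ?(ltW (Npos _)).
have -> : 3 * N `^ (a1 - al) * (4 * N `^ r) = 12 * N `^ (a1 - al + r) by rewrite (ND (a1 - al)); ring.
by apply: ler_wpM2l => //; apply: Nle.
Qed.

(** * Admissible exponents of the counting argument *)

Lemma delta_lt (R : realType) k : (3 <= k)%N -> delta R k < 1 / (k%:R + 1).
Proof.
move=> k3; rewrite /delta gtn_eqF //=; set x : R := k%:R.
have x3 : 3 <= x by rewrite /x ler_nat.
have x1 : 0 < 1 / (x + 1) by rewrite divr_gt0 //; lra.
rewrite -[X in _ < X]mulr1 ltr_pM2l // gtrDl oppr_lt0 divr_gt0 //.
  have -> : 3 * x ^+ 3 - 6 * x ^+ 2 - x + 4 = (x - 1) * (3 * (x - 3) * x + 6 * x - 4).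
    by ring.
  by apply: mulr_gt0; nra.
have y j : 0 < x ^+ j by apply: exprn_gt0; lra.
have := y 5%N; have := y 4%N; have := y 3%N; have := y 2%N; lra.
Qed.

(** The tail bound only needs some exponent below [delta k]; for [k >= 3] the value
    [(1 - 1 / (18 k)) / (k + 1)] is one. *)
Lemma exponents_exist (R : realType) k : (2 <= k)%N ->
  exists a0 a1 al r tau : R,
  [/\ 0 < tau, 0 < a0, a0 < delta R k, 0 <= a1 & 0 < al] /\
  [/\ 0 <= r, 3 * al + 1 - (k%:R + 2) * a0 < 0, al + 2^-1 + tau - k%:R * a0 < 0,
      2^-1 + tau + (k%:R + 2) * a1 - k%:R * a0 - 1 <= 2 * r & al <= a1] /\
  a1 - al + r <= a0 /\ 1 - k%:R * a1 <= a0.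
Proof.
move=> k2; set x : R := k%:R.
have x2 : 2 <= x by rewrite /x ler_nat.
pose eps : R := if k == 2%N then 100^-1 else 18^-1 / x.
pose i := (x + 1)^-1.
have i0 : 0 < i by rewrite invr_gt0; lra.
have xi : x * i = 1 - i by rewrite /i; field; rewrite gt_eqF //; lra.
have i3 : i <= 3^-1 by rewrite lef_pV2 ?posrE //; lra.
have xn0 : x != 0 by rewrite gt_eqF //; lra.
have eps0 : 0 < eps by rewrite /eps; case: ifP => _; rewrite ?divr_gt0 ?invr_gt0 //; lra.
pose e2 := eps / x; pose u := eps * i; pose v := e2 * i.
have e20 : 0 < e2 by rewrite divr_gt0 //; lra.
have u0 : 0 < u by rewrite mulr_gt0.
have v0 : 0 < v by rewrite mulr_gt0.
have u3 : u <= eps / 3 by rewrite /u; nra.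
have v3 : v <= e2 / 3 by rewrite /v; nra.
have vE : e2 - v = u.
  rewrite /v -[X in X - _]mulr1 -mulrBr (_ : 1 - i = x * i); last by rewrite xi.
  by rewrite /e2 /u mulrA mulfVK.
have main : [/\ (1 - eps) * i < delta R k, eps * (1 + i) < i * (19 / 20),
    4 / 3 * i + 2 / 3 * eps < 2^-1,
    v + 4 / 3 * u + eps / 3 <= i * (19 / 60) &
    v + 4 / 3 * u + eps / 3 + (e2 + v + eps - u) / 2 <= 4^-1 - i * (83 / 120) ].
  case: (eqVneq k 2%N) => [k2'|kn2].
    have xE : x = 2 by rewrite /x k2'.
    have iE : i = 3^-1 by rewrite /i xE; congr (_^-1); ring.
    have eE : eps = 100^-1 by rewrite /eps k2' eqxx.
    have e2E : e2 = 200^-1 by rewrite /e2 eE xE; field.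
    have uE : u = 300^-1 by rewrite /u eE iE; field.
    have vE' : v = 600^-1 by rewrite /v e2E iE; field.
    rewrite uE vE' eE iE e2E /delta k2' eqxx; split; lra.
  have k3 : (3 <= k)%N by rewrite ltn_neqAle eq_sym kn2.
  have x3 : 3 <= x by rewrite /x ler_nat.
  have i4 : i <= 4^-1 by rewrite lef_pV2 ?posrE //; lra.
  have eE : eps = 18^-1 / x by rewrite /eps (negbTE kn2).
  have uE : eps - u = i / 18.
    rewrite /u -[X in X - _]mulr1 -mulrBr (_ : 1 - i = x * i); last by rewrite xi.
    by rewrite eE mulrA mulfVK // mulrC.
  have u4 : u <= eps / 4 by rewrite /u; nra.
  have v4 : v <= e2 / 4 by rewrite /v; nra.
  split; try lra; last by rewrite mulrDr mulr1 -/u; lra.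
  rewrite /delta (negbTE kn2) -/x div1r -/i mulrC ltr_pM2l // ltrD2l ltrN2.
  have y j : 0 < x ^+ j by apply: exprn_gt0; lra.
  have D0 : 0 < 3 * x ^+ 5 + 15 * x ^+ 4 + 33 * x ^+ 3 + 21 * x ^+ 2 + 14 * x + 10.
    have := y 5%N; have := y 4%N; have := y 3%N; have := y 2%N; lra.
  rewrite eE ltr_pdivrMr // -invfM [X in _ < X]mulrC ltr_pdivlMr; last by lra.
  rewrite -subr_gt0.
  set E := (X in 0 < X).
  have -> : E = 3 * x ^+ 3 * ((x - 13 / 2) ^+ 2 + 19 / 4) + (39 * x ^+ 2 - 58 * x) + 10.
    by rewrite /E; field.
  have : 0 < 39 * x ^+ 2 - 58 * x by rewrite (_ : _ - _ = x * (39 * x - 58)); [nra|ring].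
  have : 0 < 3 * x ^+ 3 * ((x - 13 / 2) ^+ 2 + 19 / 4).
    apply: mulr_gt0; first by rewrite mulr_gt0.
    by have := sqr_ge0 (x - 13 / 2); lra.
  lra.
have [m1 m2 m3 m4 m5] := main.
have uE' : (1 - eps) * i = i - u by rewrite /u; ring.
have ei : eps * (1 + i) = eps + u by rewrite /u; ring.
have b1 : (x + 2) * ((1 - eps) * i) = 1 + i - eps - u.
  have -> : (x + 2) * ((1 - eps) * i) = (1 - eps) * (x * i) + 2 * (1 - eps) * i by ring.
  by rewrite xi /u; ring.
have b2 : x * ((1 - eps) * i) = 1 - i - eps + u.
  by rewrite /u mulrCA xi; ring.
have b3 : (x + 2) * ((1 + e2) * i) = 1 + i + e2 + v.
  have -> : (x + 2) * ((1 + e2) * i) = (1 + e2) * (x * i) + 2 * (1 + e2) * i by ring.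
  by rewrite xi /v; ring.
have b4 : x * ((1 + e2) * i) = 1 - i + e2 - v.
  by rewrite /v mulrCA xi; ring.
have a1E : (1 + e2) * i = i + v by rewrite /v; ring.
(* [a0] and [a1] are slightly below and above [1 / (k + 1)]; [al] and [r] are then nearly
   forced, and [i / 60] is a margin *)
exists ((1 - eps) * i), ((1 + e2) * i), (((1 + i - eps - u) - 1) / 3 - i / 60).
exists (Num.max 0 ((2^-1 + i / 60 + (1 + i + e2 + v) - (1 - i - eps + u) - 1) / 2)), (i / 60).
rewrite b1 b2 b3 b4 a1E uE'; rewrite uE' in m1; rewrite ei in m2.
clear b1 b2 b3 b4 a1E uE' ei xi main x2 xn0.
move: (delta R k) m1 => d m1; clearbody u v e2 eps i; clear k2 x k.
split; first by split; lra.
split; last by split; [|lra]; rewrite -lerBrDl ge_max; apply/andP; split; lra.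
split; [by rewrite le_max lexx|lra|lra| |lra].
by rewrite [X in _ <= X]mulrC -ler_pdivrMr // le_max lexx orbT.
Qed.

(** * The contribution of the large divisors *)

Lemma sum_le_count (R : realDomainType) (P : pred nat) (F : nat -> R) (c : R) s :
  (forall e, e \in s -> P e -> F e <= c) -> \sum_(e <- s | P e) F e <= c * (count P s)%:R.
Proof.
elim: s => [|e s IH] H; first by rewrite big_nil mulr0.
have IH' : \sum_(x <- s | P x) F x <= c * (count P s)%:R.
  by apply: IH => x xs; apply: H; rewrite inE xs orbT.
rewrite big_cons /= natrD mulrDr; case: ifP => Pe; last by rewrite mulr0 add0r.
by rewrite mulr1 lerD // H // mem_head.
Qed.

(** The squared divisor function costs only [N ^ eps], and both the count of hits
    for [K] up to [N ^ (1 / 2 + tau)] and the easy count for larger [K] save a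
    power of [N] over [K ^ w]. *)
Lemma tail_small (R : realType) k (w theta c kap : R) : (2 <= k)%N ->
  2 / (k%:R + 1) <= w -> delta R k < theta * w -> 0 < theta -> 0 < c -> 0 < kap ->
  exists2 N0 : R, 1 <= N0 & forall N K, N0 <= N -> 1 <= K -> K <= N -> c * N `^ theta <= K ->
    \sum_(0 <= e < (Num.truncn N).+1 | tail_hit N K k e) (size (divisors e))%:R ^+ 2 <= kap * K `^ w.
Proof.
move=> k2 wk dw th0 c0 kap0.
have k0 : (0 < k)%N by rewrite (leq_trans _ k2).
set x : R := k%:R in wk *.
have x2 : 2 <= x by rewrite /x ler_nat.
have [a0 [a1 [al [r [tau [[tau0 a00 a0d a10 al0] [[r0 H1 H2 H3 H4] [H5 H6]]]]]]]] := @exponents_exist R k k2.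
have w0 : 0 < w by apply: lt_le_trans wk; rewrite divr_gt0 //; lra.
have tau0' : 0 <= 2^-1 + tau by lra.
have [M0 M0_1 HM0] := @tail_hits_short R k a0 a1 al r tau a0 k2 (ltW a00) a10 al0 r0 tau0' H1 H2 H3 H4 (lexx _) H5 H6.
pose g := (x - 1) / (x * (x + 1)).
have g0 : 0 < g by rewrite /g divr_gt0 ?mulr_gt0 //; lra.
have smooth_win : x^-1 + g <= w.
  apply: le_trans wk; rewrite /g le_eqVlt; apply/orP; left; apply/eqP; field.
  by rewrite !gt_eqF //; lra.
pose eps := Num.min ((theta * w - a0) / 4) (Num.min (theta * g / 4) (tau / (x + 1) / 2)).
have eps0 : 0 < eps.
  rewrite /eps !lt_min; apply/and3P; split; apply: divr_gt0 => //; [lra|exact: mulr_gt0|apply: divr_gt0 => //; lra].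
have e1 : 4 * eps <= theta * w - a0.
  by rewrite mulrC -ler_pdivlMr // /eps ge_min lexx.
have e2 : 4 * eps <= theta * g.
  by rewrite mulrC -ler_pdivlMr // /eps !ge_min lexx orbT.
have e3 : 2 * eps <= tau / (x + 1).
  by rewrite mulrC -ler_pdivlMr // /eps !ge_min lexx !orbT.
clearbody eps.
have [C C1 HC] := @divisor_bound R eps eps0.
have C0 : 0 < C by rewrite (lt_le_trans _ C1).
pose cw := c `^ w; have cw0 : 0 < cw by rewrite powR_gt0.
pose cg := c `^ g; have cg0 : 0 < cg by rewrite powR_gt0.
(* three exponents with which [eps] leaves a margin: short [K], the root of [K], long [K] *)
have l1 : 2 * eps + a0 < theta * w by lra.
have [M1 M1_1 HM1] := @powR_absorb R (14 * C ^+ 2 / (kap / 2 * cw)) _ _ l1.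
have l2 : 3 * eps < theta * g by lra.
have [M2 M2_1 HM2] := @powR_absorb R (C ^+ 2 * (1 + eps^-1) / (kap / 2 * cg)) _ _ l2.
have l3 : 2 * eps + (x + 1)^-1 < (2^-1 + tau) * w.
  have : (2^-1 + tau) * (2 / (x + 1)) <= (2^-1 + tau) * w by apply: ler_wpM2l.
  have -> : (2^-1 + tau) * (2 / (x + 1)) = (x + 1)^-1 + 2 * (tau / (x + 1)) by field; rewrite gt_eqF //; lra.
  by have : 0 < tau / (x + 1) by [rewrite divr_gt0 //; lra]; lra.
have [M3 M3_1 HM3] := @powR_absorb R (2 * C ^+ 2 / (kap / 2)) _ _ l3.
exists (Num.max M0 (Num.max M1 (Num.max M2 M3))); first by rewrite le_max M0_1.
move=> N K; rewrite !ge_max => /and4P[NM0 NM1 NM2 NM3] K1 KN cK.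
have N1 : 1 <= N by apply: le_trans KN.
have N0 : 0 < N by rewrite (lt_le_trans _ N1).
have K0 : 0 < K by rewrite (lt_le_trans _ K1).
have ND y z : N `^ (y + z) = N `^ y * N `^ z by rewrite powRD // (gt_eqF N0) implybT.
have Npos y : 0 < N `^ y by rewrite powR_gt0.
have KN' : 0 <= K <= N by rewrite KN ltW.
set B := (Num.truncn N).+1.
have step1 : \sum_(0 <= e < B | tail_hit N K k e) (size (divisors e))%:R ^+ 2 <=
   C ^+ 2 * N `^ (2 * eps) * (count (tail_hit N K k) (iota 0 B))%:R.
  rewrite /index_iota subn0; apply: sum_le_count => e; rewrite mem_iota add0n => /andP[_ eB] /andP[_ he].
  have [e_gt0 _ _ _] := hit_bounds KN' k0 he.
  have -> : C ^+ 2 * N `^ (2 * eps) = (C * N `^ eps) ^+ 2.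
    by rewrite exprMn -(powR_mulrn _ (ltW (Npos _))) -powRrM [eps * _]mulrC.
  apply: le_exprn2 => //; apply: (le_trans (HC _ e_gt0)); rewrite ler_pM2l //.
  apply: le_powR2 => //; first exact: ltW.
  by rewrite -truncn_ge_nat // ltW.
apply: (le_trans step1).
have KW : cw * N `^ (theta * w) <= K `^ w.
  rewrite powRrM -powRM ?(ltW c0) ?(ltW (Npos _)) //; apply: le_powR2 => //; first exact: ltW.
  by rewrite mulr_ge0 ?(ltW c0) ?(ltW (Npos _)).
have KG : cg * N `^ (theta * g) <= K `^ g.
  rewrite powRrM -powRM ?(ltW c0) ?(ltW (Npos _)) //; apply: le_powR2 => //; first exact: ltW.
  by rewrite mulr_ge0 ?(ltW c0) ?(ltW (Npos _)).
have part2 : C ^+ 2 * N `^ (2 * eps) * (K `^ x^-1 * (1 + ln N)) <= kap / 2 * K `^ w.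
  have h1 : 1 + ln N <= (1 + eps^-1) * N `^ eps.
    have := ln_le_powR eps0 N1; have : 1 <= N `^ eps by rewrite -(powRr0 N); apply: ler_powR => //; exact: ltW.
    lra.
  have h2 : C ^+ 2 * (1 + eps^-1) * N `^ (3 * eps) <= kap / 2 * K `^ g.
    have := HM2 _ NM2; rewrite mulrAC ler_pdivrMr ?mulr_gt0 ?divr_gt0 // => h.
    apply: (le_trans h).
    have -> : N `^ (theta * g) * (kap / 2 * cg) = kap / 2 * (cg * N `^ (theta * g)) by ring.
    by rewrite ler_pM2l ?divr_gt0.
  have h3 : K `^ (x^-1 + g) <= K `^ w by apply: ler_powR.
  apply: (@le_trans _ _ (kap / 2 * K `^ (x^-1 + g))); last by rewrite ler_pM2l ?divr_gt0.
  have -> : C ^+ 2 * N `^ (2 * eps) * (K `^ x^-1 * (1 + ln N)) =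
    K `^ x^-1 * (C ^+ 2 * N `^ (2 * eps) * (1 + ln N)) by ring.
  have -> : kap / 2 * K `^ (x^-1 + g) = K `^ x^-1 * (kap / 2 * K `^ g).
    by rewrite powRD ?(gt_eqF K0) ?implybT //; ring.
  rewrite ler_pM2l ?powR_gt0 //; apply: le_trans h2.
  have -> : C ^+ 2 * (1 + eps^-1) * N `^ (3 * eps) = C ^+ 2 * N `^ (2 * eps) * ((1 + eps^-1) * N `^ eps).
    by rewrite (_ : 3 * eps = 2 * eps + eps) ?ND; ring.
  by rewrite ler_pM2l // mulr_gt0 // exprn_gt0.
have CN0 : 0 <= C ^+ 2 * N `^ (2 * eps) by rewrite mulr_ge0 ?exprn_ge0 ?(ltW C0) ?(ltW (Npos _)).
have -> : kap * K `^ w = kap / 2 * K `^ w + kap / 2 * K `^ w by field.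
have [Ks|Kl] := leP K (N `^ (2^-1 + tau)).
  apply: (le_trans (ler_wpM2l CN0 (HM0 N K B NM0 K1 KN Ks))).
  rewrite mulrDr; apply: lerD => //.
  have := HM1 _ NM1; rewrite mulrAC ler_pdivrMr ?mulr_gt0 ?divr_gt0 // => h.
  apply: (@le_trans _ _ (kap / 2 * (cw * N `^ (theta * w)))); last by rewrite ler_pM2l ?divr_gt0.
  by move: h; rewrite ND; lra.
apply: (le_trans (ler_wpM2l CN0 (tail_hits_any B k2 K1 KN))).
rewrite mulrDr; apply: lerD => //.
have := HM3 _ NM3; rewrite mulrAC ler_pdivrMr ?divr_gt0 // => h.
apply: (@le_trans _ _ (kap / 2 * N `^ ((2^-1 + tau) * w))).
  by move: h; rewrite ND; lra.
rewrite ler_pM2l ?divr_gt0 // powRrM; apply: le_powR2; [exact: ltW|exact: powR_ge0|exact: ltW].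
Qed.

(** * Mean values over the unit interval *)

Definition mean (R : realType) (f : R -> R) : R :=
  Rintegral (@lebesgue_measure R) `[0, 1]%classic f.

(** On this class, which contains all integrands below, integrability over [[0, 1]] is
    automatic and the mean value is linear and monotone. *)
Definition bmeas (R : realType) (f : R -> R) : Prop :=
  measurable_fun [set: R] f /\ exists M, forall x, `|f x| <= M.

Definition cbmeas (R : realType) (g : R -> R[i]) : Prop :=
  bmeas (fun x => complex.Re (g x)) /\ bmeas (fun x => complex.Im (g x)).

Lemma bmeas_cst (R : realType) (c : R) : bmeas (fun=> c).
Proof. by split; [exact: measurable_cst|exists `|c|]. Qed.

Lemma bmeasD (R : realType) (f g : R -> R) : bmeas f -> bmeas g -> bmeas (fun x => f x + g x).
Proof.
move=> [mf [Mf bf]] [mg [Mg bg]]; split; first exact: measurable_funD.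
by exists (Mf + Mg) => x; apply: le_trans (ler_normD _ _) _; exact: lerD.
Qed.

Lemma bmeasM (R : realType) (f g : R -> R) : bmeas f -> bmeas g -> bmeas (fun x => f x * g x).
Proof.
move=> [mf [Mf bf]] [mg [Mg bg]]; split; first exact: measurable_funM.
by exists (Mf * Mg) => x; rewrite normrM; apply: ler_pM.
Qed.

Lemma bmeasN (R : realType) (f : R -> R) : bmeas f -> bmeas (fun x => - f x).
Proof.
move=> bf; rewrite (_ : (fun x => - f x) = (fun x => -1 * f x)); first by apply: bmeasM => //; exact: bmeas_cst.
by apply/funext => x; rewrite mulN1r.
Qed.

Lemma bmeas_sum (R : realType) (I : Type) (r : seq I) (P : pred I) (F : I -> R -> R) :
  (forall i, bmeas (F i)) -> bmeas (fun x => \sum_(i <- r | P i) F i x).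
Proof.
move=> HF; elim: r => [|i r IH].
  rewrite (_ : (fun x => _) = (fun=> 0)); first exact: bmeas_cst.
  by apply/funext => x; rewrite big_nil.
case: (boolP (P i)) => Pi.
  rewrite (_ : (fun x => _) = (fun x => F i x + \sum_(i <- r | P i) F i x)); first exact: bmeasD.
  by apply/funext => x; rewrite big_cons Pi.
rewrite (_ : (fun x => _) = (fun x => \sum_(i <- r | P i) F i x)) //.
by apply/funext => x; rewrite big_cons (negbTE Pi).
Qed.

Lemma bmeas_powR (R : realType) (f : R -> R) p : 0 <= p -> (forall x, 0 <= f x) -> bmeas f -> bmeas (fun x => f x `^ p).
Proof.
move=> p0 f0 [mf [M bf]]; split.
  by apply: (measurableT_comp (measurable_powR p)).
exists (M `^ p) => x; rewrite ger0_norm ?powR_ge0 //; apply: le_powR2 => //.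
by apply: le_trans (bf x); exact: ler_norm.
Qed.

Lemma bmeas_continuous (R : realType) (f : R -> R) M : continuous f -> (forall x, `|f x| <= M) -> bmeas f.
Proof. by move=> cf bf; split; [exact: continuous_measurable_fun|exists M]. Qed.

Lemma bmeas_affine (R : realType) (f : R -> R) (a b : R) : bmeas f -> continuous f ->
  bmeas (fun x => f (a * x + b)).
Proof.
move=> [_ [M bf]] cf; apply: (@bmeas_continuous _ _ M) => // x.
by apply: continuous_comp; [|exact: cf]; apply: cvgD; [apply: cvgMr; exact: cvg_id|exact: cvg_cst].
Qed.

Lemma bmeas_integrable (R : realType) (f : R -> R) : bmeas f ->
  (@lebesgue_measure R).-integrable `[0, 1]%classic (EFin \o f).
Proof.
move=> [mf [M bf]]; apply: measurable_bounded_integrable => //.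
- by rewrite /= lebesgue_measure_itv /= lte_fin ltr01 -EFinD ltry.
- exact: measurable_funTS.
- exists M; split; first exact: num_real.
  by move=> y My x _ /=; apply: le_trans (bf x) (ltW My).
Qed.

Lemma meanD (R : realType) (f g : R -> R) : bmeas f -> bmeas g -> mean (fun x => f x + g x) = mean f + mean g.
Proof. by move=> bf bg; rewrite /mean RintegralD //; apply: bmeas_integrable. Qed.

Lemma meanZ (R : realType) (f : R -> R) c : bmeas f -> mean (fun x => c * f x) = c * mean f.
Proof. by move=> bf; rewrite /mean RintegralZl //; apply: bmeas_integrable. Qed.

Lemma mean_cst (R : realType) (c : R) : mean (fun=> c) = c.
Proof.
rewrite /mean Rintegral_cst //= lebesgue_measure_itv /= lte_fin ltr01 -EFinD /=.
by rewrite subr0 mulr1.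
Qed.

Lemma mean_le (R : realType) (f g : R -> R) : bmeas f -> bmeas g -> (forall x, 0 <= x <= 1 -> f x <= g x) -> mean f <= mean g.
Proof.
move=> bf bg fg; apply: le_Rintegral => //; exact: bmeas_integrable.
Qed.

Lemma mean_sum (R : realType) (I : Type) (r : seq I) (P : pred I) (F : I -> R -> R) :
  (forall i, bmeas (F i)) -> mean (fun x => \sum_(i <- r | P i) F i x) = \sum_(i <- r | P i) mean (F i).
Proof.
move=> HF; elim: r => [|i r IH].
  rewrite big_nil -[RHS](mean_cst 0); congr mean.
  by apply/funext => x; rewrite big_nil.
rewrite big_cons; case: ifP => Pi.
  rewrite -IH -meanD //; last exact: bmeas_sum.
  by congr mean; apply/funext => x; rewrite big_cons Pi.
by rewrite -IH; congr mean; apply/funext => x; rewrite big_cons Pi.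
Qed.

Lemma normcE_re_im (R : realType) (z : R[i]) : nc z = Num.sqrt (complex.Re z ^+ 2 + complex.Im z ^+ 2).
Proof. by case: z. Qed.

Lemma sqr_normcE (R : realType) (z : R[i]) : nc z ^+ 2 = complex.Re z ^+ 2 + complex.Im z ^+ 2.
Proof. by rewrite normcE_re_im sqr_sqrtr // addr_ge0 // sqr_ge0. Qed.

Lemma normc_ge0 (R : realType) (z : R[i]) : 0 <= nc z.
Proof. by rewrite normcE_re_im sqrtr_ge0. Qed.

Lemma re_le_normc (R : realType) (z : R[i]) : complex.Re z <= nc z.
Proof.
have h := sqr_normcE z; have z0 := normc_ge0 z; have i0 := sqr_ge0 (complex.Im z).
by rewrite leNgt; apply/negP => lt; nra.
Qed.

Lemma cbmeas_norm (R : realType) (g : R -> R[i]) : cbmeas g -> bmeas (fun x => nc (g x)).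
Proof.
move=> [br bi]; have b2 := bmeasD (bmeasM br br) (bmeasM bi bi).
have -> : (fun x => nc (g x)) = (fun x => (complex.Re (g x) * complex.Re (g x) + complex.Im (g x) * complex.Im (g x)) `^ 2^-1).
  by apply/funext => x; rewrite normcE_re_im powR12_sqrt // addr_ge0 // -expr2 sqr_ge0.
by apply: bmeas_powR => // x; rewrite addr_ge0 // -expr2 sqr_ge0.
Qed.

Lemma cbmeasD (R : realType) (f g : R -> R[i]) : cbmeas f -> cbmeas g -> cbmeas (fun x => f x + g x).
Proof.
move=> [fr fi] [gr gi]; split.
  by have := bmeasD fr gr; congr bmeas; apply/funext => x; case: (f x) (g x) => [? ?] [].
by have := bmeasD fi gi; congr bmeas; apply/funext => x; case: (f x) (g x) => [? ?] [].
Qed.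

Lemma cbmeasM (R : realType) (f g : R -> R[i]) : cbmeas f -> cbmeas g -> cbmeas (fun x => f x * g x).
Proof.
move=> [fr fi] [gr gi]; split.
  by have := bmeasD (bmeasM fr gr) (bmeasN (bmeasM fi gi)); congr bmeas; apply/funext => x; case: (f x) (g x) => [? ?] [].
by have := bmeasD (bmeasM fr gi) (bmeasM fi gr); congr bmeas; apply/funext => x; case: (f x) (g x) => [? ?] [].
Qed.

Lemma cbmeas_cst (R : realType) (c : R[i]) : cbmeas (fun=> c).
Proof. by split; exact: bmeas_cst. Qed.

Lemma cbmeas_sum (R : realType) (I : Type) (r : seq I) (P : pred I) (F : I -> R -> R[i]) :
  (forall i, cbmeas (F i)) -> cbmeas (fun x => \sum_(i <- r | P i) F i x).
Proof.
move=> HF; elim: r => [|i r IH].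
  rewrite (_ : (fun x => _) = (fun=> 0)); first exact: cbmeas_cst.
  by apply/funext => x; rewrite big_nil.
case: (boolP (P i)) => Pi.
  rewrite (_ : (fun x => _) = (fun x => F i x + \sum_(i <- r | P i) F i x)); first exact: cbmeasD.
  by apply/funext => x; rewrite big_cons Pi.
rewrite (_ : (fun x => _) = (fun x => \sum_(i <- r | P i) F i x)) //.
by apply/funext => x; rewrite big_cons (negbTE Pi).
Qed.

Lemma continuous_lin (R : realType) (a b : R) : continuous (fun x : R => a * x + b).
Proof. by move=> x; apply: cvgD; [apply: cvgMr; exact: cvg_id|exact: cvg_cst]. Qed.

Lemma cbmeas_expe (R : realType) (a b : R) : cbmeas (fun x : R => expe (a * x + b)).
Proof.
have E (t : R) : 2 * pi * (a * t + b) = (2 * pi * a) * t + 2 * pi * b :> R by ring.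
split.
  apply: (@bmeas_continuous _ _ 1) => [x|x] /=; last by rewrite ler_norml cos_geN1 cos_le1.
  under eq_fun do rewrite E.
  by apply: continuous_comp; [exact: continuous_lin|exact: continuous_cos].
apply: (@bmeas_continuous _ _ 1) => [x|x] /=; last by rewrite ler_norml sin_geN1 sin_le1.
under eq_fun do rewrite E.
by apply: continuous_comp; [exact: continuous_lin|exact: continuous_sin].
Qed.

(** * Trigonometric polynomials and Parseval's identity *)

Lemma normcD_le (R : realType) (x y : R[i]) : nc (x + y) <= nc x + nc y.
Proof. exact: le_normcD. Qed.

Lemma normc_sum_le (R : realType) (I : Type) (r : seq I) (P : pred I) (F : I -> R[i]) :
  nc (\sum_(i <- r | P i) F i) <= \sum_(i <- r | P i) nc (F i).
Proof.
elim/big_rec2: _ => [|i y x _ h]; first by rewrite Normc.normc0.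
by apply: le_trans (normcD_le _ _) _; rewrite lerD2l.
Qed.

Lemma normcR (R : realType) (c : R) : nc (real_complex R c) = `|c|.
Proof. by rewrite normcE_re_im /= expr0n addr0 sqrtr_sqr. Qed.

Lemma nc_opp (R : realType) (x : R[i]) : nc (- x) = nc x.
Proof. by rewrite !normcE_re_im; case: x => a b /=; rewrite !sqrrN. Qed.

Lemma expeD (R : realType) (x y : R) : expe (x + y) = expe x * expe y.
Proof.
rewrite /Defs.expe mulrDr cosD sinD; apply/eqP; rewrite eq_complex /= eqxx /=.
by apply/eqP; ring.
Qed.

Lemma normc_expe (R : realType) (x : R) : nc (expe x) = 1.
Proof. by rewrite /= cos2Dsin2 sqrtr1. Qed.

Lemma expe0 (R : realType) : expe (0 : R) = 1.
Proof. by rewrite /Defs.expe mulr0 cos0 sin0. Qed.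

Lemma expe1 (R : realType) : expe (1 : R) = 1.
Proof. by rewrite /Defs.expe mulr1 mulr_natl cos2pi sin2pi. Qed.

Lemma expeMn (R : realType) (n : nat) (x : R) : expe (n%:R * x) = expe x ^+ n.
Proof.
elim: n => [|n IH]; first by rewrite mul0r expe0 expr0.
by rewrite -natr1 mulrDl mul1r expeD IH exprSr.
Qed.

Lemma expe_nat (R : realType) (n : nat) : expe (n%:R : R) = 1.
Proof. by rewrite -[n%:R]mulr1 expeMn expe1 expr1n. Qed.

Definition trigpoly (R : realType) (B : nat) (c : nat -> R) (x : R) : R[i] :=
  \sum_(0 <= n < B) real_complex R (c n) * expe (n%:R * x).

Lemma cbmeas_trigpoly (R : realType) (B : nat) (c : nat -> R) (a b : R) : cbmeas (fun x => trigpoly B c (a * x + b)).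
Proof.
apply: cbmeas_sum => n; apply: cbmeasM; first exact: cbmeas_cst.
have := cbmeas_expe (n%:R * a) (n%:R * b); congr cbmeas; apply/funext => x.
by congr Defs.expe; ring.
Qed.

Lemma cbmeas_trigpoly1 (R : realType) (B : nat) (c : nat -> R) : cbmeas (trigpoly B c).
Proof. by have := cbmeas_trigpoly B c 1 0; congr cbmeas; apply/funext => x; rewrite mul1r addr0. Qed.

Lemma cbmeas_trigpolyM (R : realType) (B : nat) (c : nat -> R) a : cbmeas (fun x => trigpoly B c (a * x)).
Proof. by have := cbmeas_trigpoly B c a 0; congr cbmeas; apply/funext => x; rewrite addr0. Qed.

Lemma re_trigpoly (R : realType) (B : nat) (c : nat -> R) (x : R) :
  complex.Re (trigpoly B c x) = \sum_(0 <= n < B) c n * cos (2 * pi * (n%:R * x)).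
Proof.
rewrite /trigpoly; elim/big_rec2: _ => // n y z _ <-.
by case: z => a b /=; rewrite mul0r subr0.
Qed.

Lemma im_trigpoly (R : realType) (B : nat) (c : nat -> R) (x : R) :
  complex.Im (trigpoly B c x) = \sum_(0 <= n < B) c n * sin (2 * pi * (n%:R * x)).
Proof.
rewrite /trigpoly; elim/big_rec2: _ => // n y z _ <-.
by case: z => a b /=; rewrite mul0r addr0.
Qed.

Lemma mean_cos0 (R : realType) (w : R) : w != 0 -> sin w = 0 -> mean (fun x => cos (w * x)) = 0.
Proof.
move=> w0 sw; pose F (x : R) := w^-1 * sin (w * x).
have dF x : is_derive x (1 : R) F (cos (w * x)).
  have d1 : is_derive x (1 : R) (fun y : R => w * y) w.
    by have := is_deriveZ w (is_derive_id x (1 : R)) => h; apply: is_derive_eq h _; rewrite /GRing.scale /= mulr1.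
  have := is_deriveZ w^-1 (is_derive1_comp (is_derive_sin (w * x)) d1).
  by move=> h; apply: is_derive_eq h _; rewrite /GRing.scale /=; field.
have cF : continuous F.
  by move=> x; apply/differentiable_continuous/derivable1_diffP; apply: ex_derive; exact: dF.
rewrite /mean /Rintegral (@continuous_FTC2 _ _ F) ?ltr01 //.
- by rewrite -EFinB /= /F mulr0 mulr1 sw sin0 !mulr0 subrr.
- apply: continuous_subspaceT => x.
  apply: continuous_comp; last exact: continuous_cos.
  by apply: cvgMr; exact: cvg_id.
- split.
  + by move=> x _; apply: ex_derive; exact: dF.
  + by apply: cvg_at_right_filter; exact: cF.
  + by apply: cvg_at_left_filter; exact: cF.
- by move=> x _; rewrite derive1E; apply: derive_val.
Qed.

Lemma sin_nat2pi (R : realType) (n : nat) : sin (2 * pi * n%:R : R) = 0.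
Proof. by have := expe_nat R n => /(congr1 (@complex.Im _)). Qed.

Lemma mean_cosB (R : realType) (q n m : nat) : (0 < q)%N ->
  mean (fun x : R => cos (2 * pi * (n%:R * (q%:R * x)) - 2 * pi * (m%:R * (q%:R * x)))) = (n == m)%:R.
Proof.
move=> q0; wlog nm : n m / (m <= n)%N.
  move=> H; case/orP: (leq_total m n) => nm; first exact: H.
  rewrite eq_sym -(H _ _ nm); congr mean; apply/funext => x.
  by rewrite -cosN opprB.
case: eqVneq => [->|ne].
  by rewrite -[RHS](mean_cst 1); congr mean; apply/funext => x; rewrite subrr cos0.
have E : 2 * pi * ((n - m) * q)%N%:R = 2 * pi * (n%:R - m%:R) * q%:R :> R.
  by rewrite natrM natrB //; ring.
rewrite -[RHS](@mean_cos0 R (2 * pi * ((n - m) * q)%N%:R)).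
- by congr mean; apply/funext => x; congr cos; rewrite E; ring.
- rewrite mulf_neq0 // ?mulf_neq0 ?gt_eqF ?pi_gt0 // ltr0n muln_gt0 q0 andbT subn_gt0.
  by rewrite ltn_neqAle nm andbT eq_sym.
- exact: sin_nat2pi.
Qed.

Lemma bmeas_cos_lin (R : realType) (a b : R) : bmeas (fun x => cos (a * x + b)).
Proof.
apply: (@bmeas_continuous _ _ 1) => [x|x]; last by rewrite ler_norml cos_geN1 cos_le1.
by apply: continuous_comp; [exact: continuous_lin|exact: continuous_cos].
Qed.

(** Replacing [x] by [q x] keeps distinct frequencies distinct, so the dilation does not
    change the mean square. *)
Theorem parseval (R : realType) (q B : nat) (c : nat -> R) : (0 < q)%N ->
  mean (fun x => nc (trigpoly B c (q%:R * x)) ^+ 2) = \sum_(0 <= n < B) c n ^+ 2.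
Proof.
move=> q0.
pose cs n m (x : R) := cos (2 * pi * (n%:R * (q%:R * x)) - 2 * pi * (m%:R * (q%:R * x))).
have bcs n m : bmeas (cs n m).
  have := bmeas_cos_lin (2 * pi * (n%:R - m%:R) * q%:R : R) 0; congr bmeas.
  by apply/funext => x; rewrite /cs addr0; congr cos; ring.
have -> : (fun x => nc (trigpoly B c (q%:R * x)) ^+ 2) =
  (fun x => \sum_(0 <= n < B) \sum_(0 <= m < B) (c n * c m) * cs n m x).
  apply/funext => x; rewrite sqr_normcE re_trigpoly im_trigpoly !expr2 !big_distrlr /= -big_split /=.
  apply: eq_bigr => n _; rewrite -big_split /=; apply: eq_bigr => m _.
  by rewrite /cs cosB; ring.
rewrite mean_sum; last by move=> n; apply: bmeas_sum => m; apply: bmeasM => //; exact: bmeas_cst.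
apply: eq_big_nat => n /andP[_ nB]; rewrite mean_sum; last by move=> m; apply: bmeasM => //; exact: bmeas_cst.
rewrite (bigD1_seq n) ?iota_uniq ?mem_index_iota //= big1 ?addr0 => [|m mn].
  by rewrite meanZ // mean_cosB // eqxx mulr1 expr2.
by rewrite meanZ // mean_cosB // eq_sym (negbTE mn) mulr0.
Qed.

(** * Combinations of dilated trigonometric polynomials *)

(** Expand the square over the pairs [d, d']. *)
Lemma combo_sq_sum_le (R : realType) (Y B : nat) (m : nat -> R) (w : nat -> nat -> R) (chi : nat -> pred nat) :
  (forall d, `|m d| <= 1) -> (forall d n, `|w d n| <= (chi d n)%:R) ->
  \sum_(0 <= n < B) (\sum_(0 <= d < Y) m d * w d n) ^+ 2 <=
  \sum_(0 <= d < Y) \sum_(0 <= d' < Y) (count (fun n => chi d n && chi d' n) (iota 0 B))%:R.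
Proof.
move=> hm hw.
under [X in _ <= X]eq_bigr do under eq_bigr do rewrite -sum_count.
under [X in _ <= X]eq_bigr do rewrite exchange_big.
rewrite [X in _ <= X]exchange_big /=; apply: ler_sum => n _.
have h : `|\sum_(0 <= d < Y) m d * w d n| <= \sum_(0 <= d < Y) (chi d n)%:R.
  apply: le_trans (ler_norm_sum _ _ _) _; apply: ler_sum => d _.
  by rewrite normrM -[X in _ <= X]mul1r; apply: ler_pM.
rewrite -real_normK ?num_real //; apply: le_trans (le_exprn2 2 (normr_ge0 _) h) _.
rewrite expr2 big_distrlr /= le_eqVlt; apply/orP; left; apply/eqP.
by apply: eq_bigr => d _; apply: eq_bigr => d' _; rewrite -natrM mulnb.
Qed.

Lemma trigpoly_widen (R : realType) (B B' : nat) (c : nat -> R) x : (B <= B')%N ->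
  (forall n, (B <= n)%N -> c n = 0) -> trigpoly B c x = trigpoly B' c x.
Proof.
move=> BB H; rewrite /trigpoly [RHS](@big_cat_nat _ _ _ B) //= [X in _ = _ + X](_ : _ = 0) ?addr0 //.
by rewrite big_nat_cond big1 // => n /andP[/andP[Bn _] _]; rewrite H // mul0r.
Qed.

(** The coefficients of the dilation by [q] of the trigonometric polynomial with the
    coefficients [w]. *)
Definition lift_coef (R : realType) (q : nat) (w : nat -> R) (n : nat) : R :=
  if (q %| n)%N then w (n %/ q)%N else 0.

Lemma trigpoly_lift (R : realType) (q B : nat) (w : nat -> R) x : (0 < q)%N ->
  trigpoly B w (q%:R * x) = trigpoly (q * B) (lift_coef q w) x.
Proof.
move=> q0; elim: B => [|B IH]; first by rewrite muln0 /trigpoly !big_geq.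
rewrite /trigpoly big_nat_recr //= -[X in X + _]/(trigpoly B w (q%:R * x)) IH mulnS addnC.
rewrite [RHS](@big_cat_nat _ _ _ (q * B)) //= ?leq_addr //; congr (_ + _).
rewrite big_ltn; last by rewrite -[X in (X < _)%N]addn0 ltn_add2l.
rewrite /lift_coef dvdn_mulr // mulKn // big_nat_cond big1 ?addr0; first by rewrite natrM mulrA [q%:R * _]mulrC.
move=> n /andP[/andP[n1 n2] _]; rewrite ifF ?mul0r //; apply/negP => /dvdnP[t tE].
have h1 : (B < t)%N by rewrite -(ltn_pmul2l q0) [(q * t)%N]mulnC -tE.
have h2 : (t < B.+1)%N by rewrite -(ltn_pmul2l q0) [(q * t)%N]mulnC -tE mulnS addnC.
by move: h1; rewrite ltnNge -ltnS h2.
Qed.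

Lemma trigpoly_sum (R : realType) (B Y : nat) (m : nat -> R) (w : nat -> nat -> R) x :
  \sum_(0 <= d < Y) real_complex R (m d) * trigpoly B (w d) x =
  trigpoly B (fun n => \sum_(0 <= d < Y) m d * w d n) x.
Proof.
rewrite /trigpoly; under eq_bigr do rewrite big_distrr /=.
rewrite exchange_big /=; apply: eq_bigr => n _.
rewrite rmorph_sum big_distrl /=; apply: eq_bigr => d _.
by rewrite rmorphM mulrA.
Qed.

Lemma trigpolyD (R : realType) (B : nat) (c c' : nat -> R) x :
  trigpoly B (fun n => c n + c' n) x = trigpoly B c x + trigpoly B c' x.
Proof. by rewrite /trigpoly -big_split /=; apply: eq_bigr => n _; rewrite rmorphD mulrDl. Qed.

Lemma trigpolyN (R : realType) (B : nat) (c : nat -> R) x : trigpoly B (fun n => - c n) x = - trigpoly B c x.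
Proof. by rewrite /trigpoly -sumrN; apply: eq_bigr => n _; rewrite rmorphN mulNr. Qed.

Lemma eq_trigpoly (R : realType) (B : nat) (c c' : nat -> R) x :
  (forall n, (n < B)%N -> c n = c' n) -> trigpoly B c x = trigpoly B c' x.
Proof. by move=> H; apply: eq_big_nat => n /andP[_ nB]; rewrite H. Qed.

Lemma mean_sq_combo (R : realType) (Y B k : nat) (m : nat -> R) (w : nat -> nat -> R) (chi : nat -> pred nat) :
  (0 < k)%N -> m 0%N = 0 ->
  (forall d, `|m d| <= 1) -> (forall d n, (0 < d)%N -> `|lift_coef (d ^ k) (w d) n| <= (chi d n)%:R) ->
  (forall d n, (B <= n)%N -> w d n = 0) ->
  mean (fun x => nc (\sum_(0 <= d < Y) real_complex R (m d) * trigpoly B (w d) ((d ^ k)%:R * x)) ^+ 2) <=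
  \sum_(0 <= d < Y) \sum_(0 <= d' < Y) (count (fun n => chi d n && chi d' n) (iota 0 (Y ^ k * B)))%:R.
Proof.
move=> k0 m0 hm hw hB.
pose w' d n := if d == 0%N then 0 else lift_coef (d ^ k) (w d) n.
have hw' d n : `|w' d n| <= (chi d n)%:R.
  by rewrite /w'; case: posnP => [_|d0]; [rewrite normr0|apply: hw].
apply: le_trans (combo_sq_sum_le Y (Y ^ k * B) hm hw').
rewrite -(@parseval R 1) // le_eqVlt; apply/orP; left; apply/eqP; congr mean; apply/funext => x.
rewrite mul1r -trigpoly_sum; congr (nc _ ^+ 2); apply: eq_big_nat => d /andP[_ dY].
have [->|d0] := posnP d; first by rewrite m0 rmorph0 !mul0r.
congr (_ * _); rewrite trigpoly_lift ?expn_gt0 ?d0 // (@trigpoly_widen _ _ (Y ^ k * B)).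
- by apply: eq_trigpoly => n _; rewrite /w' gtn_eqF.
- by rewrite leq_mul2r leq_exp2r // ltnW // orbT.
- move=> n hn; rewrite /lift_coef; case: ifP => // /dvdnP[t tE]; rewrite tE mulnK ?expn_gt0 ?d0 //.
  by apply: hB; move: hn; rewrite tE [(t * _)%N]mulnC leq_pmul2l // expn_gt0 d0.
Qed.

(** * Smoothed intervals *)

Definition interval_ind (R : realType) (a b m : nat) : R := (a <= m < b)%N%:R.

(** The convolution of the interval [a, b) with the uniform distribution on [0, h):
    its exponential sum is the one of the interval times a normalised Dirichlet
    kernel of length [h]. *)
Definition smooth (R : realType) (a b h m : nat) : R :=
  h%:R^-1 * \sum_(0 <= i < h) ((i <= m) && (a <= m - i < b))%N%:R.

Definition dirichlet (R : realType) (h : nat) (x : R) : R[i] := trigpoly h (fun=> 1) x.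

Lemma dirichletE (R : realType) h (x : R) : dirichlet h x = \sum_(0 <= i < h) expe x ^+ i.
Proof. by apply: eq_bigr => i _; rewrite rmorph1 mul1r expeMn. Qed.

Lemma geom_sum (R : comNzRingType) (z : R) n : (1 - z) * \sum_(0 <= i < n) z ^+ i = 1 - z ^+ n.
Proof.
elim: n => [|n IH]; first by rewrite big_geq // mulr0 expr0 subrr.
by rewrite big_nat_recr //= mulrDr IH exprS; ring.
Qed.

Lemma trigpoly_ind_shift (R : realType) (a b i B : nat) (x : R) : (b + i <= B)%N ->
  trigpoly B (fun m => ((i <= m) && (a <= m - i < b))%N%:R) x = expe x ^+ i * trigpoly B (interval_ind R a b) x.
Proof.
move=> bB; rewrite /trigpoly (@big_cat_nat _ _ _ i) //=; last by apply: leq_trans bB; rewrite leq_addl.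
rewrite big_nat_cond big1 ?add0r; last first.
  by move=> m /andP[/andP[_ mi] _]; rewrite leqNgt mi /= mul0r.
rewrite -{1}(add0n i) big_addn [X in _ = _ * X](@big_cat_nat _ _ _ (B - i)) //= ?leq_subr //.
rewrite mulrDr [X in _ = _ + X](_ : _ = 0) ?addr0; last first.
  rewrite big_nat_cond big1 ?mulr0 // => m /andP[/andP[m1 m2] _].
  rewrite /interval_ind [(m < b)%N]ltnNge (_ : (b <= m)%N) ?andbF ?mul0r //.
  by apply: leq_trans m1; rewrite -(leq_add2r i) subnK // (leq_trans _ bB) // leq_addl.
rewrite big_distrr; apply: eq_bigr => m _.
by rewrite leq_addl addnK /interval_ind natrD mulrDl expeD -expeMn /=; ring.
Qed.

Lemma trigpoly_smooth (R : realType) (a b h B : nat) (x : R) : (b + h <= B)%N ->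
  trigpoly B (smooth R a b h) x = real_complex R h%:R^-1 * dirichlet h x * trigpoly B (interval_ind R a b) x.
Proof.
move=> bB; rewrite -mulrA dirichletE big_distrl /=.
transitivity (real_complex R h%:R^-1 * \sum_(0 <= i < h) trigpoly B (fun m => ((i <= m) && (a <= m - i < b))%N%:R) x).
  have := trigpoly_sum B h (fun=> 1) (fun i m => ((i <= m) && (a <= m - i < b))%N%:R) x.
  under eq_bigr do rewrite rmorph1 mul1r.
  move=> ->; rewrite /trigpoly big_distrr /=; apply: eq_bigr => m _.
  by rewrite mulrA -rmorphM; congr (real_complex R (_ * _) * _); apply: eq_bigr => i _; rewrite mul1r.
congr (_ * _); apply: eq_big_nat => i /andP[_ ih]; rewrite trigpoly_ind_shift //.
by apply: leq_trans bB; rewrite leq_add2l ltnW.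
Qed.

Lemma smooth_ge0 (R : realType) a b h m : 0 <= smooth R a b h m.
Proof. by rewrite mulr_ge0 ?invr_ge0 // sumr_ge0. Qed.

Lemma smooth_le1 (R : realType) a b h m : smooth R a b h m <= 1.
Proof.
have [->|h0] := posnP h; first by rewrite /smooth big_geq // mulr0.
rewrite /smooth ler_pdivrMl ?ltr0n // mulr1.
apply: (@le_trans _ _ (\sum_(0 <= i < h) 1)); last by rewrite sumr_const_nat subn0.
by apply: ler_sum => i _; case: (_ && _).
Qed.

Lemma smooth_supp (R : realType) a b h m : ~~ (a <= m < b + h)%N -> smooth R a b h m = 0.
Proof.
move=> H; rewrite /smooth big_nat_cond big1 ?mulr0 // => i /andP[/andP[_ ih] _].
case: andP => // -[im /andP[am mb]]; case/negP: H.
rewrite (leq_trans am (leq_subr _ _)) /= -(subnK im) addnC -addSn addnC.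
by rewrite leq_add // ltnW.
Qed.

Lemma smooth_plateau (R : realType) a b h m : (0 < h)%N -> (a + h <= m < b)%N -> smooth R a b h m = 1.
Proof.
move=> h0 /andP[am mb]; rewrite /smooth (eq_big_nat _ _ (F2 := fun=> 1)).
  by rewrite sumr_const_nat subn0 mulVf // pnatr_eq0 -lt0n.
move=> i /andP[_ ih].
have im : (i <= m)%N by apply: leq_trans am; apply: leq_trans (leq_addl _ _); exact: ltnW.
rewrite im (leq_ltn_trans (leq_subr _ _) mb) andbT leq_subRL // addnC.
by rewrite (leq_trans _ am) // leq_add2l ltnW.
Qed.

(** Passing from [h] to [2 h] turns the product of Dirichlet kernels into a Fejer
    kernel, whose mean value is bounded without a logarithm. *)
Lemma smooth_diff (R : realType) (a b h B : nat) (x : R) : (a <= b)%N -> (0 < h)%N -> (b + h.*2 <= B)%N ->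
  trigpoly B (fun m => smooth R a b h m - smooth R a b h.*2 m) x =
  real_complex R h.*2%:R^-1 * dirichlet h x ^+ 2 * (expe x ^+ a - expe x ^+ b).
Proof.
move=> ab h0 bB; rewrite (trigpolyD B (smooth R a b h) (fun m => - smooth R a b h.*2 m)) trigpolyN.
rewrite !trigpoly_smooth //; last by apply: leq_trans bB; rewrite leq_add2l -addnn leq_addr.
have -> : trigpoly B (interval_ind R a b) x = expe x ^+ a * \sum_(0 <= i < b - a) expe x ^+ i.
  have bB' : (b <= B)%N by apply: leq_trans bB; rewrite leq_addr.
  rewrite /trigpoly (@big_cat_nat _ _ _ b) //= [X in _ + X](_ : _ = 0) ?addr0; last first.
    by rewrite big_nat_cond big1 // => m /andP[/andP[m1 _] _]; rewrite /interval_ind [(m < b)%N]ltnNge m1 andbF mul0r.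
  rewrite (@big_cat_nat _ _ _ a) //= [X in X + _](_ : _ = 0) ?add0r; last first.
    by rewrite big_nat_cond big1 // => m /andP[/andP[_ m1] _]; rewrite /interval_ind leqNgt m1 /= mul0r.
  rewrite -{1}[a]add0n big_addn big_distrr /=; apply: eq_big_nat => i /andP[_ ib].
  move: ib; rewrite ltn_subRL addnC => ib.
  by rewrite /interval_ind leq_addl ib rmorph1 mul1r natrD mulrDl expeD -!expeMn mulrC.
set z := expe x; set G := \sum_(0 <= i < b - a) z ^+ i.
have D2 : dirichlet h.*2 x = dirichlet h x * (1 + z ^+ h).
  rewrite !dirichletE -/z -addnn (@big_cat_nat _ _ _ h) //= ?leq_addr // mulrDr mulr1; congr (_ + _).
  rewrite -{1}[h]add0n big_addn addnK big_distrl /=; apply: eq_bigr => i _.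
  by rewrite exprD.
have G1 : (1 - z) * G = 1 - z ^+ (b - a) by exact: geom_sum.
have D1 : (1 - z) * dirichlet h x = 1 - z ^+ h by rewrite dirichletE; exact: geom_sum.
have zb : z ^+ b = z ^+ a * z ^+ (b - a) by rewrite -exprD subnKC.
have -> : real_complex R h%:R^-1 = 2 * real_complex R h.*2%:R^-1.
  have -> : (2 : R[i]) = real_complex R 2 by rewrite rmorph_nat.
  rewrite -rmorphM; congr (real_complex R _).
  by rewrite -muln2 natrM; field; rewrite pnatr_eq0 -lt0n.
rewrite D2 zb; set c := real_complex R _; set D := dirichlet h x in D1 *.
transitivity (c * D * z ^+ a * ((1 - z ^+ h) * G)); first by ring.
rewrite -D1; transitivity (c * D ^+ 2 * z ^+ a * ((1 - z) * G)); first by ring.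
by rewrite G1; ring.
Qed.

Lemma mean_dirichlet_sq (R : realType) q h : (0 < q)%N ->
  mean (fun x : R => nc (dirichlet h (q%:R * x)) ^+ 2) = h%:R.
Proof.
move=> q0; rewrite parseval // (eq_bigr (fun=> 1)) => [|i _]; last by rewrite expr1n.
by rewrite sumr_const_nat subn0.
Qed.

Lemma bmeas_nc_trigpoly (R : realType) (B : nat) (c : nat -> R) a : bmeas (fun x => nc (trigpoly B c (a * x))).
Proof. by apply: cbmeas_norm; exact: cbmeas_trigpolyM. Qed.

Lemma bmeas_sq (R : realType) (f : R -> R) : bmeas f -> bmeas (fun x => f x ^+ 2).
Proof. by move=> bf; have := bmeasM bf bf; congr bmeas; apply/funext => x; rewrite expr2. Qed.

(** The mean value of the Fejer kernel [|dirichlet h| ^ 2 / h] is one. *)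
Lemma mean_smooth_diff (R : realType) (q a b h B : nat) : (0 < q)%N -> (a <= b)%N -> (0 < h)%N -> (b + h.*2 <= B)%N ->
  mean (fun x : R => nc (trigpoly B (fun m => smooth R a b h m - smooth R a b h.*2 m) (q%:R * x))) <= 1.
Proof.
move=> q0 ab h0 bB.
have h0' : 0 < h%:R :> R by rewrite ltr0n.
rewrite -[X in _ <= X](@mulVf _ (h%:R : R)) ?gt_eqF // -[X in _ <= _ * X](@mean_dirichlet_sq R q) //.
have bD : bmeas (fun x : R => nc (dirichlet h (q%:R * x)) ^+ 2) by apply: bmeas_sq; exact: bmeas_nc_trigpoly.
rewrite -meanZ //; apply: mean_le.
- exact: bmeas_nc_trigpoly.
- by apply: bmeasM => //; exact: bmeas_cst.
move=> x _; rewrite smooth_diff // !Normc.normcM normcR -mulrA.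
have h2 : h.*2%:R^-1 = h%:R^-1 / 2 :> R by rewrite -muln2 natrM invfM.
rewrite h2 ger0_norm ?divr_ge0 ?invr_ge0 // -!mulrA ler_wpM2l ?invr_ge0 //.
set D := nc (dirichlet _ _); have D0 : 0 <= D ^+ 2 by rewrite exprn_ge0 // normc_ge0.
have : nc (expe (q%:R * x) ^+ a - expe (q%:R * x) ^+ b) <= 2.
  apply: le_trans (normcD_le _ _) _; rewrite -!expeMn normc_expe.
  by rewrite nc_opp normc_expe.
nra.
Qed.

Lemma sum_ind_le a b B : (\sum_(0 <= m < B) (a <= m < b) <= b - a)%N.
Proof.
have -> : (\sum_(0 <= m < B) (a <= m < b) = count (fun m => a <= m < b) (iota 0 B))%N.
  rewrite /index_iota subn0; elim: (iota 0 B) => [|m s IH]; first by rewrite big_nil.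
  by rewrite big_cons IH.
rewrite -size_filter -[X in (_ <= X)%N](size_iota a); apply: uniq_leq_size.
  by rewrite filter_uniq // iota_uniq.
by move=> m; rewrite mem_filter !mem_iota => /andP[/andP[am mb] _]; rewrite am /=; lia.
Qed.

(** Both factors are Dirichlet kernels of length at most [3 h], hence have mean squares of
    order [h]; the arithmetic-geometric mean inequality gives the bound for the product. *)
Lemma mean_smooth (R : realType) (q a b h B : nat) : (0 < q)%N -> (0 < h)%N -> (b + h <= B)%N ->
  (b - a <= 3 * h)%N -> mean (fun x : R => nc (trigpoly B (smooth R a b h) (q%:R * x))) <= 2.
Proof.
move=> q0 h0 bB bh.
have h0' : 0 < h%:R :> R by rewrite ltr0n.
have bD : bmeas (fun x : R => nc (dirichlet h (q%:R * x)) ^+ 2) by apply: bmeas_sq; exact: bmeas_nc_trigpoly.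
have bT : bmeas (fun x : R => nc (trigpoly B (interval_ind R a b) (q%:R * x)) ^+ 2) by apply: bmeas_sq; exact: bmeas_nc_trigpoly.
have mT : mean (fun x : R => nc (trigpoly B (interval_ind R a b) (q%:R * x)) ^+ 2) <= 3 * h%:R.
  rewrite parseval // (eq_bigr (fun m => ((a <= m < b)%N : nat)%:R : R)); last first.
    by move=> m _; rewrite /interval_ind; case: (_ && _); rewrite ?expr1n ?expr0n.
  rewrite -natr_sum -natrM ler_nat; apply: leq_trans bh; exact: sum_ind_le.
apply: (@le_trans _ _ (mean (fun x : R => (2 * h%:R)^-1 * (nc (dirichlet h (q%:R * x)) ^+ 2 + nc (trigpoly B (interval_ind R a b) (q%:R * x)) ^+ 2)))).
  apply: mean_le; first exact: bmeas_nc_trigpoly.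
    by apply: bmeasM; [exact: bmeas_cst|exact: bmeasD].
  move=> x _; rewrite trigpoly_smooth // !Normc.normcM normcR ger0_norm ?invr_ge0 // invfM -!mulrA.
  rewrite [2^-1 * _]mulrCA ler_wpM2l ?invr_ge0 //.
  set u := nc _; set v := nc _; have := sqr_ge0 (u - v); rewrite sqrrB; lra.
rewrite meanZ ?meanD //; last exact: bmeasD.
rewrite mean_dirichlet_sq // ler_pdivrMl ?mulr_gt0 //; lra.
Qed.

(** * Dyadic layers of a window *)

(** The multiples [q m] of [q] in the window (N - K, N] are those with
    [win_lo N K q <= m < win_hi N q]. *)
Definition win_lo (R : realType) (N K : R) (q : nat) : nat := (Num.truncn ((N - K) / q%:R)).+1.

Definition win_hi (R : realType) (N : R) (q : nat) : nat := (Num.truncn (N / q%:R)).+1.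

Lemma lo_le (R : realType) (N K : R) q m : K <= N -> (0 < q)%N ->
  (win_lo N K q <= m)%N = (N - K < (q * m)%:R).
Proof.
move=> KN q0; have q0' : 0 < q%:R :> R by rewrite ltr0n.
rewrite /win_lo truncn_lt_nat; last by rewrite divr_ge0 // subr_ge0.
by rewrite ltr_pdivrMr // -natrM mulnC.
Qed.

Lemma lt_hi (R : realType) (N : R) q m : 0 <= N -> (0 < q)%N ->
  (m < win_hi N q)%N = ((q * m)%:R <= N).
Proof.
move=> N0 q0; have q0' : 0 < q%:R :> R by rewrite ltr0n.
by rewrite /win_hi ltnS truncn_ge_nat ?divr_ge0 // ler_pdivlMr // -natrM mulnC.
Qed.

Lemma lo_le_hi (R : realType) (N K : R) q : 0 <= K <= N -> (0 < q)%N -> (win_lo N K q <= win_hi N q)%N.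
Proof.
move=> /andP[K0 KN] q0; rewrite /win_lo /win_hi ltnS; apply: le_truncn.
by rewrite ler_wpM2r ?invr_ge0 // lerBlDr lerDl.
Qed.

Lemma hi_sub_lo (R : realType) (N K : R) q : 0 <= K <= N -> (0 < q)%N ->
  (win_hi N q - win_lo N K q)%:R <= K / q%:R + 1.
Proof.
move=> KN q0; have q0' : 0 < q%:R :> R by rewrite ltr0n.
have /andP[K0 KN'] := KN; have lh := lo_le_hi KN q0; rewrite natrB // /win_lo /win_hi -!natr1.
have h1 : (Num.truncn (N / q%:R))%:R <= N / q%:R by rewrite truncn_le divr_ge0 // (le_trans K0).
have := truncnS_gt ((N - K) / q%:R); rewrite -natr1 mulrBl; lra.
Qed.

(** For [2 ^ j q > K] the interval is too short to have a plateau after smoothing, and the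
    layers stop. *)
Definition smooth_win (R : realType) (N K : R) (j q m : nat) : R :=
  if (2 ^ j * q)%:R <= K then smooth R (win_lo N K q) (win_hi N q) (2 ^ j) m else 0.

(** [layer_win] is the layer of the window at scale [2 ^ j]; [end_win] is what remains at the two
    ends of the window after the layers of larger scale have been removed. *)
Definition layer_win (R : realType) (N K : R) (j q m : nat) : R := smooth_win N K j q m - smooth_win N K j.+1 q m.

Definition end_win (R : realType) (N K : R) (j q m : nat) : R := interval_ind R (win_lo N K q) (win_hi N q) m - smooth_win N K j q m.

(** The multiples of [q] at distance [O(2 ^ j q)] from an end of the window. *)
Definition near_ends (R : realType) (N K : R) (j q n : nat) : bool :=
  (q %| n)%N && ((N - K < n%:R <= N - K + 4 * (2 ^ j * q)%:R) || (N < n%:R <= N + 4 * (2 ^ j * q)%:R)).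

Lemma near_endsI (R : realType) (N K : R) j q m : 0 <= K <= N -> (0 < q)%N ->
  (win_lo N K q <= m < win_hi N q + 2 ^ j.+1)%N -> (m < win_hi N q)%N ==> ((m < win_lo N K q + 2 ^ j.+1)%N || (K < (2 ^ j.+1 * q)%:R)) ->
  near_ends N K j q (q * m).
Proof.
move=> KN q0 /andP[lm mh] H; have q0' : 0 < q%:R :> R by rewrite ltr0n.
have /andP[K0 KN'] := KN; have N0 : 0 <= N by apply: le_trans KN'.
rewrite /near_ends dvdn_mulr //= -lo_le // lm /=.
have t0 : 0 <= (2 ^ j * q)%:R :> R by [].
have E2 : (2 ^ j.+1 * q)%:R = 2 * (2 ^ j * q)%:R :> R by rewrite expnS !natrM mulrA.
have [mhi|mhi] := ltnP m (win_hi N q).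
  move: H; rewrite mhi /= => /orP[ml|Kq].
    apply/orP; left.
    have : m%:R <= (N - K) / q%:R + (2 ^ j.+1)%:R.
      have h : (m <= Num.truncn ((N - K) / q%:R) + 2 ^ j.+1)%N by rewrite -ltnS -addSn.
      apply: (@le_trans _ _ (Num.truncn ((N - K) / q%:R) + 2 ^ j.+1)%N%:R); first by rewrite ler_nat.
      by rewrite natrD lerD2r truncn_le divr_ge0 // subr_ge0.
    rewrite -(ler_pM2r q0') mulrDl divfK ?gt_eqF // -!natrM mulnC E2; lra.
  apply/orP; left; move: mhi; rewrite lt_hi // => h; apply: (le_trans h).
  by move: Kq; rewrite E2; lra.
apply/orP; right.
have : ~~ (m < win_hi N q)%N by rewrite -leqNgt.
rewrite lt_hi // -ltNge => -> /=.
have : m%:R <= N / q%:R + (2 ^ j.+1)%:R.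
  have h : (m <= Num.truncn (N / q%:R) + 2 ^ j.+1)%N by rewrite -ltnS -addSn.
  apply: (@le_trans _ _ (Num.truncn (N / q%:R) + 2 ^ j.+1)%N%:R); first by rewrite ler_nat.
  by rewrite natrD lerD2r truncn_le divr_ge0.
rewrite -(ler_pM2r q0') mulrDl divfK ?gt_eqF // -!natrM mulnC E2; lra.
Qed.

Lemma smooth_win_ge0 (R : realType) (N K : R) j q m : 0 <= smooth_win N K j q m.
Proof. by rewrite /smooth_win; case: ifP => // _; exact: smooth_ge0. Qed.

Lemma smooth_win_le1 (R : realType) (N K : R) j q m : smooth_win N K j q m <= 1.
Proof. by rewrite /smooth_win; case: ifP => // _; exact: smooth_le1. Qed.

Lemma smooth_win0 (R : realType) (N K : R) j q m : ~~ (win_lo N K q <= m < win_hi N q + 2 ^ j)%N -> smooth_win N K j q m = 0.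
Proof. by move=> H; rewrite /smooth_win smooth_supp //; case: ifP. Qed.

Lemma normr_sub01 (R : realDomainType) (x y : R) : 0 <= x -> x <= 1 -> 0 <= y -> y <= 1 -> `|x - y| <= 1.
Proof. by move=> x0 x1 y0 y1; rewrite ler_norml; apply/andP; split; lra. Qed.

Lemma layer_win_near (R : realType) (N K : R) j q m : 0 <= K <= N -> (0 < q)%N ->
  layer_win N K j q m != 0 -> ((2 ^ j * q)%:R <= K) && near_ends N K j q (q * m).
Proof.
move=> KN q0 nz.
have mono : (2 ^ j * q)%:R <= (2 ^ j.+1 * q)%:R :> R by rewrite ler_nat leq_mul2r leq_exp2l // leqnSn orbT.
have c1 : (2 ^ j * q)%:R <= K.
  rewrite leNgt; apply/negP => h; case/negP: nz; rewrite /layer_win /smooth_win !ifF ?subrr //; apply/negbTE; rewrite -ltNge //.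
  exact: lt_le_trans mono.
rewrite c1 /=.
have range : (win_lo N K q <= m < win_hi N q + 2 ^ j.+1)%N.
  apply/negPn/negP => H; case/negP: nz; rewrite /layer_win !smooth_win0 ?subrr //.
  apply: contra H => /andP[-> /= h]; apply: leq_trans h _.
  by rewrite leq_add2l leq_exp2l.
apply: near_endsI => //; apply/implyP => mh.
case: (leP (2 ^ j.+1 * q)%:R K) => c2; last by rewrite orbT.
rewrite orbF ltnNge; apply/negP => h; case/negP: nz.
rewrite /layer_win /smooth_win c1 c2 !smooth_plateau ?subrr ?expn_gt0 // mh andbT //.
by apply: leq_trans h; rewrite leq_add2l leq_exp2l.
Qed.

Lemma end_win_near (R : realType) (N K : R) j q m : 0 <= K <= N -> (0 < q)%N -> (2 ^ j * q)%:R <= K ->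
  end_win N K j q m != 0 -> near_ends N K j q (q * m).
Proof.
move=> KN q0 c1 nz.
have range : (win_lo N K q <= m < win_hi N q + 2 ^ j.+1)%N.
  apply/negPn/negP => H; case/negP: nz; rewrite /end_win /interval_ind smooth_win0 ?subr0.
    rewrite (_ : _ && _ = false) //; apply: contraNF H => /andP[-> h].
    by apply: leq_trans h _; rewrite leq_addr.
  apply: contra H => /andP[-> /= h]; apply: leq_trans h _.
  by rewrite leq_add2l leq_exp2l.
apply: near_endsI => //; apply/implyP => mh.
case: ltnP => // h; case/negP: nz; have /andP[lm _] := range.
rewrite /end_win /interval_ind lm mh /smooth_win c1 smooth_plateau ?subrr ?expn_gt0 // mh andbT.
by apply: leq_trans h; rewrite leq_add2l leq_exp2l.
Qed.

Lemma lift_le (R : realType) (w : nat -> R) q n (P : bool) : (0 < q)%N -> (forall m, `|w m| <= 1) ->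
  (forall m, w m != 0 -> n = (q * m)%N -> P) -> `|lift_coef q w n| <= P%:R.
Proof.
move=> q0 w1 H; rewrite /lift_coef; case: ifP => [/dvdnP[m E]|_]; last by rewrite normr0.
rewrite E mulnK //; have [->|nz] := eqVneq (w m) 0; first by rewrite normr0.
by rewrite (H m nz) // E mulnC.
Qed.

Lemma lift_layer_win (R : realType) (N K : R) j q n : 0 <= K <= N -> (0 < q)%N ->
  `|lift_coef q (layer_win N K j q) n| <= (((2 ^ j * q)%:R <= K) && near_ends N K j q n)%:R.
Proof.
move=> KN q0; apply: lift_le => // m.
  by apply: normr_sub01; rewrite ?smooth_win_ge0 ?smooth_win_le1.
by move=> nz ->; exact: layer_win_near.
Qed.

Lemma lift_end_win (R : realType) (N K : R) j q n : 0 <= K <= N -> (0 < q)%N -> (2 ^ j * q)%:R <= K ->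
  `|lift_coef q (end_win N K j q) n| <= (near_ends N K j q n)%:R.
Proof.
move=> KN q0 c1; apply: lift_le => // m.
  by apply: normr_sub01; rewrite ?smooth_win_ge0 ?smooth_win_le1 // /interval_ind; case: (_ && _).
by move=> nz ->; exact: end_win_near.
Qed.

(** In the topmost layer of [q] only one smoothed interval is left; its length is comparable
    to [2 ^ j], so [mean_smooth] applies instead of [mean_smooth_diff]. *)
Lemma mean_layer_win (R : realType) (N K : R) j q B : 0 <= K <= N -> (0 < q)%N -> (win_hi N q + 2 ^ j.+1 <= B)%N ->
  mean (fun x : R => nc (trigpoly B (layer_win N K j q) (q%:R * x))) <= 2.
Proof.
move=> KN q0 hB; have q0' : 0 < q%:R :> R by rewrite ltr0n.
have h0 : (0 < 2 ^ j)%N by rewrite expn_gt0.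
have E2 : (2 ^ j.+1 = (2 ^ j).*2)%N by rewrite expnS mul2n.
case: (leP (2 ^ j * q)%:R K) => c1; last first.
  rewrite (_ : (fun x => _) = fun=> 0) ?mean_cst //; apply/funext => x.
  rewrite /trigpoly big1 ?Normc.normc0 // => m _.
  have /eqP -> : layer_win N K j q m == 0; last by rewrite mul0r.
  by apply/negPn/negP => /(layer_win_near KN q0); rewrite leNgt c1.
case: (leP (2 ^ j.+1 * q)%:R K) => c2.
  apply: (@le_trans _ _ 1); last by rewrite ler1n.
  have -> : layer_win N K j q = (fun m => smooth R (win_lo N K q) (win_hi N q) (2 ^ j) m - smooth R (win_lo N K q) (win_hi N q) (2 ^ j).*2 m).
    by apply/funext => m; rewrite /layer_win /smooth_win c1 c2 E2.
  by apply: mean_smooth_diff => //; rewrite ?lo_le_hi // -E2.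
have -> : layer_win N K j q = smooth R (win_lo N K q) (win_hi N q) (2 ^ j).
  by apply/funext => m; rewrite /layer_win /smooth_win c1 leNgt c2 /= subr0.
apply: mean_smooth => //.
  by apply: leq_trans hB; rewrite leq_add2l E2 -addnn leq_addr.
rewrite -(ler_nat R); apply: le_trans (hi_sub_lo KN q0) _.
have : K / q%:R <= 2 * (2 ^ j)%:R.
  by rewrite ler_pdivrMr // -!natrM -expnS ltW.
have : 1 <= (2 ^ j)%:R :> R by rewrite ler1n.
rewrite natrM; lra.
Qed.

(** The sum telescopes down from scales exceeding [K], where [smooth_win] vanishes. *)
Lemma window_layers (R : realType) (N K : R) j0 J q m : (j0 <= J)%N -> (0 < q)%N -> K < (2 ^ J)%:R ->
  interval_ind R (win_lo N K q) (win_hi N q) m = end_win N K j0 q m + \sum_(j0 <= j < J) layer_win N K j q m.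
Proof.
move=> jJ q0 KJ; rewrite /layer_win.
have -> : \sum_(j0 <= j < J) (smooth_win N K j q m - smooth_win N K j.+1 q m) = smooth_win N K j0 q m - smooth_win N K J q m.
  rewrite -opprB -(telescope_sumr (fun j => smooth_win N K j q m) jJ) -sumrN; apply: eq_bigr => j _; by rewrite opprB.
have -> : smooth_win N K J q m = 0.
  rewrite /smooth_win ifF //; apply/negbTE; rewrite -ltNge (lt_le_trans KJ) // ler_nat leq_pmulr //.
by rewrite /end_win subr0 subrK.
Qed.

(** * First and second moments of a layer *)

Lemma sum_inv_sq_le (R : realFieldType) n : (0 < n)%N ->
  \sum_(1 <= v < n.+1) (v%:R : R) ^- 2 <= 2 - n%:R^-1.
Proof.
elim: n => // n IH _; have [->|n0] := posnP n.
  by rewrite big_nat1 expr1n invr1; lra.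
rewrite big_nat_recr //=; apply: le_trans (lerD (IH n0) (lexx _)) _.
have n0' : 0 < n%:R :> R by rewrite ltr0n.
rewrite -(natr1 n); set x : R := n%:R in n0' *.
rewrite -subr_ge0.
have -> : 2 - (x + 1)^-1 - (2 - x^-1 + (x + 1) ^- 2) = (x * (x + 1) ^+ 2)^-1.
  by field; rewrite !gt_eqF //; lra.
by rewrite invr_ge0 mulr_ge0 ?exprn_ge0 //; lra.
Qed.

Lemma lcm_pow_dvd k d d' n : (d ^ k %| n)%N -> (d' ^ k %| n)%N -> ((lcmn d d') ^ k %| n)%N.
Proof.
move=> h1 h2; have [->|n0] := posnP n; first by rewrite dvdn0.
have [->|k0] := posnP k; first by rewrite expn0 dvd1n.
have d0 : (0 < d)%N by case: (d) h1 => //; rewrite exp0n // dvd0n => /eqP n0'; move: n0; rewrite n0'.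
have d'0 : (0 < d')%N by case: (d') h2 => //; rewrite exp0n // dvd0n => /eqP n0'; move: n0; rewrite n0'.
have l0 : (0 < lcmn d d')%N by rewrite lcmn_gt0 d0.
apply/dvdn_partP => [|p]; first by rewrite expn_gt0 l0.
rewrite mem_primes => /and3P[pp _ _]; rewrite p_part pfactor_dvdn // lognX.
have e1 : (k * logn p d <= logn p n)%N by rewrite -lognX dvdn_leq_log.
have e2 : (k * logn p d' <= logn p n)%N by rewrite -lognX dvdn_leq_log.
by rewrite logn_lcm // maxnMr geq_max e1 e2.
Qed.

Lemma sum_multiples (R : realType) v n : \sum_(1 <= d < n.+1) (v %| d)%N%:R = (n %/ v)%N%:R :> R.
Proof. by rewrite divn_count_dvd natr_sum. Qed.

(** Sorting [d'] by [v = d / gcd(d, d')] bounds the inner sum by the sum of [1 / v] over the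
    divisors [v] of [d], and the average of the latter over [d] is bounded. *)
Lemma gcd_sum_le (R : realType) Y :
  \sum_(1 <= d < Y.+1) \sum_(1 <= d' < d.+1) ((gcdn d d')%:R / d%:R) ^+ 2 <= 2 * Y%:R :> R.
Proof.
have step d : (0 < d)%N -> \sum_(1 <= d' < d.+1) ((gcdn d d')%:R / d%:R) ^+ 2 <=
    \sum_(v <- divisors d) v%:R^-1 :> R.
  move=> d0; have d0' : 0 < d%:R :> R by rewrite ltr0n.
  apply: (@le_trans _ _ (\sum_(1 <= d' < d.+1) \sum_(v <- divisors d) (v%:R^-1) ^+ 2 * ((d %/ v) %| d')%N%:R)).
    apply: ler_sum => d' _; have gd := dvdn_gcdl d d'.
    have g0 : (0 < gcdn d d')%N by rewrite gcdn_gt0 d0.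
    have vd : (d %/ gcdn d d' %| d)%N by apply/dvdnP; exists (gcdn d d'); rewrite mulnC divnK.
    rewrite (bigD1_seq (d %/ gcdn d d')%N) ?divisors_uniq -?dvdn_divisors //=.
    have -> : (d %/ (d %/ gcdn d d') = gcdn d d')%N by rewrite divnA // mulKn.
    rewrite dvdn_gcdr mulr1 -[X in X <= _]addr0; apply: lerD.
      rewrite le_eqVlt; apply/orP; left; apply/eqP; congr (_ ^+ 2).
      rewrite -{2}(divnK gd) natrM; field; rewrite !pnatr_eq0 -!lt0n g0 andbT.
      by rewrite divn_gt0 // dvdn_leq.
    by apply: sumr_ge0 => v _; rewrite mulr_ge0 // exprn_ge0 // invr_ge0.
  rewrite exchange_big /= big_seq [X in _ <= X]big_seq; apply: ler_sum => v.
  rewrite -dvdn_divisors // => vd; rewrite -mulr_sumr sum_multiples.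
  have v0 : (0 < v)%N by case: (v) vd d0 => //; rewrite dvd0n => /eqP ->.
  have -> : (d %/ (d %/ v) = v)%N by rewrite divnA // mulKn.
  by rewrite expr2 -mulrA mulVf ?mulr1 // pnatr_eq0 -lt0n.
apply: (@le_trans _ _ (\sum_(1 <= d < Y.+1) \sum_(1 <= v < Y.+1) v%:R^-1 * (v %| d)%N%:R)).
  rewrite big_nat [X in _ <= X]big_nat; apply: ler_sum => d /andP[d0 dY].
  apply: le_trans (step d d0) _.
  have -> : \sum_(v <- divisors d) v%:R^-1 = \sum_(1 <= v < Y.+1 | (v %| d)%N) v%:R^-1 :> R.
    rewrite -[RHS]big_filter; apply: perm_big; apply: uniq_perm; rewrite ?divisors_uniq ?filter_uniq ?iota_uniq // => v.
    rewrite -dvdn_divisors // mem_filter mem_index_iota; case: (boolP (v %| d)%N) => //= vd.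
    rewrite ltnS (leq_trans (dvdn_leq d0 vd)) // andbT; apply/esym.
    by case: (v) vd d0 => //; rewrite dvd0n => /eqP ->.
  rewrite big_mkcond /=; apply: ler_sum => v _; case: (v %| d)%N; rewrite ?mulr1 ?mulr0 //.
rewrite exchange_big /=.
apply: (@le_trans _ _ (\sum_(1 <= v < Y.+1) Y%:R * v%:R ^- 2)).
  rewrite big_nat [X in _ <= X]big_nat; apply: ler_sum => v /andP[v0 _].
  rewrite -mulr_sumr sum_multiples.
  have v0' : 0 < v%:R :> R by rewrite ltr0n.
  rewrite mulrC -exprVn expr2 mulrA ler_wpM2r ?invr_ge0 ?(ltW v0') // ler_pdivlMr //.
  by rewrite -natrM ler_nat leq_trunc_div.
rewrite -mulr_sumr mulrC; have [->|Y0] := posnP Y; first by rewrite !mulr0.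
apply: ler_wpM2r => //; apply: le_trans (sum_inv_sq_le _ Y0) _.
by rewrite lerBlDr lerDl invr_ge0.
Qed.

Lemma count_orb (P Q : pred nat) s : (count (fun n => P n || Q n) s <= count P s + count Q s)%N.
Proof. by rewrite -count_predUI leq_addr. Qed.

(** Only the shorter of the two windows is used; it contains at most
    [8 2 ^ j d' ^ k / lcm(d, d') ^ k + 2] common multiples. *)
Lemma count_near_pair (R : realType) (N K : R) j k d d' B : (2 <= k)%N -> (0 < d')%N -> (d' <= d)%N ->
  (count (fun n => near_ends N K j (d ^ k) n && near_ends N K j (d' ^ k) n) (iota 0 B))%:R <=
  8 * (2 ^ j)%:R * ((gcdn d d')%:R / d%:R) ^+ 2 + 2 :> R.
Proof.
move=> k2 d'0 dd; have d0 : (0 < d)%N by apply: leq_trans dd.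
pose L : R := 4 * (2 ^ j * d' ^ k)%:R.
have L0 : 0 <= L by rewrite mulr_ge0.
pose l := lcmn d d'.
have l0 : (0 < l)%N by rewrite lcmn_gt0 d0.
have lk : (0 < l ^ k)%N by rewrite expn_gt0 l0.
pose P (a : R) n := (l ^ k %| n)%N && (a < n%:R <= a + L).
have H a : (count (P a) (iota 0 B))%:R <= L / (l ^ k)%:R + 1.
  apply: count_multiples => // [x /andP[] //|x y /andP[_ /andP[x1 x2]] /andP[_ /andP[y1 y2]] xy].
  by rewrite natrB //; lra.
have lcmk n : (d ^ k %| n)%N -> (d' ^ k %| n)%N -> (l ^ k %| n)%N by exact: lcm_pow_dvd.
pose P1 := P (N - K).
have : (count (fun n => near_ends N K j (d ^ k) n && near_ends N K j (d' ^ k) n) (iota 0 B) <=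
   count P1 (iota 0 B) + count (P N) (iota 0 B))%N.
  apply: leq_trans (count_orb _ _ _); apply: sub_count => n /andP[/andP[h1 _] /andP[h2 h3]].
  by rewrite /P1 /P lcmk.
rewrite -(ler_nat R) natrD => /le_trans; apply; apply: le_trans (lerD (H _) (H _)) _.
have E : (d'%:R / l%:R) = (gcdn d d')%:R / d%:R :> R.
  have gl : (gcdn d d')%:R * l%:R = d%:R * d'%:R :> R by rewrite -!natrM mulnC muln_lcm_gcd.
  apply/eqP; rewrite eqr_div ?pnatr_eq0 -?lt0n // gl mulrC //.
have -> : L / (l ^ k)%:R + 1 + (L / (l ^ k)%:R + 1) = 8 * (2 ^ j)%:R * (d'%:R / l%:R) ^+ k + 2.
  rewrite /L expr_div_n natrM !natrX; ring.
rewrite E lerD2r ler_wpM2l //.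
apply: ler_wiXn2l => //.
by rewrite ler_pdivrMr ?ltr0n // mul1r ler_nat dvdn_leq // dvdn_gcdl.
Qed.

(** By Parseval's identity the mean square is at most the number of triples of [d], [d'] and a
    common multiple of [d ^ k] and [d' ^ k] near the ends of the window. *)
Lemma layer_L2 (R : realType) (N K : R) j k Y B (m : nat -> R) (w : nat -> nat -> R) : (2 <= k)%N ->
  m 0%N = 0 -> (forall d, `|m d| <= 1) ->
  (forall d n, (0 < d <= Y)%N -> `|lift_coef (d ^ k) (w d) n| <= (near_ends N K j (d ^ k) n)%:R) ->
  (forall d n, (0 < d <= Y)%N -> (B <= n)%N -> w d n = 0) ->
  mean (fun x => nc (\sum_(0 <= d < Y.+1) real_complex R (m d) * trigpoly B (w d) ((d ^ k)%:R * x)) ^+ 2) <=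
  2 * Y%:R ^+ 2 + 32 * (2 ^ j)%:R * Y%:R.
Proof.
move=> k2 m0 m1 hw hB.
have k0 : (0 < k)%N by apply: leq_trans k2.
pose w' d n := if (0 < d <= Y)%N then w d n else 0.
pose chi d n := [&& (0 < d)%N & near_ends N K j (d ^ k) n].
have -> : (fun x => nc (\sum_(0 <= d < Y.+1) real_complex R (m d) * trigpoly B (w d) ((d ^ k)%:R * x)) ^+ 2) =
  (fun x => nc (\sum_(0 <= d < Y.+1) real_complex R (m d) * trigpoly B (w' d) ((d ^ k)%:R * x)) ^+ 2).
  apply/funext => x; congr (nc _ ^+ 2); apply: eq_big_nat => d /andP[_ dY].
  have [->|d0] := posnP d; first by rewrite m0 rmorph0 !mul0r.
  by congr (_ * _); apply: eq_trigpoly => n _; rewrite /w' d0 -ltnS dY.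
apply: le_trans (@mean_sq_combo R Y.+1 B k m w' chi k0 m0 m1 _ _) _.
- move=> d n d0; have [dY|dY] := boolP (0 < d <= Y)%N.
    rewrite /chi d0 /=; apply: le_trans (hw _ _ dY); rewrite /lift_coef /w' dY //.
  by rewrite /lift_coef /w' (negbTE dY) if_same normr0.
- by move=> d n Bn; rewrite /w'; case: ifP => // dY; apply: hB.
set C := iota 0 _; pose T d d' : R := ((gcdn d d')%:R / d%:R) ^+ 2.
have T0 d d' : 0 <= T d d' by rewrite exprn_ge0 // divr_ge0.
pose c d d' := (count (fun n => chi d n && chi d' n) C)%:R : R.
have cS d d' : c d d' = c d' d by congr (_%:R); apply: eq_count => n; rewrite andbC.
have c0 d : c 0%N d = 0 by rewrite /c (@eq_count _ _ pred0) ?count_pred0.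
have c1 d d' : (0 < d')%N -> (d' <= d)%N -> c d d' <= 8 * (2 ^ j)%:R * T d d' + 2.
  move=> d0 dd; apply: le_trans (@count_near_pair R N K j k d d' _ k2 d0 dd).
  by rewrite ler_nat; apply: sub_count => n /andP[/andP[_ ->] /andP[_ ->]].
rewrite -/c (@big_ltn _ _ _ 0) // [X in X + _]big1 ?add0r; last by move=> d _; exact: c0.
have -> : \sum_(1 <= d < Y.+1) \sum_(0 <= d' < Y.+1) (count (fun n => chi d n && chi d' n) C)%:R =
    \sum_(1 <= d < Y.+1) \sum_(1 <= d' < Y.+1) c d d'.
  by apply: eq_bigr => d _; rewrite big_ltn // -/(c d 0%N) cS c0 add0r.
apply: (@le_trans _ _ (\sum_(1 <= d < Y.+1) \sum_(1 <= d' < Y.+1)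
   (8 * (2 ^ j)%:R * ((d' <= d)%N%:R * T d d' + (d <= d')%N%:R * T d' d) + 2))).
  rewrite big_nat [X in _ <= X]big_nat; apply: ler_sum => d /andP[d0 _].
  rewrite big_nat [X in _ <= X]big_nat; apply: ler_sum => d' /andP[d'0 _].
  have t0 : 0 <= 8 * (2 ^ j)%:R :> R by rewrite mulr_ge0.
  case/orP: (leq_total d' d) => dd.
    apply: le_trans (c1 _ _ d'0 dd) _; rewrite lerD2r ler_wpM2l // dd mul1r lerDl mulr_ge0 //.
  rewrite cS; apply: le_trans (c1 _ _ d0 dd) _; rewrite lerD2r ler_wpM2l // dd mul1r lerDr mulr_ge0 //.
under eq_bigr do rewrite big_split /= sumr_const_nat subn1 /= -mulr_sumr big_split /=.
rewrite big_split /= sumr_const_nat subn1 /= -mulr_sumr big_split /=.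
have S1 : \sum_(1 <= d < Y.+1) \sum_(1 <= d' < Y.+1) (d' <= d)%N%:R * T d d' <= 2 * Y%:R.
  apply: le_trans (gcd_sum_le R Y); rewrite big_nat [X in _ <= X]big_nat; apply: ler_sum => d /andP[d0 dY].
  rewrite (@big_cat_nat _ _ _ d.+1) //= [X in _ + X](_ : _ = 0) ?addr0; last first.
    by rewrite big_nat big1 // => d' /andP[h _]; rewrite leqNgt h mul0r.
  rewrite big_nat [X in _ <= X]big_nat; apply: ler_sum => d' /andP[_ h].
  by rewrite -ltnS h mul1r.
have S2 : \sum_(1 <= d < Y.+1) \sum_(1 <= d' < Y.+1) (d <= d')%N%:R * T d' d <= 2 * Y%:R.
  by rewrite exchange_big.
have t0 : 0 <= 8 * (2 ^ j)%:R :> R by rewrite mulr_ge0.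
have := ler_wpM2l t0 (lerD S1 S2).
rewrite -[2 *+ Y]mulr_natr -[_ *+ Y]mulr_natr; move: (_ + _) => S.
set tj := (2 ^ j)%:R; set y := Y%:R; rewrite expr2; lra.
Qed.

Lemma layer_L1 (R : realType) (Y B k : nat) (M : R) (m : nat -> R) (w : nat -> nat -> R) :
  m 0%N = 0 -> (forall d, `|m d| <= 1) -> 0 <= M ->
  (forall d, (0 < d <= Y)%N -> mean (fun x => nc (trigpoly B (w d) ((d ^ k)%:R * x))) <= M) ->
  mean (fun x => nc (\sum_(0 <= d < Y.+1) real_complex R (m d) * trigpoly B (w d) ((d ^ k)%:R * x))) <= M * Y%:R.
Proof.
move=> m0 m1 M0 H.
have b1 d : bmeas (fun x => nc (trigpoly B (w d) ((d ^ k)%:R * x))) by exact: bmeas_nc_trigpoly.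
apply: (@le_trans _ _ (mean (fun x => \sum_(1 <= d < Y.+1) nc (trigpoly B (w d) ((d ^ k)%:R * x))))).
  apply: mean_le.
  - by apply: cbmeas_norm; apply: cbmeas_sum => d; apply: cbmeasM; [exact: cbmeas_cst|exact: cbmeas_trigpolyM].
  - exact: bmeas_sum.
  move=> x _; rewrite big_ltn // m0 rmorph0 mul0r add0r; apply: le_trans (normc_sum_le _ _ _) _.
  apply: ler_sum => d _; rewrite Normc.normcM normcR -[X in _ <= X]mul1r.
  by rewrite ler_wpM2r // normc_ge0.
rewrite mean_sum // big_nat; apply: (@le_trans _ _ (\sum_(1 <= d < Y.+1) M)); last first.
  by rewrite sumr_const_nat subn1 /= mulr_natr.
rewrite [X in _ <= X]big_nat; apply: ler_sum => d /andP[d0 dY]; apply: H.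
by rewrite d0 -ltnS.
Qed.

(** * Layers of the main part *)

(** The part of the exponential sum that comes from the divisors [d <= Z]. *)
Definition main_sum (R : realType) (N K : R) (k Z B : nat) (x : R) : R[i] :=
  \sum_(0 <= d < Z.+1) real_complex R (moebius R d) *
    trigpoly B (interval_ind R (win_lo N K (d ^ k)) (win_hi N (d ^ k))) ((d ^ k)%:R * x).

Definition end_sum (R : realType) (N K : R) (k Z B j : nat) (x : R) : R[i] :=
  \sum_(0 <= d < Z.+1) real_complex R (moebius R d) * trigpoly B (end_win N K j (d ^ k)) ((d ^ k)%:R * x).

Definition layer_sum (R : realType) (N K : R) (k Z B j : nat) (x : R) : R[i] :=
  \sum_(0 <= d < Z.+1) real_complex R (moebius R d) * trigpoly B (layer_win N K j (d ^ k)) ((d ^ k)%:R * x).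

Lemma moebius0 (R : realType) : moebius R 0 = 0.
Proof. by []. Qed.

Lemma cbmeas_combo (R : realType) (B k Z : nat) (m : nat -> R) (w : nat -> nat -> R) :
  cbmeas (fun x => \sum_(0 <= d < Z) real_complex R (m d) * trigpoly B (w d) ((d ^ k)%:R * x)).
Proof. by apply: cbmeas_sum => d; apply: cbmeasM; [exact: cbmeas_cst|exact: cbmeas_trigpolyM]. Qed.

Lemma main_sum_layers (R : realType) (N K : R) k Z B j0 J x : (j0 <= J)%N -> K < (2 ^ J)%:R ->
  main_sum N K k Z B x = end_sum N K k Z B j0 x + \sum_(j0 <= j < J) layer_sum N K k Z B j x.
Proof.
move=> jJ KJ; rewrite /main_sum /end_sum /layer_sum exchange_big -big_split /=; apply: eq_bigr => d _.
have [->|d0] := posnP d; first by rewrite moebius0 rmorph0 !mul0r big1 ?addr0 // => j _; rewrite mul0r.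
rewrite -mulr_sumr -mulrDr; congr (_ * _).
have q0 : (0 < d ^ k)%N by rewrite expn_gt0 d0.
rewrite -[\sum_(j0 <= j < J) _]mulr1.
have -> : \sum_(j0 <= j < J) trigpoly B (layer_win N K j (d ^ k)) ((d ^ k)%:R * x) =
  trigpoly B (fun m => \sum_(j0 <= j < J) layer_win N K j (d ^ k) m) ((d ^ k)%:R * x).
  rewrite /trigpoly exchange_big /=; apply: eq_bigr => m _.
  by rewrite rmorph_sum big_distrl.
by rewrite mulr1 -trigpolyD; apply: eq_trigpoly => m _; exact: window_layers.
Qed.

Lemma hi_le (R : realType) (N : R) q : 0 <= N -> (win_hi N q <= (Num.truncn N).+1)%N.
Proof.
move=> N0; rewrite /win_hi ltnS; have [->|q0] := posnP q; first by rewrite invr0 mulr0 truncn0.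
by apply: le_truncn; rewrite ler_pdivrMr ?ltr0n // ler_peMr // ler1n.
Qed.

Lemma smooth_win_big (R : realType) (N K : R) j q m B : 0 <= N -> ((Num.truncn N).+1 + 2 ^ j <= B)%N -> (B <= m)%N ->
  smooth_win N K j q m = 0.
Proof.
move=> N0 hB Bm; apply: smooth_win0; rewrite negb_and -!leqNgt; apply/orP; right.
by apply: leq_trans Bm; apply: leq_trans hB; rewrite leq_add2r hi_le.
Qed.

Lemma end_sum_L2 (R : realType) (N K : R) k Z B j : (2 <= k)%N -> 0 <= K <= N ->
  (2 ^ j * Z ^ k)%:R <= K -> ((Num.truncn N).+1 + 2 ^ j <= B)%N ->
  mean (fun x => nc (end_sum N K k Z B j x) ^+ 2) <= 2 * Z%:R ^+ 2 + 32 * (2 ^ j)%:R * Z%:R.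
Proof.
move=> k2 KN hZ hB; have N0 : 0 <= N by move: KN => /andP[]; exact: le_trans.
apply: layer_L2 => //.
- exact: normr_moebius_le1.
- move=> d n /andP[d0 dZ]; apply: lift_end_win => //; first by rewrite expn_gt0 d0.
  by apply: le_trans hZ; rewrite ler_nat leq_mul2l leq_exp2r ?dZ ?orbT // (leq_trans _ k2).
- move=> d n _ Bn; rewrite /end_win (smooth_win_big K _ N0 hB Bn) subr0 /interval_ind.
  rewrite (_ : (n < win_hi N (d ^ k))%N = false) ?andbF //; apply/negbTE; rewrite -leqNgt.
  by apply: leq_trans Bn; apply: leq_trans hB; apply: leq_trans (hi_le _ N0) (leq_addr _ _).
Qed.

(** The layer [j] contains only the [d] with [2 ^ j d ^ k <= K]. *)
Lemma layer_sum_trim (R : realType) (N K : R) k Z Y B j x : 0 <= K <= N -> (Y <= Z)%N ->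
  (forall d, (0 < d <= Z)%N -> (2 ^ j * d ^ k)%:R <= K -> (d <= Y)%N) ->
  layer_sum N K k Z B j x = layer_sum N K k Y B j x.
Proof.
move=> KN YZ HY; rewrite /layer_sum (@big_cat_nat _ _ _ Y.+1) //= [X in _ + X](_ : _ = 0) ?addr0 //.
rewrite big_nat big1 // => d /andP[Yd dZ].
have d0 : (0 < d)%N by apply: leq_trans Yd.
rewrite (_ : trigpoly _ _ _ = 0) ?mulr0 // /trigpoly big1 // => m _.
have /eqP -> : layer_win N K j (d ^ k) m == 0; last by rewrite mul0r.
apply/negPn/negP => /(layer_win_near KN); rewrite expn_gt0 d0 => /(_ isT) /andP[h _].
by have := HY d; rewrite d0 -ltnS dZ => /(_ isT h); rewrite leqNgt Yd.
Qed.

Lemma layer_sum_bounds (R : realType) (N K : R) k Z Y B j : (2 <= k)%N -> 0 <= K <= N -> (Y <= Z)%N ->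
  (forall d, (0 < d <= Z)%N -> (2 ^ j * d ^ k)%:R <= K -> (d <= Y)%N) ->
  ((Num.truncn N).+1 + 2 ^ j.+1 <= B)%N ->
  mean (fun x => nc (layer_sum N K k Z B j x)) <= 2 * Y%:R /\
  mean (fun x => nc (layer_sum N K k Z B j x) ^+ 2) <= 2 * Y%:R ^+ 2 + 32 * (2 ^ j)%:R * Y%:R.
Proof.
move=> k2 KN YZ HY hB; have N0 : 0 <= N by move: KN => /andP[]; exact: le_trans.
have -> : layer_sum N K k Z B j = layer_sum N K k Y B j by apply/funext => x; exact: layer_sum_trim.
split.
  apply: layer_L1 => //; first exact: normr_moebius_le1.
  move=> d /andP[d0 dY]; apply: mean_layer_win => //; first by rewrite expn_gt0 d0.
  by apply: leq_trans hB; rewrite leq_add2r hi_le.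
apply: layer_L2 => //; first exact: normr_moebius_le1.
- move=> d n /andP[d0 dZ]; apply: le_trans (lift_layer_win j n KN _) _; first by rewrite expn_gt0 d0.
  by rewrite ler_nat; case: (_ <= K) => //=.
- move=> d n _ Bn; rewrite /layer_win !(@smooth_win_big _ _ _ _ _ _ B) ?subrr //.
  by apply: leq_trans hB; rewrite leq_add2l leq_exp2l.
Qed.

Lemma geometric_sum_le (R : realType) (t : R) a b : 0 <= t < 1 -> \sum_(a <= j < b) t ^+ (j - a) <= (1 - t)^-1.
Proof.
move=> /andP[t0 t1]; have t1' : 0 < 1 - t by lra.
rewrite -{1}(add0n a) big_addn; under eq_bigr do rewrite addnK.
rewrite -[X in _ <= X]div1r ler_pdivlMr // mulrC geom_sum; have : 0 <= t ^+ (b - a) by rewrite exprn_ge0.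
lra.
Qed.

Lemma geometric_sum_rev_le (R : realType) (t : R) a b : 0 <= t < 1 -> \sum_(a <= j < b) t ^+ (b - j) <= (1 - t)^-1.
Proof.
move=> t01; have /andP[t0 t1] := t01; have [ab|ba] := leqP a b; last first.
  by rewrite big_geq; [rewrite invr_ge0 subr_ge0 ltW|exact: ltnW].
rewrite big_nat_rev /=; apply: le_trans (geometric_sum_le a b t01).
rewrite big_nat [X in _ <= X]big_nat; apply: ler_sum => j /andP[aj jb].
have -> : (b - (a + b - j.+1) = (j - a).+1)%N by clear -aj jb; lia.
by rewrite exprS ler_piMl ?exprn_ge0 // ltW.
Qed.

Lemma lt1_powR (R : realType) (t y : R) : 0 < t -> t < 1 -> 0 < y -> t `^ y < 1.
Proof.
move=> t0 t1 y0; have := @gt0_ltr_powR R y y0 t 1; rewrite powR1 !nnegrE; apply => //.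
exact: ltW.
Qed.

Lemma powR_exprn_swap (R : realType) (p s : R) n : 0 <= p -> (p `^ s) ^+ n = (p ^+ n) `^ s.
Proof.
move=> p0; rewrite -(powR_mulrn n (powR_ge0 p s)) -(powR_mulrn n p0) -(powRrM p s) -(powRrM p n%:R).
by congr (_ `^ _); rewrite mulrC.
Qed.

(** A substitute for Minkowski's inequality: the largest of the [p ^ - e_j a_j]
    dominates the whole sum up to a constant. *)
Lemma pow_sum_le (R : realType) (s p S : R) (r : seq nat) (e : nat -> nat) (a : nat -> R) :
  0 < s -> 0 < p -> 0 <= S -> (forall j, 0 <= a j) -> \sum_(j <- r) p ^+ e j <= S ->
  (\sum_(j <- r) a j) `^ s <= S `^ s * \sum_(j <- r) (p `^ (- s)) ^+ e j * a j `^ s.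
Proof.
move=> s0 p0 S0 a0 HS; set Q := \sum_(j <- r) _ * _.
have term0 j : 0 <= (p `^ (- s)) ^+ e j * a j `^ s by rewrite mulr_ge0 ?exprn_ge0 ?powR_ge0.
have Q0 : 0 <= Q by apply: sumr_ge0.
have step j : j \in r -> a j <= p ^+ e j * Q `^ s^-1.
  move=> jr; have h : (p `^ (- s)) ^+ e j * a j `^ s <= Q.
    by rewrite /Q (big_rem j) //= lerDl sumr_ge0.
  have pe : 0 < p ^+ e j by rewrite exprn_gt0.
  have E := powR_exprn_swap (- s) (e j) (ltW p0).
  have h2 : a j `^ s <= (p ^+ e j * Q `^ s^-1) `^ s.
    rewrite powRM ?powR_ge0 ?(ltW pe) // -powRrM mulVf ?gt_eqF // powRr1 //.
    by move: h; rewrite E powRN ler_pdivrMl ?powR_gt0.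
  rewrite leNgt; apply/negP => lt; move: h2; rewrite leNgt => /negP; apply.
  by apply: gt0_ltr_powR => //; rewrite nnegrE // mulr_ge0 ?powR_ge0 // ltW.
have : \sum_(j <- r) a j <= S * Q `^ s^-1.
  apply: (@le_trans _ _ (\sum_(j <- r) p ^+ e j * Q `^ s^-1)).
    by rewrite big_seq [X in _ <= X]big_seq; apply: ler_sum.
  by rewrite -mulr_suml ler_wpM2r // powR_ge0.
move=> h; apply: le_trans (le_powR2 (ltW s0) _ h) _; first exact: sumr_ge0.
by rewrite powRM ?powR_ge0 // -powRrM mulVf ?gt_eqF // powRr1.
Qed.

(** If the [s]th moments are bounded by a geometric progression, the [s]th moment of the sum is
    bounded by its leading term, up to a constant; the choice [p = t ^ (1 / (2 s))] spends half
    of the decay on [pow_sum_le]. *)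
Lemma mean_pow_sum_le (R : realType) (s t A : R) (r : seq nat) (e : nat -> nat) (a : nat -> R -> R) :
  0 < s -> 0 < t < 1 -> 0 <= A -> (forall j x, 0 <= a j x) -> (forall j, bmeas (a j)) ->
  (forall u : R, 0 <= u < 1 -> \sum_(j <- r) u ^+ e j <= (1 - u)^-1) ->
  (forall j, j \in r -> mean (fun x => a j x `^ s) <= A * t ^+ e j) ->
  mean (fun x => (\sum_(j <- r) a j x) `^ s) <=
  ((1 - t `^ (2 * s)^-1)^-1) `^ s * (1 - t `^ 2^-1)^-1 * A.
Proof.
move=> s0 /andP[t0 t1] A0 a0 ba Hr HA.
have lt1 y : 0 < y -> 0 <= t `^ y < 1.
  by move=> y0; rewrite powR_ge0 lt1_powR.
set p := t `^ (2 * s)^-1.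
have /lt1 p01 : 0 < (2 * s)^-1 by rewrite invr_gt0 mulr_gt0.
have p0 : 0 < p by apply: powR_gt0.
have bas j : bmeas (fun x => a j x `^ s) by apply: bmeas_powR => //; exact: ltW.
set S := (1 - p)^-1.
have S0 : 0 <= S by rewrite invr_ge0 subr_ge0; case/andP: p01 => _ /ltW.
have E : p `^ (- s) * t = t `^ 2^-1.
  rewrite /p -powRrM -{2}(powRr1 (ltW t0)) -powRD ?(gt_eqF t0) ?implybT //.
  by congr (_ `^ _); field; rewrite gt_eqF.
apply: (@le_trans _ _ (mean (fun x => S `^ s * \sum_(j <- r) (p `^ (- s)) ^+ e j * a j x `^ s))).
  apply: mean_le.
  - apply: bmeas_powR; [exact: ltW|by move=> x; apply: sumr_ge0|exact: bmeas_sum].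
  - by apply: bmeasM; [exact: bmeas_cst|apply: bmeas_sum => j; apply: bmeasM => //; exact: bmeas_cst].
  by move=> x _; apply: pow_sum_le => //; exact: Hr.
have bt j : bmeas (fun x => (p `^ (- s)) ^+ e j * a j x `^ s) by apply: bmeasM => //; exact: bmeas_cst.
rewrite meanZ; last exact: bmeas_sum.
rewrite mean_sum // -[X in _ <= X]mulrA ler_wpM2l ?powR_ge0 //.
apply: (@le_trans _ _ (\sum_(j <- r) A * (t `^ 2^-1) ^+ e j)).
  rewrite big_seq [X in _ <= X]big_seq; apply: ler_sum => j jr.
  rewrite meanZ // -E exprMn mulrCA ler_wpM2l ?exprn_ge0 ?powR_ge0 //; exact: HA.
rewrite -mulr_sumr mulrC ler_wpM2r //; apply: Hr; apply: lt1; by rewrite invr_gt0.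
Qed.

(** * Interpolation and choice of scales *)

(** The pointwise inequalities that follow replace Hoelder's inequality: [l] is the height at
    which the two terms on the right balance, and it is chosen according to the moments that
    are known. *)
Lemma powR_interp12 (R : realType) (a l s : R) : 0 <= a -> 0 < l -> 1 <= s <= 2 ->
  a `^ s <= l `^ (s - 1) * a + l `^ (s - 2) * a ^+ 2.
Proof.
move=> a0 l0 /andP[s1 s2]; have s0 : 0 < s by lra.
have [a_l|l_a] := leP a l.
  have : a `^ s <= l `^ (s - 1) * a.
    rewrite -(mulr_powRB1 a0 s0) mulrC ler_wpM2r //; apply: le_powR2 => //; lra.
  move/le_trans; apply; rewrite lerDl mulr_ge0 ?powR_ge0 ?sqr_ge0 //.
have a0' : 0 < a by apply: lt_trans l_a.
have -> : a `^ s = a `^ (s - 2) * a ^+ 2.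
  rewrite -powR_mulrn // -powRD ?subrK // (gt_eqF a0') implybT //.
have : a `^ (s - 2) * a ^+ 2 <= l `^ (s - 2) * a ^+ 2.
  rewrite ler_wpM2r ?sqr_ge0 // -[s - 2]opprB !powRN lef_pV2 ?posrE ?powR_gt0 //.
  by apply: le_powR2; [lra|exact: ltW|exact: ltW].
by move/le_trans; apply; rewrite lerDr mulr_ge0 ?powR_ge0.
Qed.

Lemma powR_interp02 (R : realType) (a l s : R) : 0 <= a -> 0 < l -> 0 <= s <= 2 ->
  a `^ s <= l `^ s + l `^ (s - 2) * a ^+ 2.
Proof.
move=> a0 l0 /andP[s0 s2].
have [a_l|l_a] := leP a l.
  by apply: (@le_trans _ _ (l `^ s)); [exact: le_powR2|rewrite lerDl mulr_ge0 ?powR_ge0 ?sqr_ge0].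
have a0' : 0 < a by apply: lt_trans l_a.
have -> : a `^ s = a `^ (s - 2) * a ^+ 2.
  by rewrite -powR_mulrn // -powRD ?subrK // (gt_eqF a0') implybT.
have : a `^ (s - 2) * a ^+ 2 <= l `^ (s - 2) * a ^+ 2.
  rewrite ler_wpM2r ?sqr_ge0 // -[s - 2]opprB !powRN lef_pV2 ?posrE ?powR_gt0 //.
  by apply: le_powR2; [lra|exact: ltW|exact: ltW].
by move/le_trans; apply; rewrite lerDr powR_ge0.
Qed.

Lemma powR_interp01 (R : realType) (a l s : R) : 0 <= a -> 0 < l -> 0 <= s <= 1 ->
  a `^ s <= l `^ s + l `^ (s - 1) * a.
Proof.
move=> a0 l0 /andP[s0 s2].
have [a_l|l_a] := leP a l.
  by apply: (@le_trans _ _ (l `^ s)); [exact: le_powR2|rewrite lerDl mulr_ge0 ?powR_ge0].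
have a0' : 0 < a by apply: lt_trans l_a.
have -> : a `^ s = a `^ (s - 1) * a.
  by rewrite -{3}(powRr1 a0) -powRD ?subrK // (gt_eqF a0') implybT.
have : a `^ (s - 1) * a <= l `^ (s - 1) * a.
  rewrite ler_wpM2r // -[s - 1]opprB !powRN lef_pV2 ?posrE ?powR_gt0 //.
  by apply: le_powR2; [lra|exact: ltW|exact: ltW].
by move/le_trans; apply; rewrite lerDr powR_ge0.
Qed.

Lemma powR_add_le (R : realType) (a b s : R) : 0 <= a -> 0 <= b -> 0 <= s ->
  (a + b) `^ s <= 2 `^ s * (a `^ s + b `^ s).
Proof.
move=> a0 b0 s0; wlog ab : a b a0 b0 / a <= b.
  move=> H; case/orP: (le_total a b) => h; first exact: H.
  by rewrite addrC [a `^ s + _]addrC; exact: H.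
apply: (@le_trans _ _ ((2 * b) `^ s)).
  by apply: le_powR2 => //; [rewrite addr_ge0|lra].
by rewrite powRM // ler_wpM2l ?powR_ge0 // lerDr powR_ge0.
Qed.

(** The first scale exceeding [K], where all layers are empty. *)
Definition topscale (R : realType) (K : R) : nat := (trunc_log 2 (Num.truncn K)).+1.

(** A cut-off for the frequencies beyond the supports of all smoothed intervals in use. *)
Definition cutoff (R : realType) (N K : R) : nat := ((Num.truncn N).+1 + 2 ^ topscale K)%N.

Lemma topscaleP (R : realType) (K : R) : 1 <= K -> K < (2 ^ topscale K)%:R <= 2 * K.
Proof.
move=> K1; have t0 : (0 < Num.truncn K)%N by rewrite truncn_gt0.
have /andP[h1 h2] := @trunc_log_bounds 2 _ isT t0.
apply/andP; split.
  by apply: lt_le_trans (truncnS_gt K) _; rewrite ler_nat.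
rewrite /topscale expnS natrM ler_pM2l //; apply: (@le_trans _ _ (Num.truncn K)%:R).
  by rewrite ler_nat.
by rewrite truncn_le (le_trans _ K1).
Qed.

Lemma bottomscale (R : realType) (D : R) : 1 <= D -> exists j, (2 ^ j)%:R <= D < 2 * (2 ^ j)%:R.
Proof.
move=> D1; have /andP[] := topscaleP D1; rewrite /topscale expnS natrM ler_pM2l // => h1 h2.
by exists (trunc_log 2 (Num.truncn D)); rewrite h1 h2.
Qed.

(** The largest real [d] with [2 ^ j d ^ k <= K]. *)
Definition yscale (R : realType) (K : R) (k j : nat) : R := (K / (2 ^ j)%:R) `^ k%:R^-1.

Lemma layer_sum_scale (R : realType) (N K : R) k Z j : (2 <= k)%N -> 1 <= K -> K <= N ->
  (j < topscale K)%N -> Z%:R <= 2 * (2 ^ j)%:R :> R ->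
  exists Y : nat, [/\ Y%:R <= Z%:R :> R, Y%:R <= yscale K k j,
    mean (fun x => nc (layer_sum N K k Z (cutoff N K) j x)) <= 2 * Y%:R &
    mean (fun x => nc (layer_sum N K k Z (cutoff N K) j x) ^+ 2) <= 36 * (2 ^ j)%:R * Y%:R].
Proof.
move=> k2 K1 KN jJ Zj.
have k0 : (0 < k)%N by apply: leq_trans k2.
have h0 : 0 < (2 ^ j)%:R :> R by rewrite ltr0n expn_gt0.
have K0 : 0 <= K by apply: le_trans K1.
have q0 : 0 <= K / (2 ^ j)%:R by rewrite divr_ge0 // ltW.
exists (minn Z (Num.truncn (yscale K k j))).
set Y := minn _ _.
have YZ : (Y <= Z)%N by rewrite geq_minl.
have HY d : (0 < d <= Z)%N -> (2 ^ j * d ^ k)%:R <= K -> (d <= Y)%N.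
  move=> /andP[d0 dZ] dK; rewrite leq_min dZ /= truncn_ge_nat ?powR_ge0 //.
  rewrite leNgt; apply/negP => lt.
  have := lt_root_exp d q0 k0; rewrite lt => /idP; rewrite ltNge => /negP; apply.
  by rewrite ler_pdivlMr // -natrX -natrM mulnC.
have KN' : 0 <= K <= N by rewrite K0.
have hB : ((Num.truncn N).+1 + 2 ^ j.+1 <= cutoff N K)%N by rewrite /cutoff leq_add2l leq_exp2l.
have [b1 b2] := layer_sum_bounds k2 KN' YZ HY hB.
split => //; first by rewrite ler_nat.
  apply: (@le_trans _ _ (Num.truncn (yscale K k j))%:R); last by rewrite truncn_le powR_ge0.
  by rewrite ler_nat geq_minr.
apply: le_trans b2 _.
have YZ' : Y%:R <= Z%:R :> R by rewrite ler_nat.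
have Y0 : 0 <= Y%:R :> R by [].
have : Y%:R ^+ 2 <= 2 * (2 ^ j)%:R * Y%:R :> R by rewrite expr2 ler_wpM2r // (le_trans YZ').
lra.
Qed.

Lemma bmeas_layer_sum (R : realType) (N K : R) k Z B j : bmeas (fun x => nc (layer_sum N K k Z B j x)).
Proof. by apply: cbmeas_norm; exact: cbmeas_combo. Qed.

Lemma bmeas_end_sum (R : realType) (N K : R) k Z B j : bmeas (fun x => nc (end_sum N K k Z B j x)).
Proof. by apply: cbmeas_norm; exact: cbmeas_combo. Qed.

Lemma bmeas_main_sum (R : realType) (N K : R) k Z B : bmeas (fun x => nc (main_sum N K k Z B x)).
Proof. by apply: cbmeas_norm; exact: cbmeas_combo. Qed.

(** With [D = K ^ (1 / (k + 1))] the ends of the windows are treated in mean square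
    at the scale [2 ^ j0] of size about [D]. *)
Lemma main_sum_split (R : realType) (N K D : R) k Z : (2 <= k)%N -> 1 <= K -> K <= N ->
  D = K `^ (k%:R + 1)^-1 -> Z%:R <= D ->
  exists j0, [/\ (j0 <= topscale K)%N, (2 ^ j0)%:R <= D < 2 * (2 ^ j0)%:R,
    (forall x, nc (main_sum N K k Z (cutoff N K) x) <= nc (end_sum N K k Z (cutoff N K) j0 x) +
       \sum_(j0 <= j < topscale K) nc (layer_sum N K k Z (cutoff N K) j x)) &
    mean (fun x => nc (end_sum N K k Z (cutoff N K) j0 x) ^+ 2) <= 34 * D * Z%:R].
Proof.
move=> k2 K1 KN DE ZD; have k0 : (0 < k)%N by apply: leq_trans k2.
have K0 : 0 <= K by apply: le_trans K1.
have D1 : 1 <= D.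
  have := le_powR2 (_ : 0 <= (k%:R + 1)^-1) ler01 K1; rewrite powR1 DE; apply.
  by rewrite invr_ge0 addr_ge0.
have Dk : D ^+ k.+1 = K by rewrite DE natr1 powR_root_exp.
have [j0 /andP[h1 h2]] := bottomscale D1; exists j0.
have /andP[t1 t2] := topscaleP K1.
have DK : D <= K by rewrite -Dk exprS ler_peMr ?exprn_ege1 // (le_trans _ D1).
have jJ : (j0 <= topscale K)%N.
  rewrite -(@leq_exp2l 2) // -(ler_nat R) (le_trans h1) // (le_trans DK) // ltW //.
split => //; first by rewrite h1 h2.
  move=> x; rewrite (main_sum_layers _ _ _ _ _ jJ t1); apply: le_trans (normcD_le _ _) _.
  by rewrite lerD2l normc_sum_le.
have Z0 : 0 <= Z%:R :> R by [].
apply: le_trans (end_sum_L2 k2 _ _ _) _; first by rewrite K0.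
- by rewrite natrM [(Z ^ k)%:R]natrX -Dk exprS; apply: ler_pM => //; apply: le_exprn2.
- by rewrite /cutoff leq_add2l leq_exp2l.
have : Z%:R ^+ 2 <= D * Z%:R by rewrite expr2 ler_wpM2r.
have : (2 ^ j0)%:R * Z%:R <= D * Z%:R by rewrite ler_wpM2r.
lra.
Qed.

(** * Moments of the main part *)

Lemma invr_powR (R : realType) (x y : R) : 0 <= x -> x^-1 `^ y = x `^ (- y).
Proof. by move=> x0; rewrite -(powR_inv1 x0) -powRrM mulN1r. Qed.

(** The Cauchy-Schwarz inequality in the form in which [t] is the expected size of [f]. *)
Lemma mean_abs_le_sq (R : realType) (f : R -> R) (t : R) : bmeas f -> 0 < t ->
  mean f <= (t + t^-1 * mean (fun x => f x ^+ 2)) / 2.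
Proof.
move=> bf t0; have b2 := bmeas_sq bf.
apply: (@le_trans _ _ (mean (fun x => t / 2 + (t^-1 / 2) * f x ^+ 2))).
  apply: mean_le => //; first by apply: bmeasD; [exact: bmeas_cst|apply: bmeasM => //; exact: bmeas_cst].
  move=> x _; have : 0 <= t^-1 * (f x - t) ^+ 2 by rewrite mulr_ge0 ?invr_ge0 ?sqr_ge0 // ltW.
  rewrite sqrrB !mulrDr (_ : t^-1 * t ^+ 2 = t); last by rewrite expr2 mulrA mulVf ?mul1r ?gt_eqF.
  rewrite (_ : t^-1 * - (f x * t *+ 2) = - (2 * f x)); last by rewrite -mulr_natr; field; rewrite gt_eqF.
  lra.
rewrite meanD; [|exact: bmeas_cst|by apply: bmeasM => //; exact: bmeas_cst].
by rewrite mean_cst meanZ //; lra.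
Qed.

Lemma powR_exp_root (R : realType) (x : R) k : 0 <= x -> (0 < k)%N -> (x ^+ k) `^ k%:R^-1 = x.
Proof. by move=> x0 k0; rewrite -powR_mulrn // -powRrM mulfV ?powRr1 // pnatr_eq0 -lt0n. Qed.

Lemma yscale_le (R : realType) (K D : R) k j0 j : (2 <= k)%N -> 1 <= D -> D ^+ k.+1 = K ->
  D < 2 * (2 ^ j0)%:R -> (j0 <= j)%N ->
  yscale K k j <= 2 * D * (2^-1 `^ k%:R^-1) ^+ (j - j0).
Proof.
move=> k2 D1 DK D2 jj; have k0 : (0 < k)%N by apply: leq_trans k2.
have D0 : 0 < D by apply: lt_le_trans D1.
have r0 : 0 <= (2^-1 : R) `^ k%:R^-1 by exact: powR_ge0.
set r := _ `^ _ in r0 *.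
have rk : r ^+ k = 2^-1 by rewrite powR_root_exp.
have b0 : 0 <= 2 * D * r ^+ (j - j0) by rewrite !mulr_ge0 ?exprn_ge0 // ltW.
have -> : 2 * D * r ^+ (j - j0) = ((2 * D * r ^+ (j - j0)) ^+ k) `^ k%:R^-1.
  by rewrite powR_exp_root.
have h0 i : 0 < (2 ^ i)%:R :> R by rewrite ltr0n expn_gt0.
apply: le_powR2; first by rewrite invr_ge0.
  by rewrite divr_ge0 // -DK exprn_ge0 // ltW.
rewrite ler_pdivrMr // -DK !exprMn -exprM mulnC exprM rk exprS.
have E : (2 ^ j)%:R = (2 ^ j0)%:R * 2 ^+ (j - j0) :> R by rewrite -natrX -natrM -expnD subnKC.
have -> : 2 ^+ k * D ^+ k * 2^-1 ^+ (j - j0) * (2 ^ j)%:R = D ^+ k * (2 ^+ k * (2 ^ j0)%:R).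
  by rewrite E exprVn; field; rewrite expf_neq0.
rewrite mulrC ler_pM2l ?exprn_gt0 //; apply: le_trans (ltW D2) _.
rewrite ler_wpM2r //.
by rewrite -[X in X <= _]expr1 ler_weXn2l // ler1n.
Qed.

Lemma root_scale (R : realType) (K : R) k : 1 <= K ->
  1 <= K `^ (k%:R + 1)^-1 /\ (K `^ (k%:R + 1)^-1) ^+ k.+1 = K.
Proof.
move=> K1; split; last by rewrite natr1 powR_root_exp // (le_trans _ K1).
have := le_powR2 (_ : 0 <= (k%:R + 1)^-1) ler01 K1; rewrite powR1; apply.
by rewrite invr_ge0 addr_ge0.
Qed.

(** The layers have first moments of order at most [min (Z, yscale K k j)], and [yscale]
    decays geometrically from [D] on; the ends of the window contribute [sqrt (Z D)] by the
    Cauchy-Schwarz inequality. *)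
Lemma mean_main_sum (R : realType) k : (2 <= k)%N -> exists2 C : R, 0 < C &
  forall (N K D : R) Z, 1 <= K -> K <= N -> D = K `^ (k%:R + 1)^-1 -> (0 < Z)%N -> Z%:R <= D ->
  mean (fun x => nc (main_sum N K k Z (cutoff N K) x)) <= C * Num.sqrt (Z%:R * D).
Proof.
move=> k2; have k0 : (0 < k)%N by apply: leq_trans k2.
have kr0 : 0 < k%:R :> R by rewrite ltr0n.
pose r : R := 2^-1 `^ (2 * k%:R)^-1.
have r1 : r < 1 by apply: lt1_powR; rewrite ?invr_gt0 ?mulr_gt0 //; lra.
have r0 : 0 <= r by exact: powR_ge0.
have r2 : 2^-1 `^ k%:R^-1 = r ^+ 2.
  by rewrite /r -powR_mulrn ?powR_ge0 // -powRrM; congr (_ `^ _); field; rewrite gt_eqF.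
have r1' : 0 < 1 - r by lra.
exists (18 + 4 * (1 - r)^-1); first by rewrite ltr_wpDr // mulr_ge0 // invr_ge0 ltW.
move=> N K D Z K1 KN DE Z0 ZD.
have [j0 [jJ /andP[h1 h2] HV HE]] := main_sum_split k2 K1 KN DE ZD.
have [D1 DK] := @root_scale R K k K1; rewrite -DE in D1 DK.
have D0 : 0 < D by apply: lt_le_trans D1.
have Z0' : 0 < Z%:R :> R by rewrite ltr0n.
set t := Num.sqrt _.
have t0 : 0 < t by rewrite sqrtr_gt0 mulr_gt0.
have tt : t ^+ 2 = Z%:R * D by rewrite sqr_sqrtr // ltW // mulr_gt0.
apply: (@le_trans _ _ (mean (fun x => nc (end_sum N K k Z (cutoff N K) j0 x) +
       \sum_(j0 <= j < topscale K) nc (layer_sum N K k Z (cutoff N K) j x)))).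
  apply: mean_le => //; first exact: bmeas_main_sum.
  by apply: bmeasD; [exact: bmeas_end_sum|apply: bmeas_sum => j; exact: bmeas_layer_sum].
rewrite meanD; [|exact: bmeas_end_sum|by apply: bmeas_sum => j; exact: bmeas_layer_sum].
rewrite mean_sum; last by move=> j; exact: bmeas_layer_sum.
rewrite mulrDl; apply: lerD.
  apply: le_trans (mean_abs_le_sq (bmeas_end_sum _ _ _ _ _ _) t0) _.
  have h : t^-1 * mean (fun x : R => nc (end_sum N K k Z (cutoff N K) j0 x) ^+ 2) <= 34 * t.
    rewrite ler_pdivrMl // mulrCA -expr2 tt; apply: le_trans HE _.
    by rewrite -mulrA [D * _]mulrC.
  lra.
apply: (@le_trans _ _ (\sum_(j0 <= j < topscale K) 4 * t * r ^+ (j - j0))); last first.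
  rewrite -mulr_sumr; have := geometric_sum_le j0 (topscale K) (_ : 0 <= r < 1); rewrite r0 r1 => /(_ isT) h.
  rewrite [X in _ <= X]mulrAC; apply: ler_wpM2l => //; rewrite mulr_ge0 // ltW //.
rewrite big_nat [X in _ <= X]big_nat; apply: ler_sum => j /andP[jl ju].
have Zj : Z%:R <= 2 * (2 ^ j)%:R :> R.
  apply: (le_trans ZD); apply: le_trans (ltW h2) _.
  by rewrite ler_pM2l // ler_nat leq_exp2l.
have [Y [YZ Yy b1 _]] := layer_sum_scale k2 K1 KN ju Zj.
apply: (le_trans b1).
have : Y%:R <= 2 * t * r ^+ (j - j0).
  have p0 : 0 <= 2 * t * r ^+ (j - j0) by rewrite !mulr_ge0 ?exprn_ge0 // ltW.
  rewrite -(@ler_pXn2r _ 2) ?nnegrE // expr2.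
  apply: (@le_trans _ _ (Z%:R * (2 * D * (r ^+ 2) ^+ (j - j0)))).
    apply: ler_pM => //; apply: (le_trans Yy); rewrite -r2; exact: yscale_le.
  have -> : (2 * t * r ^+ (j - j0)) ^+ 2 = 4 * (Z%:R * D) * (r ^+ (j - j0)) ^+ 2 by rewrite -tt; ring.
  have -> : (r ^+ 2) ^+ (j - j0) = (r ^+ (j - j0)) ^+ 2 by rewrite -!exprM mulnC.
  have : 0 <= Z%:R * D * (r ^+ (j - j0)) ^+ 2 by rewrite mulr_ge0 ?sqr_ge0 // ltW // mulr_gt0.
  lra.
lra.
Qed.

Lemma moment_order_ge_D (R : realType) (K s : R) k : (2 <= k)%N -> 1 <= K -> 0 < s ->
  K `^ (s / (k%:R + 1)) <= moment_order k s K.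
Proof.
move=> k2 K1 s0; rewrite /moment_order; case: ltP => // h.
have k0 : 0 < k%:R :> R by rewrite ltr0n (leq_trans _ k2).
apply: ler_powR => //; rewrite ler_pdivrMr; last by lra.
have : k%:R + 1 <= s * k%:R.
  by have := ler_wpM2r (ltW k0) h; rewrite mulrDl mulVf ?gt_eqF // mul1r.
lra.
Qed.

(** Interpolation between the first moment [2 Y] and the mean square [36 2 ^ j Y] of a layer,
    with [Y] at most [yscale K k j], gives [K ^ (1 / k) 2 ^ (j (s - 1 - 1 / k))].  The exponent
    of [2] is [- be j] or [be j], so that the bottom or the top layer dominates. *)
Lemma moment_main_sum (R : realType) k (s : R) : (2 <= k)%N -> 1 <= s -> s < 2 -> s != 1 + k%:R^-1 ->
  exists2 C : R, 0 < C &
  forall (N K D : R) Z, 1 <= K -> K <= N -> D = K `^ (k%:R + 1)^-1 -> (0 < Z)%N -> Z%:R <= D ->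
  mean (fun x => nc (main_sum N K k Z (cutoff N K) x) `^ s) <= C * moment_order k s K.
Proof.
move=> k2 s1 s2 sk; have k0 : (0 < k)%N by apply: leq_trans k2.
have kr0 : 0 < k%:R :> R by rewrite ltr0n.
have s0 : 0 < s by lra.
pose be : R := `|1 + k%:R^-1 - s|.
have be0 : 0 < be by rewrite normr_gt0 subr_eq0 eq_sym.
pose t : R := 2^-1 `^ be.
have t0 : 0 < t by apply: powR_gt0; rewrite invr_gt0.
have t1 : t < 1 by apply: lt1_powR => //; lra.
pose C1 := ((1 - t `^ (2 * s)^-1)^-1) `^ s * (1 - t `^ 2^-1)^-1.
have C10 : 0 <= C1 by rewrite mulr_ge0 ?powR_ge0 // invr_ge0 subr_ge0 ltW // lt1_powR.
pose C2 : R := 38 * 2 `^ be.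
have C20 : 0 <= C2 by rewrite mulr_ge0 ?powR_ge0.
exists (2 `^ s * (35 + C1 * C2)); first by rewrite mulr_gt0 ?powR_gt0 // ltr_wpDr // mulr_ge0.
move=> N K D Z K1 KN DE Z0 ZD.
have [j0 [jJ /andP[h1 h2] HV HE]] := main_sum_split k2 K1 KN DE ZD.
have [D1 DK] := @root_scale R K k K1; rewrite -DE in D1 DK.
have D0 : 0 < D by apply: lt_le_trans D1.
have K0 : 0 < K by apply: lt_le_trans K1.
set M := moment_order k s K.
have DM : D `^ s <= M.
  by apply: le_trans (moment_order_ge_D k2 K1 s0); rewrite DE -powRrM mulrC.
have M0 : 0 <= M by apply: le_trans DM; exact: powR_ge0.
have bE := bmeas_end_sum N K k Z (cutoff N K) j0.
have bU j := bmeas_layer_sum N K k Z (cutoff N K) j.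
have bUs : bmeas (fun x => \sum_(j0 <= j < topscale K) nc (layer_sum N K k Z (cutoff N K) j x)) by apply: bmeas_sum.
have U0 x : 0 <= \sum_(j0 <= j < topscale K) nc (layer_sum N K k Z (cutoff N K) j x) by apply: sumr_ge0 => j _; exact: normc_ge0.
have bEs : bmeas (fun x => nc (end_sum N K k Z (cutoff N K) j0 x) `^ s) by apply: bmeas_powR => //; [exact: ltW|move=> x; exact: normc_ge0].
have bUss : bmeas (fun x => (\sum_(j0 <= j < topscale K) nc (layer_sum N K k Z (cutoff N K) j x)) `^ s) by apply: bmeas_powR => //; exact: ltW.
have pE : mean (fun x => nc (end_sum N K k Z (cutoff N K) j0 x) `^ s) <= 35 * M.
  apply: (@le_trans _ _ (mean (fun x => D `^ s + D `^ (s - 2) * nc (end_sum N K k Z (cutoff N K) j0 x) ^+ 2))).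
    apply: mean_le => //; first by apply: bmeasD; [exact: bmeas_cst|apply: bmeasM; [exact: bmeas_cst|exact: bmeas_sq]].
    move=> x _; apply: powR_interp02 => //; [exact: normc_ge0|lra].
  rewrite meanD; [|exact: bmeas_cst|by apply: bmeasM; [exact: bmeas_cst|exact: bmeas_sq]].
  rewrite mean_cst meanZ; last exact: bmeas_sq.
  apply: (@le_trans _ _ (D `^ s + D `^ (s - 2) * (34 * D ^+ 2))).
    rewrite lerD2l ler_wpM2l ?powR_ge0 //; apply: (le_trans HE).
    by rewrite expr2 mulrA ler_wpM2l // mulr_ge0 // ltW.
  have -> : D `^ (s - 2) * (34 * D ^+ 2) = 34 * D `^ s.
    by rewrite mulrCA -powR_mulrn ?(ltW D0) // -powRD ?subrK // (gt_eqF D0) implybT.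
  lra.
have pU : mean (fun x => (\sum_(j0 <= j < topscale K) nc (layer_sum N K k Z (cutoff N K) j x)) `^ s) <= C1 * (C2 * M).
  have term j : (j0 <= j < topscale K)%N ->
      mean (fun x => nc (layer_sum N K k Z (cutoff N K) j x) `^ s) <= 38 * K `^ k%:R^-1 * (2 ^ j)%:R `^ (s - 1 - k%:R^-1).
    move=> /andP[jl ju]; have hj : 0 < (2 ^ j)%:R :> R by rewrite ltr0n expn_gt0.
    have Zj : Z%:R <= 2 * (2 ^ j)%:R :> R.
      apply: (le_trans ZD); apply: le_trans (ltW h2) _.
      by rewrite ler_pM2l // ler_nat leq_exp2l.
    have [Y [YZ Yy b1 b2]] := layer_sum_scale k2 K1 KN ju Zj.
    set h := (2 ^ j)%:R in hj Zj b2 *.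
    apply: (@le_trans _ _ (mean (fun x => h `^ (s - 1) * nc (layer_sum N K k Z (cutoff N K) j x) + h `^ (s - 2) * nc (layer_sum N K k Z (cutoff N K) j x) ^+ 2))).
      apply: mean_le; first by apply: bmeas_powR => //; [exact: ltW|move=> x; exact: normc_ge0].
        by apply: bmeasD; apply: bmeasM => //; try exact: bmeas_cst; exact: bmeas_sq.
      move=> x _; apply: powR_interp12 => //; [exact: normc_ge0|lra].
    rewrite meanD; [|by apply: bmeasM => //; exact: bmeas_cst|by apply: bmeasM; [exact: bmeas_cst|exact: bmeas_sq]].
    rewrite meanZ // meanZ; last exact: bmeas_sq.
    apply: (@le_trans _ _ (h `^ (s - 1) * (2 * Y%:R) + h `^ (s - 2) * (36 * h * Y%:R))).
      by apply: lerD; rewrite ler_wpM2l ?powR_ge0.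
    have -> : h `^ (s - 2) * (36 * h * Y%:R) = 36 * (h `^ (s - 1) * Y%:R).
      have -> : h `^ (s - 1) = h `^ (s - 2) * h.
        by rewrite -{3}(powRr1 (ltW hj)) -powRD ?(gt_eqF hj) ?implybT //; congr (_ `^ _); ring.
      ring.
    have -> : 38 * K `^ k%:R^-1 * h `^ (s - 1 - k%:R^-1) = 38 * (h `^ (s - 1) * yscale K k j).
      rewrite /yscale powRM ?invr_ge0 ?(ltW hj) ?(ltW K0) // -/h invr_powR ?(ltW hj) //.
      by rewrite [h `^ (s - 1 - _)]powRD ?(gt_eqF hj) ?implybT //; ring.
    have : h `^ (s - 1) * Y%:R <= h `^ (s - 1) * yscale K k j by rewrite ler_wpM2l ?powR_ge0.
    lra.
  have fin (e : nat -> nat) : (forall u : R, 0 <= u < 1 -> \sum_(j0 <= j < topscale K) u ^+ e j <= (1 - u)^-1) ->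
     (forall j, (j0 <= j < topscale K)%N -> 38 * K `^ k%:R^-1 * (2 ^ j)%:R `^ (s - 1 - k%:R^-1) <= C2 * M * t ^+ e j) ->
     mean (fun x => (\sum_(j0 <= j < topscale K) nc (layer_sum N K k Z (cutoff N K) j x)) `^ s) <= C1 * (C2 * M).
    move=> He Hb; apply: (@mean_pow_sum_le R s t (C2 * M) _ e (fun j x => nc (layer_sum N K k Z (cutoff N K) j x))) => //.
    - by rewrite t0.
    - by rewrite mulr_ge0.
    - by move=> j x; exact: normc_ge0.
    by move=> j; rewrite mem_index_iota => hj; apply: le_trans (term j hj) (Hb j hj).
  have P2 i : (2 ^ i)%:R = 2 `^ i%:R :> R by rewrite powR_mulrn // natrX.
  have tX i : t ^+ i = 2 `^ (- be * i%:R) :> R.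
    rewrite -powR_mulrn ?powR_ge0 // /t -powRrM invr_powR //; congr (_ `^ _); ring.
  have P2D (u v : R) : 2 `^ (u + v) = 2 `^ u * 2 `^ v :> R by rewrite powRD // pnatr_eq0 implybT.
  have [lt|gt] := ltP s (1 + k%:R^-1).
    have beE : s - 1 - k%:R^-1 = - be by rewrite /be gtr0_norm ?subr_gt0 //; ring.
    apply: (fin (fun j => (j - j0)%N)) => [u|j /andP[jl _]]; first exact: geometric_sum_le.
    rewrite beE.
    have -> : (2 ^ j)%:R `^ (- be) = (2 ^ j0)%:R `^ (- be) * t ^+ (j - j0).
      rewrite tX !P2 -!powRrM -P2D natrB //; congr (_ `^ _); ring.
    rewrite mulrA ler_wpM2r ?exprn_ge0 ?(ltW t0) //.
    have hD : (2 ^ j0)%:R `^ (- be) <= 2 `^ be * D `^ (- be).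
      rewrite !powRN -ler_pdivrMl ?powR_gt0 // -invfM lef_pV2 ?posrE ?mulr_gt0 ?powR_gt0 ?ltr0n ?expn_gt0 //.
      rewrite -powRM //; apply: le_powR2; [exact: ltW|exact: ltW|exact: ltW].
    have ME : M = K `^ k%:R^-1 * D `^ (- be).
      rewrite /M /moment_order lt DE -powRrM -powRD ?(gt_eqF K0) ?implybT //; congr (_ `^ _).
      rewrite -beE; field; rewrite !gt_eqF //; lra.
    rewrite ME /C2.
    have -> : 38 * 2 `^ be * (K `^ k%:R^-1 * D `^ (- be)) = 38 * K `^ k%:R^-1 * (2 `^ be * D `^ (- be)) by ring.
    by rewrite ler_wpM2l // mulr_ge0 ?powR_ge0.
  have beE : s - 1 - k%:R^-1 = be.
    by rewrite /be ler0_norm ?subr_le0 //; ring.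
  apply: (fin (fun j => (topscale K - j)%N)) => [u|j /andP[_ ju]]; first exact: geometric_sum_rev_le.
  rewrite beE.
  have -> : (2 ^ j)%:R `^ be = (2 ^ topscale K)%:R `^ be * t ^+ (topscale K - j).
    rewrite tX !P2 -!powRrM -P2D natrB ?(ltnW ju) //; congr (_ `^ _); ring.
  rewrite mulrA ler_wpM2r ?exprn_ge0 ?(ltW t0) //.
  have /andP[_ tK] := topscaleP K1.
  have hD : (2 ^ topscale K)%:R `^ be <= 2 `^ be * K `^ be.
    by rewrite -powRM ?(ltW K0) //; apply: le_powR2 => //; exact: ltW.
  have ME : M = K `^ k%:R^-1 * K `^ be.
    rewrite /M /moment_order ltNge gt /= -powRD ?(gt_eqF K0) ?implybT //; congr (_ `^ _).
    by rewrite -beE; ring.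
  rewrite ME /C2.
  have -> : 38 * 2 `^ be * (K `^ k%:R^-1 * K `^ be) = 38 * K `^ k%:R^-1 * (2 `^ be * K `^ be) by ring.
  by rewrite ler_wpM2l // mulr_ge0 ?powR_ge0.
apply: (@le_trans _ _ (mean (fun x => 2 `^ s * (nc (end_sum N K k Z (cutoff N K) j0 x) `^ s +
   (\sum_(j0 <= j < topscale K) nc (layer_sum N K k Z (cutoff N K) j x)) `^ s)))).
  apply: mean_le.
  - by apply: bmeas_powR; [exact: ltW|move=> x; exact: normc_ge0|exact: bmeas_main_sum].
  - by apply: bmeasM; [exact: bmeas_cst|exact: bmeasD].
  move=> x _; apply: le_trans (powR_add_le _ _ (ltW s0)); rewrite ?normc_ge0 //.
  by apply: le_powR2; [exact: ltW|exact: normc_ge0|exact: HV].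
rewrite meanZ; last exact: bmeasD.
rewrite meanD // -mulrA ler_wpM2l ?powR_ge0 // mulrDl; apply: lerD => //.
by rewrite -mulrA.
Qed.

(** * Decomposition of the exponential sum *)

Lemma mu_moebius (R : realType) k n : (0 < k)%N -> (0 < n)%N ->
  mu R k n = \sum_(e <- divisors n) moebius R e * (e ^ k %| n)%N%:R.
Proof.
move=> k0 n0; rewrite sum_moebius_kpow // /mu indicE; congr (_%:R); congr (nat_of_bool _).
apply/idP/idP => [|H].
  move=> /set_mem H; apply/allP => e _; apply/implyP => ek; apply/negPn/negP => ne.
  have e0 : (0 < e)%N by case: (e) ek => //; rewrite exp0n // dvd0n => /eqP n0'; move: n0; rewrite n0'.
  have e1 : (1 < e)%N by rewrite ltn_neqAle eq_sym ne.
  move/negP: (H _ (pdiv_prime e1)); apply; by apply: dvdn_trans ek; rewrite dvdn_exp2r // pdiv_dvd.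
apply/mem_set => p pp; apply/negP => pk.
have pn : (p %| n)%N by apply: dvdn_trans pk; rewrite dvdn_exp.
move/allP: H => /(_ p); rewrite -dvdn_divisors // => /(_ pn); rewrite pk /= => /eqP p1.
by rewrite p1 in pp.
Qed.

Lemma mu_moebius_range (R : realType) k n M : (0 < k)%N -> (0 < n)%N -> (n <= M)%N ->
  mu R k n = \sum_(0 <= e < M.+1) moebius R e * (e ^ k %| n)%N%:R.
Proof.
move=> k0 n0 nM; rewrite (mu_moebius R k0 n0).
have -> : \sum_(e <- divisors n) moebius R e * (e ^ k %| n)%N%:R =
  \sum_(0 <= e < M.+1 | (e %| n)%N) moebius R e * (e ^ k %| n)%N%:R.
  rewrite -[RHS]big_filter; apply: perm_big; apply: uniq_perm; rewrite ?divisors_uniq ?filter_uniq ?iota_uniq // => e.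
  rewrite -dvdn_divisors // mem_filter mem_index_iota; case: (boolP (e %| n)%N) => //= en.
  by rewrite ltnS (leq_trans (dvdn_leq n0 en)).
rewrite big_mkcond; apply: eq_bigr => e _; case: ifP => // /negbT en.
case: (boolP (e ^ k %| n)%N) => [h|]; last by rewrite mulr0.
by case/negP: en; apply: dvdn_trans h; rewrite dvdn_exp.
Qed.

Definition win (R : realType) (N K : R) (n : nat) : bool := (N - K < n%:R) && (n%:R <= N).

Definition kfree_coef (R : realType) (N K : R) (k n : nat) : R := (win N K n)%:R * mu R k n.

Lemma expsumE (R : realType) (N K x : R) k B : 0 <= N -> ((Num.truncn N).+1 <= B)%N ->
  expsum k N K x = trigpoly B (kfree_coef N K k) x.
Proof.
move=> N0 hB; rewrite -(@trigpoly_widen _ _ _ _ _ hB); last first.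
  move=> n hn; rewrite /kfree_coef /win [n%:R <= N]leNgt (_ : N < n%:R) ?andbF ?mul0r //.
  by apply: lt_le_trans (truncnS_gt N) _; rewrite ler_nat.
rewrite /expsum big_mkcond /=; apply: eq_big_nat => n /andP[_ nN].
have le : n%:R <= N by rewrite -truncn_ge_nat.
rewrite /kfree_coef /win le andbT; case: ifP => _; rewrite ?mul1r // mul0r //.
by rewrite rmorph0 mul0r.
Qed.

Lemma lift_ind (R : realType) (N K : R) q n : 0 <= K <= N -> (0 < q)%N ->
  lift_coef q (interval_ind R (win_lo N K q) (win_hi N q)) n = (win N K n)%:R * (q %| n)%N%:R.
Proof.
move=> /andP[K0 KN] q0; rewrite /lift_coef; case: ifP => [/dvdnP[m ->]|_]; last by rewrite mulr0.
rewrite mulr1 mulnK // /interval_ind lo_le // lt_hi ?(le_trans K0) // /win mulnC //.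
Qed.

Definition main_coef (R : realType) (N K : R) (k Z n : nat) : R :=
  (win N K n)%:R * \sum_(0 <= d < Z.+1) moebius R d * (d ^ k %| n)%N%:R.

Lemma main_sumE (R : realType) (N K x : R) k Z B : 0 <= K <= N -> ((Num.truncn N).+1 <= B)%N ->
  main_sum N K k Z B x = trigpoly B (main_coef N K k Z) x.
Proof.
move=> KN hB; have /andP[K0 KN'] := KN; have N0 : 0 <= N by apply: le_trans KN'.
rewrite /main_coef.
have -> : trigpoly B (fun n => (win N K n)%:R * \sum_(0 <= d < Z.+1) moebius R d * (d ^ k %| n)%N%:R) x =
  trigpoly B (fun n => \sum_(0 <= d < Z.+1) moebius R d * ((win N K n)%:R * (d ^ k %| n)%N%:R)) x.
  by apply: eq_trigpoly => n _; rewrite big_distrr /=; apply: eq_bigr => d _; rewrite mulrCA.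
rewrite -trigpoly_sum; apply: eq_bigr => d _.
have [->|d0] := posnP d; first by rewrite moebius0 rmorph0 !mul0r.
have q0 : (0 < d ^ k)%N by rewrite expn_gt0 d0.
congr (_ * _); rewrite trigpoly_lift // [RHS](@trigpoly_widen _ _ (d ^ k * B)).
- by apply: eq_trigpoly => n _; rewrite lift_ind.
- by rewrite leq_pmull.
move=> n Bn; rewrite /win [n%:R <= N]leNgt (_ : N < n%:R) ?andbF ?mul0r //.
by apply: lt_le_trans (truncnS_gt N) _; rewrite ler_nat (leq_trans hB).
Qed.

Definition rem_coef (R : realType) (N K : R) (k Z n : nat) : R :=
  (win N K n)%:R * \sum_(0 <= d < (Num.truncn N).+1) (if (Z < d)%N then moebius R d else 0) * (d ^ k %| n)%N%:R.

Lemma kfree_sub_main_coef (R : realType) (N K : R) k Z n : (0 < k)%N -> 0 <= K <= N -> (Z <= Num.truncn N)%N ->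
  kfree_coef N K k n - main_coef N K k Z n = rem_coef N K k Z n.
Proof.
move=> k0 /andP[K0 KN] ZN; rewrite /kfree_coef /main_coef /rem_coef -mulrBr.
case: (boolP (win N K n)) => [/andP[w1 w2]|_]; last by rewrite !mul0r.
have n0 : (0 < n)%N by rewrite -(ltr0n R) (le_lt_trans _ w1) // subr_ge0.
have nM : (n <= Num.truncn N)%N by rewrite truncn_ge_nat // (le_trans K0).
congr (_ * _); rewrite (mu_moebius_range R k0 n0 nM).
rewrite (@big_cat_nat _ _ _ Z.+1) //= [RHS](@big_cat_nat _ _ _ Z.+1) //=.
rewrite [X in _ = X + _](_ : _ = 0) ?add0r; last first.
  by rewrite big_nat big1 // => d /andP[_ dZ]; rewrite ltnNge -ltnS dZ mul0r.
rewrite [X in X - _]addrC addrK; apply: eq_big_nat => d /andP[Zd _]; by rewrite Zd.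
Qed.

Lemma sum_inv_sq_tail (R : realFieldType) n M : (0 < n)%N ->
  \sum_(n <= t < M) (t%:R : R) ^- 2 <= 2 / n%:R.
Proof.
move=> n0; have n0' : 0 < n%:R :> R by rewrite ltr0n.
have H i : \sum_(n <= t < (n + i).+1) (t%:R : R) ^- 2 <= 2 / n%:R - (n + i)%:R^-1.
  elim: i => [|i IH].
    rewrite addn0 big_nat1 expr2 invfM.
    have : n%:R^-1 * n%:R^-1 <= n%:R^-1 :> R by rewrite ler_piMl ?invr_ge0 // invf_le1 // ler1n.
    lra.
  rewrite addnS big_nat_recr /=; last by rewrite -addnS leq_addr.
  apply: le_trans (lerD IH (lexx _)) _.
  rewrite -(natr1 (n + i)); set x : R := (n + i)%:R.
  have x0 : 0 < x by rewrite ltr0n addn_gt0 n0.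
  rewrite -subr_ge0.
  have -> : 2 / n%:R - (x + 1)^-1 - (2 / n%:R - x^-1 + (x + 1) ^- 2) = (x * (x + 1) ^+ 2)^-1.
    by field; rewrite !gt_eqF //; lra.
  by rewrite invr_ge0 mulr_ge0 ?exprn_ge0 //; lra.
have [Mn|nM] := leqP M n; first by rewrite big_geq // divr_ge0.
have := H (M - n.+1)%N; rewrite -addSn subnKC // => /le_trans; apply.
by rewrite lerBlDr lerDl invr_ge0.
Qed.

Lemma sum_inv_pow_tail (R : realFieldType) n M k : (0 < n)%N -> (2 <= k)%N ->
  \sum_(n <= t < M) (t%:R : R) ^- k <= 2 * (n%:R) ^- (k.-1).
Proof.
move=> n0; case: k => // -[//|k] _ /=; have n0' : 0 < n%:R :> R by rewrite ltr0n.
have -> : 2 * n%:R ^- k.+1 = n%:R ^- k * (2 / n%:R) :> R by rewrite exprSr invfM; ring.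
apply: (@le_trans _ _ (\sum_(n <= t < M) n%:R ^- k * (t%:R : R) ^- 2)).
  rewrite big_nat [X in _ <= X]big_nat; apply: ler_sum => t /andP[nt _].
  have t0 : 0 < t%:R :> R by rewrite ltr0n (leq_trans n0).
  rewrite -[k.+2]addn2 exprD invfM ler_wpM2r ?invr_ge0 ?exprn_ge0 ?(ltW t0) //.
  by rewrite lef_pV2 ?posrE ?exprn_gt0 // le_exprn2 ?ler_nat // ltW.
rewrite -mulr_sumr ler_wpM2l ?invr_ge0 ?exprn_ge0 ?(ltW n0') //.
exact: sum_inv_sq_tail.
Qed.

Lemma sum_sub_uniq (R : realFieldType) (s1 s2 : seq nat) (F : nat -> R) : uniq s1 -> uniq s2 ->
  {subset s1 <= s2} -> (forall x, 0 <= F x) -> \sum_(x <- s1) F x <= \sum_(x <- s2) F x.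
Proof.
move=> u1 u2 sub F0.
have -> : \sum_(x <- s1) F x = \sum_(x <- s2 | x \in s1) F x.
  rewrite -[RHS]big_filter; apply: perm_big; apply: uniq_perm => //; first by rewrite filter_uniq.
  by move=> x; rewrite mem_filter; case: (boolP (x \in s1)) => //= /sub ->.
by rewrite big_mkcond; apply: ler_sum => x _; case: ifP.
Qed.

Lemma sum_multiples_inv_pow (R : realFieldType) Z M v k : (0 < v)%N -> (2 <= k)%N ->
  \sum_(Z.+1 <= d < M.+1) (v %| d)%N%:R * (d%:R : R) ^- k <= v%:R ^- k * (2 * (Z %/ v).+1%:R ^- (k.-1)).
Proof.
move=> v0 k2; have v0' : 0 < v%:R :> R by rewrite ltr0n.
have vk : 0 <= v%:R ^- k :> R by rewrite invr_ge0 exprn_ge0 // ltW.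
apply: le_trans (ler_wpM2l vk (sum_inv_pow_tail R M.+1 (ltn0Sn (Z %/ v)) k2)).
rewrite mulr_sumr.
have -> : \sum_(Z.+1 <= d < M.+1) (v %| d)%N%:R * (d%:R : R) ^- k =
   \sum_(t <- [seq (d %/ v)%N | d <- index_iota Z.+1 M.+1 & (v %| d)%N]) v%:R ^- k * t%:R ^- k.
  rewrite big_map big_filter [RHS]big_mkcond; apply: eq_bigr => d _.
  case: (boolP (v %| d)%N) => vd; last by rewrite mul0r.
  by rewrite mul1r -{1}(divnK vd) natrM exprMn invfM mulrC.
apply: sum_sub_uniq.
- rewrite map_inj_in_uniq ?filter_uniq ?iota_uniq // => x y.
  by rewrite !mem_filter => /andP[vx _] /andP[vy _] E; rewrite -(divnK vx) -(divnK vy) E.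
- exact: iota_uniq.
- move=> t /mapP[d]; rewrite mem_filter mem_index_iota => /andP[vd /andP[Zd dM]] ->.
  rewrite mem_index_iota ltn_divLR // divnK // ltnS (leq_trans (leq_div _ _)) // andbT.
  by rewrite (leq_trans Zd).
- by move=> t; rewrite mulr_ge0 // invr_ge0 exprn_ge0.
Qed.

(** * Mean square of the remainder *)

(** The term [v = gcd(d, d')] on the right equals the left-hand side; the sum over all [v]
    separates [d] from [d']. *)
Lemma lcm_inv_le (R : realFieldType) k d d' M : (0 < d)%N -> (0 < d')%N -> (d <= M)%N ->
  ((lcmn d d')%:R : R) ^- k <=
  \sum_(1 <= v < M.+1) v%:R ^+ k * (((v %| d)%N%:R * d%:R ^- k) * ((v %| d')%N%:R * d'%:R ^- k)).
Proof.
move=> d0 d'0 dM; set g := gcdn d d'.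
have g0 : (0 < g)%N by rewrite gcdn_gt0 d0.
have gM : (g <= M)%N by apply: leq_trans dM; rewrite dvdn_leq // dvdn_gcdl.
rewrite (bigD1_seq g) ?iota_uniq ?mem_index_iota ?g0 //= dvdn_gcdl dvdn_gcdr !mul1r.
rewrite -[X in X <= _]addr0; apply: lerD; last first.
  by apply: sumr_ge0 => v _; rewrite !mulr_ge0 ?invr_ge0 ?exprn_ge0.
have E : (lcmn d d')%:R = d%:R * d'%:R / g%:R :> R.
  by apply/(canRL (mulfK _)); rewrite ?pnatr_eq0 -?lt0n // -!natrM muln_lcm_gcd.
rewrite le_eqVlt; apply/orP; left; apply/eqP.
by rewrite E !exprMn exprVn !invfM invrK; ring.
Qed.

(** After [lcm_inv_le] the divisors [v <= Z] and [v > Z] of the greatest common divisor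
    contribute [4 Z ^ (1 - k)] and [8 Z ^ (1 - k)]. *)
Lemma lcm_tail_sum (R : realFieldType) k Z M : (2 <= k)%N -> (0 < Z)%N ->
  \sum_(Z.+1 <= d < M.+1) \sum_(Z.+1 <= d' < M.+1) ((lcmn d d')%:R : R) ^- k <= 12 * Z%:R ^- (k.-1).
Proof.
move=> k2 Z0; have Zr : 0 < Z%:R :> R by rewrite ltr0n.
have Zk j : 0 < Z%:R ^- j :> R by rewrite invr_gt0 exprn_gt0.
have [MZ|ZM] := leqP M Z.
  by rewrite big_geq // mulr_ge0 // ltW.
pose T v : R := \sum_(Z.+1 <= d < M.+1) (v %| d)%N%:R * d%:R ^- k.
have T0 v : 0 <= T v by apply: sumr_ge0 => d _; rewrite mulr_ge0 // invr_ge0 exprn_ge0.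
apply: (@le_trans _ _ (\sum_(1 <= v < M.+1) v%:R ^+ k * (T v * T v))).
  have -> : \sum_(1 <= v < M.+1) v%:R ^+ k * (T v * T v) =
    \sum_(Z.+1 <= d < M.+1) \sum_(Z.+1 <= d' < M.+1) \sum_(1 <= v < M.+1)
      v%:R ^+ k * (((v %| d)%N%:R * (d%:R : R) ^- k) * ((v %| d')%N%:R * (d'%:R : R) ^- k)).
    under [RHS]eq_bigr do rewrite exchange_big /=.
    rewrite [RHS]exchange_big /=; apply: eq_bigr => v _.
    rewrite /T big_distrlr /= big_distrr /=; apply: eq_bigr => d _.
    by rewrite big_distrr.
  rewrite big_nat [X in _ <= X]big_nat; apply: ler_sum => d /andP[Zd dM].
  rewrite big_nat [X in _ <= X]big_nat; apply: ler_sum => d' /andP[Zd' dM'].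
  by apply: lcm_inv_le => //; apply: leq_trans (ltn0Sn Z) _.
have Tb v : (0 < v)%N -> v%:R ^+ k * (T v * T v) <= 4 * (v%:R ^- k * ((Z %/ v).+1%:R ^- (k.-1)) ^+ 2).
  move=> v0; have v0' : 0 < v%:R :> R by rewrite ltr0n.
  have := sum_multiples_inv_pow R Z M v0 k2; rewrite -/(T v) => h.
  have vk : 0 < v%:R ^+ k :> R by rewrite exprn_gt0.
  apply: (@le_trans _ _ (v%:R ^+ k * ((v%:R ^- k * (2 * (Z %/ v).+1%:R ^- (k.-1))) * (v%:R ^- k * (2 * (Z %/ v).+1%:R ^- (k.-1)))))).
    by rewrite ler_wpM2l ?(ltW vk) //; apply: ler_pM.
  rewrite le_eqVlt; apply/orP; left; apply/eqP.
  by field; rewrite !expf_neq0 // gt_eqF.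
rewrite (@big_cat_nat _ _ _ Z.+1) //=; last by rewrite ltnS ltnW.
have -> : 12 * Z%:R ^- k.-1 = 4 * Z%:R ^- k.-1 + 8 * Z%:R ^- k.-1 :> R by ring.
apply: lerD.
  apply: (@le_trans _ _ (\sum_(1 <= v < Z.+1) 4 * Z%:R ^- k)); last first.
    rewrite sumr_const_nat subn1 /= -[_ *+ Z]mulr_natr -mulrA ler_wpM2l //.
    by rewrite -{1}(prednK (ltnW k2)) exprS invfM mulrAC mulVf ?mul1r // gt_eqF.
  rewrite big_nat [X in _ <= X]big_nat; apply: ler_sum => v /andP[v0 vZ].
  have v0' : 0 < v%:R :> R by rewrite ltr0n.
  apply: le_trans (Tb v v0) _; rewrite ler_wpM2l //.
  have h1 : (Z %/ v).+1%:R ^- k.-1 <= (v%:R / Z%:R) ^+ k.-1 :> R.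
    rewrite -exprVn le_exprn2 ?invr_ge0 // -[X in _ <= X]invf_div lef_pV2 ?posrE ?divr_gt0 //.
    by rewrite ler_pdivrMr // -natrM ler_nat ltnW // ltn_ceil.
  apply: (@le_trans _ _ (v%:R ^- k * ((v%:R / Z%:R) ^+ k.-1) ^+ 2)).
    by rewrite ler_wpM2l ?invr_ge0 ?exprn_ge0 ?(ltW v0') // le_exprn2 // invr_ge0 exprn_ge0.
  have vZ' : v%:R <= Z%:R :> R by rewrite ler_nat.
  case: (k) k2 => // -[//|j] _ /=.
  have -> : v%:R ^- j.+2 * ((v%:R / Z%:R) ^+ j.+1) ^+ 2 = v%:R ^+ j * (Z%:R ^- j.+1 ^+ 2) :> R.
    by rewrite expr_div_n !exprS expr0; field; rewrite !expf_neq0 ?gt_eqF.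
  have -> : Z%:R ^- j.+2 = Z%:R ^+ j * (Z%:R ^- j.+1 ^+ 2) :> R.
    by rewrite !exprS expr0; field; rewrite !expf_neq0 ?gt_eqF.
  by rewrite ler_wpM2r ?exprn_ge0 ?(ltW (Zk _)) // le_exprn2.
apply: (@le_trans _ _ (\sum_(Z.+1 <= v < M.+1) 4 * v%:R ^- k)).
  rewrite big_nat [X in _ <= X]big_nat; apply: ler_sum => v /andP[v0 vZ].
  have v0' : (0 < v)%N by apply: leq_trans v0.
  apply: le_trans (Tb v v0') _; rewrite ler_wpM2l // -[X in _ <= X]mulr1 ler_wpM2l ?invr_ge0 ?exprn_ge0 //.
  by rewrite divn_small // expr1n invr1 expr1n.
rewrite -mulr_sumr (_ : 8 = 4 * 2); last by ring.
rewrite -mulrA ler_wpM2l //; apply: le_trans (sum_inv_pow_tail R _ (ltn0Sn Z) k2) _.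
by rewrite ler_wpM2l // lef_pV2 ?posrE ?exprn_gt0 // le_exprn2 // ler_nat.
Qed.

Lemma count_win_multiples (R : realType) (N K : R) q B : 0 <= K <= N -> (0 < q)%N ->
  (count (fun n => win N K n && (q %| n)%N) (iota 0 B))%:R <= K / q%:R + 1.
Proof.
move=> /andP[K0 KN] q0; apply: count_multiples => // [n /andP[] //|x y /andP[/andP[x1 x2] _] /andP[/andP[y1 y2] _] xy].
by rewrite natrB //; lra.
Qed.

Lemma hit_of_multiple (R : realType) (N K : R) k e n : 0 <= K <= N -> (0 < k)%N -> win N K n -> (e ^ k %| n)%N ->
  hit N K k e && (e <= Num.truncn N)%N.
Proof.
move=> /andP[K0 KN] k0 /andP[w1 w2] en.
have n0 : (0 < n)%N by rewrite -(ltr0n R) (le_lt_trans _ w1) // subr_ge0.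
have nM : (n <= Num.truncn N)%N by rewrite truncn_ge_nat // (le_trans K0).
have e0 : (0 < e)%N by case: (e) en => //; rewrite exp0n // dvd0n => /eqP n0'; move: n0; rewrite n0'.
apply/andP; split.
  rewrite /hit; apply: lt_le_trans w1 _; rewrite ler_nat -{1}(divnK en) mulnC leq_mul2l.
  by rewrite leq_div2r // orbT.
apply: leq_trans nM; apply: dvdn_leq => //; apply: dvdn_trans en.
by rewrite dvdn_exp.
Qed.

(** A window of length [K] contains at most one multiple of [e ^ k > K]. *)
Lemma count_tail_le1 (R : realType) (N K : R) k e B : 0 <= K <= N -> (0 < k)%N -> K < e%:R ^+ k ->
  (count (fun n => win N K n && (e ^ k %| n)%N) (iota 0 B))%:R <= (tail_hit N K k e && (e <= Num.truncn N)%N)%:R :> R.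
Proof.
move=> KN k0 Ke; have K0 : 0 <= K by case/andP: KN.
have ek : 0 < e%:R ^+ k :> R by apply: le_lt_trans Ke.
have q0 : (0 < e ^ k)%N by rewrite -(ltr0n R) natrX.
rewrite /tail_hit Ke /=; set c := count _ _.
have c2 : (c <= 1)%N.
  rewrite -ltnS -(ltr_nat R); apply: le_lt_trans (count_win_multiples B KN q0) _.
  by rewrite -[2]/(1 + 1 : R) ltrD2r ltr_pdivrMr ?ltr0n // mul1r natrX.
have [->|c0] := posnP c; first by [].
have : has (fun n => win N K n && (e ^ k %| n)%N) (iota 0 B) by rewrite has_count.
move=> /hasP[n _ /andP[wn en]]; rewrite (hit_of_multiple KN k0 wn en).
by rewrite ler_nat.
Qed.

Definition tail_sum (R : realType) (N K : R) k : R :=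
  \sum_(0 <= e < (Num.truncn N).+1 | tail_hit N K k e) (size (divisors e))%:R ^+ 2.

(** Pairs [d, d'] with [lcm(d, d') ^ k <= K] contribute the convergent main sum; the
    others are counted by the hits beyond [K ^ (1 / k)]. *)
Lemma rem_coef_L2 (R : realType) (N K : R) k Z B : (2 <= k)%N -> 1 <= K -> K <= N -> (0 < Z)%N ->
  \sum_(0 <= n < B) rem_coef N K k Z n ^+ 2 <= 24 * (K * Z%:R ^- (k.-1)) + tail_sum N K k.
Proof.
move=> k2 K1 KN Z0; have k0 : (0 < k)%N by apply: leq_trans k2.
have K0 : 0 <= K by apply: le_trans K1.
have KN' : 0 <= K <= N by rewrite K0.
set M := Num.truncn N.
pose chi d n := [&& (Z < d)%N, win N K n & (d ^ k %| n)%N].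
pose w d n : R := (chi d n)%:R.
have -> : \sum_(0 <= n < B) rem_coef N K k Z n ^+ 2 =
   \sum_(0 <= n < B) (\sum_(0 <= d < M.+1) moebius R d * w d n) ^+ 2.
  apply: eq_bigr => n _; congr (_ ^+ 2); rewrite /rem_coef big_distrr /=; apply: eq_bigr => d _.
  rewrite /w /chi; case: (Z < d)%N => /=; last by rewrite mul0r !mulr0.
  by rewrite mulrCA -natrM mulnb.
have hw d n : `|w d n| <= (chi d n)%:R by rewrite /w normr_nat.
apply: le_trans (combo_sq_sum_le M.+1 B (normr_moebius_le1 R) hw) _.
pose c d d' : R := (count (fun n => chi d n && chi d' n) (iota 0 B))%:R.
have c0 d d' : ~~ (Z < d)%N || ~~ (Z < d')%N -> c d d' = 0.
  move=> H; rewrite /c (@eq_count _ _ pred0) ?count_pred0 // => n; rewrite /chi /=.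
  by case/orP: H => /negbTE ->; rewrite //= andbF.
have cb d d' : (Z < d)%N -> (Z < d')%N -> c d d' <= 2 * K * (lcmn d d')%:R ^- k +
    \sum_(0 <= e < M.+1 | tail_hit N K k e) ((d %| e)%N%:R * (d' %| e)%N%:R).
  move=> Zd Zd'; set l := lcmn d d'.
  have l0 : (0 < l)%N by rewrite lcmn_gt0 (leq_trans _ Zd) // (leq_trans _ Zd').
  have lk0 : (0 < l ^ k)%N by rewrite expn_gt0 l0.
  have h : c d d' <= (count (fun n => win N K n && (l ^ k %| n)%N) (iota 0 B))%:R.
    rewrite /c ler_nat; apply: sub_count => n /andP[/and3P[_ -> h1] /and3P[_ _ h2]] /=.
    exact: lcm_pow_dvd.
  have t0 : 0 <= \sum_(0 <= e < M.+1 | tail_hit N K k e) ((d %| e)%N%:R * (d' %| e)%N%:R) :> R.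
    by apply: sumr_ge0 => e _; rewrite mulr_ge0.
  apply: (le_trans h); have [Kl|lK] := ltP K (l%:R ^+ k).
    apply: le_trans (count_tail_le1 B KN' k0 Kl) _.
    have m0 : 0 <= 2 * K * l%:R ^- k by rewrite !mulr_ge0 ?invr_ge0 ?exprn_ge0.
    case: (boolP (_ && _)) => [/andP[th lM]|_]; last by rewrite addr_ge0.
    rewrite -[X in X <= _]add0r; apply: lerD => //.
    rewrite big_mkcond (bigD1_seq l) ?iota_uniq ?mem_index_iota //= th dvdn_lcml dvdn_lcmr mulr1 lerDl.
    by apply: sumr_ge0 => e _; case: ifP => // _; rewrite mulr_ge0.
  apply: le_trans (count_win_multiples B KN' lk0) _.
  have : 1 <= K * l%:R ^- k by rewrite ler_pdivlMr ?exprn_gt0 ?ltr0n // mul1r.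
  by rewrite natrX; lra.
have E : \sum_(0 <= d < M.+1) \sum_(0 <= d' < M.+1) (count (fun n => chi d n && chi d' n) (iota 0 B))%:R =
  \sum_(Z.+1 <= d < M.+1) \sum_(Z.+1 <= d' < M.+1) c d d'.
  have [ZM|MZ] := leqP Z.+1 M.+1; last first.
    rewrite [RHS]big_geq; last exact: ltnW.
    rewrite big_nat big1 // => d /andP[_ dM]; rewrite big1 // => d' _; apply: c0.
    by rewrite -leqNgt -ltnS (leq_trans dM) // ltnW.
  rewrite (@big_cat_nat _ _ _ Z.+1) //= [X in X + _](_ : _ = 0) ?add0r; last first.
    rewrite big_nat big1 // => d /andP[_ dZ]; rewrite big1 // => d' _; apply: c0.
    by rewrite -leqNgt -ltnS dZ.
  apply: eq_bigr => d _; rewrite (@big_cat_nat _ _ _ Z.+1) //= [X in X + _](_ : _ = 0) ?add0r //.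
  rewrite big_nat big1 // => d' /andP[_ dZ]; apply: c0.
  by apply/orP; right; rewrite -leqNgt -ltnS.
rewrite E.
apply: (@le_trans _ _ (\sum_(Z.+1 <= d < M.+1) \sum_(Z.+1 <= d' < M.+1) (2 * K * (lcmn d d')%:R ^- k +
    \sum_(0 <= e < M.+1 | tail_hit N K k e) ((d %| e)%N%:R * (d' %| e)%N%:R)))).
  rewrite big_nat [X in _ <= X]big_nat; apply: ler_sum => d /andP[Zd _].
  by rewrite big_nat [X in _ <= X]big_nat; apply: ler_sum => d' /andP[Zd' _]; apply: cb.
under eq_bigr do rewrite big_split /= -mulr_sumr.
rewrite big_split /= -mulr_sumr; apply: lerD.
  have -> : 24 * (K * Z%:R ^- k.-1) = 2 * K * (12 * Z%:R ^- k.-1) by ring.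
  by rewrite ler_wpM2l ?mulr_ge0 // lcm_tail_sum.
under eq_bigr do rewrite exchange_big /=.
rewrite exchange_big /=; apply: ler_sum => e /andP[_ he].
have [e0 _ _ _] := hit_bounds KN' k0 he.
have sz : \sum_(Z.+1 <= d < M.+1) (d %| e)%N%:R <= (size (divisors e))%:R :> R.
  rewrite -natr_sum ler_nat.
  have -> : (\sum_(Z.+1 <= d < M.+1) (d %| e) = count (fun d => d %| e) (index_iota Z.+1 M.+1))%N.
    by elim: (index_iota _ _) => [|x s IH]; rewrite ?big_nil // big_cons /= IH.
  rewrite -size_filter; apply: uniq_leq_size; first by rewrite filter_uniq ?iota_uniq.
  by move=> d; rewrite mem_filter -dvdn_divisors // => /andP[].
under eq_bigr do rewrite -mulr_sumr.
rewrite -mulr_suml expr2; apply: ler_pM => //; exact: sumr_ge0.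
Qed.

(** * The number of [k]-free integers in a window *)

Lemma cutoff_ge (R : realType) (N K : R) : ((Num.truncn N).+1 <= cutoff N K)%N.
Proof. exact: leq_addr. Qed.

Lemma expsum_decomp (R : realType) (N K x : R) k Z : (0 < k)%N -> 0 <= K <= N -> (Z <= Num.truncn N)%N ->
  expsum k N K x = main_sum N K k Z (cutoff N K) x + trigpoly (cutoff N K) (rem_coef N K k Z) x.
Proof.
move=> k0 KN ZN; have N0 : 0 <= N by case/andP: KN => K0; exact: le_trans.
rewrite (expsumE K x k N0 (cutoff_ge N K)) (main_sumE x k Z KN (cutoff_ge N K)) -trigpolyD.
by apply: eq_trigpoly => n _; rewrite -(kfree_sub_main_coef n k0 KN ZN) addrC subrK.
Qed.

Lemma mean_rest_sq (R : realType) (N K : R) k Z B : (2 <= k)%N -> 1 <= K -> K <= N -> (0 < Z)%N ->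
  mean (fun x => nc (trigpoly B (rem_coef N K k Z) x) ^+ 2) <= 24 * (K * Z%:R ^- (k.-1)) + tail_sum N K k.
Proof.
move=> k2 K1 KN Z0; apply: le_trans (rem_coef_L2 B k2 K1 KN Z0).
rewrite -(@parseval R 1) //; under [X in _ <= mean X]eq_fun do rewrite mul1r.
exact: lexx.
Qed.

Lemma eventually_large (R : realType) (c theta K0 : R) : 0 < c -> 0 < theta ->
  exists2 N0 : R, 1 <= N0 & forall N, N0 <= N -> K0 <= c * N `^ theta.
Proof.
move=> c0 t0; have [N0 N01 H] := @powR_absorb R (K0 / c) 0 theta t0.
exists N0 => // N hN; have := H N hN; rewrite powRr0 mulr1 ler_pdivrMr // mulrC //.
Qed.

Lemma kfree_coef_ge0 (R : realType) (N K : R) k n : 0 <= kfree_coef N K k n.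
Proof. by rewrite mulr_ge0 // /mu indicE. Qed.

Lemma kfree_coef_sq (R : realType) (N K : R) k n : kfree_coef N K k n ^+ 2 = kfree_coef N K k n.
Proof. by rewrite /kfree_coef /mu indicE -natrM mulnb; case: (_ && _); rewrite ?expr1n ?expr0n. Qed.

Lemma kfree_coef_win (R : realType) (N K : R) k n : kfree_coef N K k n <= (win N K n)%:R.
Proof. by rewrite /kfree_coef ler_piMr // /mu indicE; case: (_ \in _). Qed.

Lemma count_win_ge (R : realType) (N K : R) B : 0 <= K <= N -> ((Num.truncn N).+1 <= B)%N ->
  K - 1 <= (count (win N K) (iota 0 B))%:R.
Proof.
move=> /andP[K0 KN] hB; have N0 : 0 <= N by apply: le_trans KN.
pose a := Num.truncn (N - K); pose b := Num.truncn N.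
have ab : (a <= b)%N by apply: le_truncn; lra.
have h : (size (iota a.+1 (b - a)) <= count (win N K) (iota 0 B))%N.
  rewrite -size_filter; apply: uniq_leq_size; first exact: iota_uniq.
  move=> n; rewrite mem_iota addSn subnKC // => /andP[an nb]; rewrite mem_filter mem_iota /= add0n.
  rewrite (leq_trans _ hB) ?ltnS // andbT /win.
  rewrite -truncn_ge_nat // -ltnS nb andbT; apply: lt_le_trans (truncnS_gt (N - K)) _.
  by rewrite ler_nat.
move: h; rewrite size_iota -(ler_nat R) natrB // => /(le_trans _); apply.
have := truncnS_gt N; rewrite -natr1 -/b.
have : a%:R <= N - K by rewrite truncn_le subr_ge0.
lra.
Qed.

Lemma count_win_le (R : realType) (N K : R) B : 0 <= K <= N ->
  (count (win N K) (iota 0 B))%:R <= K + 1.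
Proof.
move=> KN; have := count_win_multiples B KN (ltn0Sn 0); rewrite divr1.
by under eq_count do rewrite dvd1n andbT.
Qed.

Lemma sum_from2_le (R : realFieldType) m (F : nat -> R) : (forall n, 0 <= F n) ->
  \sum_(2 <= d < m) F d <= \sum_(0 <= d < m) F d.
Proof.
move=> F0; apply: sum_sub_uniq => //; rewrite ?iota_uniq // => d.
by rewrite !mem_index_iota => /andP[].
Qed.

(** An integer that is not [k]-free is divisible by [d ^ k] for some [d >= 2].  Small [d] sieve
    out a proportion of at most 11 / 12 of the window, and [tail_small] shows that the other
    [d] are negligible. *)
Lemma kfree_count (R : realType) k (theta c : R) : (2 <= k)%N -> delta R k < theta -> 0 < theta -> 0 < c ->
  exists2 N0 : R, 1 <= N0 & forall N K B, N0 <= N -> 1 <= K -> K <= N -> c * N `^ theta <= K ->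
    ((Num.truncn N).+1 <= B)%N -> K / 24 <= \sum_(0 <= n < B) kfree_coef N K k n.
Proof.
move=> k2 dt t0 c0; have k0 : (0 < k)%N by apply: leq_trans k2.
have kr2 : 2 <= k%:R :> R by rewrite ler_nat.
have kap0 : 0 < 96^-1 :> R by rewrite invr_gt0.
have w1 : 2 / (k%:R + 1) <= 1 :> R by rewrite ler_pdivrMr; lra.
have d1 : delta R k < theta * 1 by rewrite mulr1.
have [M0 M01 HM0] := @tail_small R k 1 theta c 96^-1 k2 w1 d1 t0 c0 kap0.
have k1 : k%:R^-1 < 1 :> R by rewrite invf_lt1; lra.
have [K1 K11 HK1] := @powR_absorb R 96 k%:R^-1 1 k1.
have [M1 M11 HM1] := @eventually_large R c theta (Num.max K1 96) c0 t0.
exists (Num.max M0 M1); first by rewrite le_max M01.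
move=> N K B; rewrite ge_max => /andP[NM0 NM1] K1' KN cK hB.
have KN' : 0 <= K <= N by rewrite (le_trans _ K1').
have K0 : 0 <= K by case/andP: KN'.
have := le_trans (HM1 _ NM1) cK; rewrite ge_max => /andP[KK1 K96].
have tl : tail_sum N K k <= K / 96.
  by have := HM0 N K NM0 K1' KN cK; rewrite powRr1 // mulrC.
pose y := K `^ k%:R^-1.
have yK : y <= K / 96 by have := HK1 K KK1; rewrite powRr1 // -/y; lra.
set M := Num.truncn N.
have low n : (win N K n)%:R - \sum_(2 <= d < M.+1) (win N K n && (d ^ k %| n)%N)%:R <= kfree_coef N K k n.
  case: (boolP (win N K n)) => wn; last first.
    by rewrite sub0r; apply: le_trans (kfree_coef_ge0 _ _ _ _); rewrite oppr_le0 sumr_ge0.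
  have s0 : 0 <= \sum_(2 <= d < M.+1) (true && (d ^ k %| n)%N)%:R :> R by apply: sumr_ge0.
  rewrite /kfree_coef wn mul1r /mu indicE; case: (boolP (n \in kfree k)) => nk; first by rewrite lerBlDr lerDl.
  have [p pp pn] : exists2 p, prime p & (p ^ k %| n)%N.
    move: nk => /negP nk; apply: contrapT => H; apply: nk; apply/mem_set => p pp.
    by apply/negP => pn; apply: H; exists p.
  have /andP[_ pM] := hit_of_multiple KN' k0 wn pn.
  rewrite (bigD1_seq p) ?iota_uniq ?mem_index_iota ?prime_gt1 //= pn.
  rewrite opprD addrA subrr sub0r oppr_le0; exact: sumr_ge0.
apply: le_trans (ler_sum _ (fun n _ => low n)).
rewrite sumrB exchange_big /= sum_count.
under [X in _ <= _ - X]eq_bigr do rewrite (sum_count R (fun n => win N K n && (_ ^ k %| n)%N)).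
have cw := count_win_ge KN' hB.
have bad : \sum_(2 <= d < M.+1) (count (fun n => win N K n && (d ^ k %| n)%N) (iota 0 B))%:R <=
   K * (11 / 12) + y + tail_sum N K k.
  apply: (@le_trans _ _ (\sum_(2 <= d < M.+1) (K * d%:R ^- 2 + ((0 < d)%N && (d%:R <= y))%:R +
     (if tail_hit N K k d then (size (divisors d))%:R ^+ 2 else 0)))).
    rewrite big_nat [X in _ <= X]big_nat; apply: ler_sum => d /andP[d2 dM].
    have d0 : (0 < d)%N by apply: leq_trans d2.
    have d0' : 0 < d%:R :> R by rewrite ltr0n.
    have dk : (0 < d ^ k)%N by rewrite expn_gt0 d0.
    have t1 : 0 <= (if tail_hit N K k d then (size (divisors d))%:R ^+ 2 else 0) :> R by case: ifP => // _; rewrite exprn_ge0.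
    have q0 : 0 <= K * d%:R ^- 2 by rewrite mulr_ge0 // invr_ge0 exprn_ge0.
    have [Kd|dK] := ltP K (d%:R ^+ k).
      apply: le_trans (count_tail_le1 B KN' k0 Kd) _.
      rewrite -[X in X <= _]add0r; apply: lerD; first by rewrite addr_ge0.
      case: (boolP (tail_hit N K k d)) => //= th.
      have sz : (0 < size (divisors d))%N.
        by have := divisors_id d0; case: (divisors d).
      apply: (@le_trans _ _ 1); first by case: (_ <= _)%N.
      by rewrite exprn_ege1 // ler1n.
    apply: le_trans (count_win_multiples B KN' dk) _.
    rewrite d0 (_ : d%:R <= y) /=; last by rewrite leNgt -lt_root_exp // ltNge dK.
    rewrite -[X in X <= _]addr0; apply: lerD => //; rewrite lerD2r natrX ler_wpM2l // lef_pV2 ?posrE ?exprn_gt0 //.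
    by rewrite ler_weXn2l // ler1n.
  rewrite !big_split /= -mulr_sumr; apply: lerD; first apply: lerD.
  (* 1 / 4 + 2 / 3 = 11 / 12 bounds the sum of [d ^ - 2] over [d >= 2] *)
  - rewrite ler_wpM2l //; have [M1'|M2] := leqP M 1; first by rewrite big_geq // divr_ge0.
    rewrite big_ltn //; have := sum_inv_sq_tail R M.+1 (isT : (0 < 3)%N); lra.
  - apply: le_trans (count_le_bound M.+1 (powR_ge0 K k%:R^-1)); rewrite -sum_count.
    exact: sum_from2_le.
  - rewrite /tail_sum [X in _ <= X]big_mkcond -/M.
    have P0 d : 0 <= (if tail_hit N K k d then (size (divisors d))%:R ^+ 2 else 0) :> R by case: ifP => // _; rewrite exprn_ge0.
    exact: sum_from2_le.
lra.
Qed.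

Lemma mean_expsum_sq (R : realType) (N K : R) k : 0 <= K <= N ->
  mean (fun x => nc (expsum k N K x) ^+ 2) <= K + 1.
Proof.
move=> KN; have N0 : 0 <= N by case/andP: KN => K0; exact: le_trans.
under [X in mean X <= _]eq_fun do rewrite (expsumE K _ k N0 (leqnn _)) -[X in trigpoly _ _ X]mul1r.
rewrite (@parseval R 1) //; apply: le_trans (count_win_le (Num.truncn N).+1 KN).
rewrite -sum_count; apply: ler_sum => n _; by rewrite kfree_coef_sq kfree_coef_win.
Qed.

Lemma normc_expsum_le (R : realType) (N K x : R) k : 0 <= K <= N -> nc (expsum k N K x) <= K + 1.
Proof.
move=> KN; have N0 : 0 <= N by case/andP: KN => K0; exact: le_trans.
rewrite (expsumE K x k N0 (leqnn _)); apply: le_trans (normc_sum_le _ _ _) _.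
apply: le_trans (count_win_le (Num.truncn N).+1 KN); rewrite -sum_count; apply: ler_sum => n _.
by rewrite Normc.normcM normc_expe mulr1 normcR ger0_norm ?kfree_coef_ge0 // kfree_coef_win.
Qed.

(** * Upper bounds for the moments *)

Lemma bmeas_expsum (R : realType) (N K : R) k : 0 <= K <= N -> bmeas (fun x => nc (expsum k N K x)).
Proof.
move=> KN; have N0 : 0 <= N by case/andP: KN => K0; exact: le_trans.
have := cbmeas_norm (cbmeas_trigpoly1 (Num.truncn N).+1 (kfree_coef N K k)); congr bmeas.
by apply/funext => x; rewrite (expsumE K x k N0 (leqnn _)).
Qed.

Lemma momentE (R : realType) (N K s : R) k : 0 <= s -> 0 <= K <= N ->
  moment k s N K = (mean (fun x => nc (expsum k N K x) `^ s))%:E.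
Proof.
move=> s0 KN; rewrite /mean /Rintegral fineK //.
apply: integrable_fin_num => //; apply: bmeas_integrable; apply: bmeas_powR => //.
  by move=> x; exact: normc_ge0.
exact: bmeas_expsum.
Qed.

Lemma delta_gt0 (R : realType) k : (2 <= k)%N -> 0 < delta R k.
Proof.
move=> k2; have [a0 [a1 [al [r [tau [[_ h1 h2 _ _] _]]]]]] := @exponents_exist R k k2.
exact: lt_trans h2.
Qed.

(** The exponent [w] for which a mean square of order [K ^ w] corresponds to an [s]th moment of
    order [(K ^ w) ^ (s / 2) = moment_order k s K]. *)
Definition tail_exp (R : realType) (k : nat) (s : R) : R :=
  if s < 1 + k%:R^-1 then 2 / (k%:R + 1) else 2 * (s - 1) / s.

Lemma tail_exp_ge (R : realType) (k : nat) (s : R) : (2 <= k)%N -> 0 < s -> 2 / (k%:R + 1) <= tail_exp k s.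
Proof.
move=> k2 s0; rewrite /tail_exp; case: ltP => // h.
have k0 : 0 < k%:R :> R by rewrite ltr0n (leq_trans _ k2).
have h2 : k%:R + 1 <= s * k%:R by have := ler_wpM2r (ltW k0) h; rewrite mulrDl mulVf ?gt_eqF // mul1r.
by rewrite ler_pdivlMr // mulrAC ler_pdivrMr; lra.
Qed.

(** Below order [2] the value of [theta_bound k s] is [delta k / tail_exp k s]. *)
Lemma tail_exp_delta (R : realType) (k : nat) (s theta : R) : (2 <= k)%N -> 0 < s -> s < 2 ->
  theta_bound k s < theta -> delta R k < theta * tail_exp k s.
Proof.
move=> k2 s0 s2; have k0 : 0 < k%:R :> R by rewrite ltr0n (leq_trans _ k2).
rewrite /theta_bound /tail_exp; case: (boolP (s < 1 + k%:R^-1)) => h; rewrite ?s2 => ht.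
  rewrite mulrA ltr_pdivlMr; last by lra.
  by move: ht; lra.
have s1 : 0 < s - 1 by move: h; rewrite -leNgt; have : 0 < (k%:R : R)^-1; [rewrite invr_gt0|lra].
rewrite mulrA ltr_pdivlMr // [delta R k * s]mulrC.
have -> : s * delta R k = (1 / 2 + 1 / (2 * (s - 1))) * delta R k * (2 * (s - 1)).
  by field; rewrite gt_eqF.
by rewrite ltr_pM2r ?mulr_gt0.
Qed.

Lemma theta_bound_ge_delta (R : realType) (k : nat) (s : R) : (2 <= k)%N -> 0 < s -> delta R k <= theta_bound k s.
Proof.
move=> k2 s0; have d0 := @delta_gt0 R k k2.
have kr2 : 2 <= k%:R :> R by rewrite ler_nat.
rewrite /theta_bound; case: ltP => h; first by rewrite ler_peMl ?(ltW d0) // ler_pdivlMr; lra.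
case: ltP => h2 //; rewrite ler_peMl ?(ltW d0) //.
have s1 : 0 < s - 1 by have : 0 < (k%:R : R)^-1; [rewrite invr_gt0; lra|lra].
have : 1 / 2 <= 1 / (2 * (s - 1)) by rewrite !div1r lef_pV2 ?posrE ?mulr_gt0 //; lra.
lra.
Qed.

Lemma moment_order_tail (R : realType) (k : nat) (s K : R) : (2 <= k)%N -> 1 <= K -> 0 < s ->
  moment_order k s K = K `^ (tail_exp k s / 2 * s).
Proof.
move=> k2 K1 s0; rewrite /moment_order /tail_exp; case: ltP => h; congr (_ `^ _).
  by field; rewrite gt_eqF // addr_gt0 // ltr0n (leq_trans _ k2).
by field; rewrite gt_eqF.
Qed.

(** With [Z] about [K ^ (1 / (k + 1))] the mean square of the rest is controlled by
    the tail sum. *)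
Lemma rest_small (R : realType) k (w theta c : R) : (2 <= k)%N ->
  2 / (k%:R + 1) <= w -> delta R k < theta * w -> 0 < theta -> 0 < c ->
  exists2 N0 : R, 1 <= N0 & forall N K Z, N0 <= N -> 1 <= K -> K <= N -> c * N `^ theta <= K ->
    (0 < Z)%N -> mean (fun x => nc (trigpoly (cutoff N K) (rem_coef N K k Z) x) ^+ 2) <=
      24 * (K * Z%:R ^- (k.-1)) + K `^ w.
Proof.
move=> k2 wk dw t0 c0; have [N0 N01 H] := @tail_small R k w theta c 1 k2 wk dw t0 c0 ltr01.
exists N0 => // N K Z hN K1 KN cK Z0; apply: le_trans (mean_rest_sq _ k2 K1 KN Z0) _.
by rewrite lerD2l; have := H N K hN K1 KN cK; rewrite mul1r.
Qed.

Lemma truncn_half (R : realType) (D : R) : 1 <= D -> [/\ (0 < Num.truncn D)%N, (Num.truncn D)%:R <= D & D <= 2 * (Num.truncn D)%:R].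
Proof.
move=> D1; have Z0 : (0 < Num.truncn D)%N by rewrite truncn_gt0.
split => //; first by rewrite truncn_le (le_trans _ D1).
have := truncnS_gt D; rewrite -natr1; have : 1 <= (Num.truncn D)%:R :> R by rewrite ler1n.
lra.
Qed.

(** Both parts of [expsum] are treated with [Z] about [D]; for the remainder interpolate
    between orders [0] and [2] at the height [K ^ (w / 2)]. *)
Lemma moment_upper_mid (R : realType) k (s theta c : R) : (2 <= k)%N -> 1 <= s -> s < 2 -> s != 1 + k%:R^-1 ->
  theta_bound k s < theta -> 0 < c ->
  exists2 C : R, 0 < C & exists2 N0 : R, 1 <= N0 &
   forall N K, N0 <= N -> 1 <= K -> K <= N -> c * N `^ theta <= K ->
   mean (fun x => nc (expsum k N K x) `^ s) <= C * moment_order k s K.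
Proof.
move=> k2 s1 s2 sk th c0; have s0 : 0 < s by lra.
have k0 : (0 < k)%N by apply: leq_trans k2.
have d0 := @delta_gt0 R k k2.
have t0 : 0 < theta by apply: lt_trans th; apply: lt_le_trans d0 (theta_bound_ge_delta k2 s0).
have [C1 C10 HC1] := moment_main_sum k2 s1 s2 sk.
set w := tail_exp k s.
have wk : 2 / (k%:R + 1) <= w by exact: tail_exp_ge.
have [N0 N01 HN0] := rest_small k2 wk (tail_exp_delta k2 s0 s2 th) t0 c0.
pose C2 : R := 24 * 2 ^+ k.-1 + 2.
have C20 : 0 < C2 by rewrite ltr_wpDl // mulr_ge0 // exprn_ge0.
exists (2 `^ s * (C1 + C2)); first by rewrite mulr_gt0 ?powR_gt0 // addr_gt0.
exists N0 => // N K hN K1 KN cK.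
have K0 : 0 < K by apply: lt_le_trans K1.
have KN' : 0 <= K <= N by rewrite KN ltW.
pose D := K `^ (k%:R + 1)^-1.
have [D1 DK] := @root_scale R K k K1; rewrite -/D in D1 DK.
have D0 : 0 < D by apply: lt_le_trans D1.
pose Z := Num.truncn D.
have [Z0 ZD DZ] := truncn_half D1; rewrite -/Z in Z0 ZD DZ.
have Zr : 0 < Z%:R :> R by rewrite ltr0n.
have ZN : (Z <= Num.truncn N)%N.
  apply: le_truncn; apply: le_trans KN; rewrite -DK exprS ler_peMr ?exprn_ege1 // ltW //.
have hR := HN0 N K Z hN K1 KN cK Z0.
set M := moment_order k s K.
have ME : M = K `^ (w / 2 * s) by exact: moment_order_tail.
have M0 : 0 < M by rewrite ME powR_gt0.
have KZ : K * Z%:R ^- k.-1 <= 2 ^+ k.-1 * K `^ w.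
  have h : D ^+ k.-1 <= 2 ^+ k.-1 * Z%:R ^+ k.-1 by rewrite -exprMn le_exprn2 // ltW.
  rewrite ler_pdivrMr ?exprn_gt0 //.
  have -> : K = D ^+ 2 * D ^+ k.-1 by rewrite -exprD addSn add1n prednK.
  have D2 : D ^+ 2 <= (D ^+ 2 * D ^+ k.-1) `^ w.
    rewrite -exprD addSn add1n prednK // DK; apply: le_trans (ler_powR K1 wk).
    by rewrite /D -powR_mulrn ?powR_ge0 // -powRrM mulrC.
  rewrite [X in _ <= X]mulrAC [X in _ <= X]mulrC.
  by apply: ler_pM; rewrite ?exprn_ge0 ?(ltW D0).
have bR : bmeas (fun x => nc (trigpoly (cutoff N K) (rem_coef N K k Z) x)) by apply: cbmeas_norm; exact: cbmeas_trigpoly1.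
have bV := bmeas_main_sum N K k Z (cutoff N K).
have bRs : bmeas (fun x => nc (trigpoly (cutoff N K) (rem_coef N K k Z) x) `^ s) by apply: bmeas_powR => //; [exact: ltW|move=> x; exact: normc_ge0].
have bVs : bmeas (fun x => nc (main_sum N K k Z (cutoff N K) x) `^ s) by apply: bmeas_powR => //; [exact: ltW|move=> x; exact: normc_ge0].
have pR : mean (fun x => nc (trigpoly (cutoff N K) (rem_coef N K k Z) x) `^ s) <= C2 * M.
  set l := K `^ (w / 2); have l0 : 0 < l by exact: powR_gt0.
  apply: (@le_trans _ _ (mean (fun x => l `^ s + l `^ (s - 2) * nc (trigpoly (cutoff N K) (rem_coef N K k Z) x) ^+ 2))).
    apply: mean_le => //; first by apply: bmeasD; [exact: bmeas_cst|apply: bmeasM; [exact: bmeas_cst|exact: bmeas_sq]].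
    move=> x _; apply: powR_interp02 => //; [exact: normc_ge0|lra].
  rewrite meanD; [|exact: bmeas_cst|by apply: bmeasM; [exact: bmeas_cst|exact: bmeas_sq]].
  rewrite mean_cst meanZ; last exact: bmeas_sq.
  have lM : l `^ s = M by rewrite ME /l -powRrM.
  have lw : l `^ (s - 2) * K `^ w = M.
    by rewrite ME /l -powRrM -powRD ?(gt_eqF K0) ?implybT //; congr (_ `^ _); field.
  rewrite lM; apply: (@le_trans _ _ (M + l `^ (s - 2) * (24 * (2 ^+ k.-1 * K `^ w) + K `^ w))).
    rewrite lerD2l; apply: ler_wpM2l; first exact: powR_ge0.
    apply: (le_trans hR); rewrite lerD2r; apply: ler_wpM2l; [exact: ler0n|exact: KZ].
  have -> : l `^ (s - 2) * (24 * (2 ^+ k.-1 * K `^ w) + K `^ w) = (24 * 2 ^+ k.-1 + 1) * (l `^ (s - 2) * K `^ w) by ring.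
  by rewrite lw /C2; lra.
have pV := HC1 N K D Z K1 KN erefl Z0 ZD.
apply: (@le_trans _ _ (mean (fun x => 2 `^ s * (nc (main_sum N K k Z (cutoff N K) x) `^ s + nc (trigpoly (cutoff N K) (rem_coef N K k Z) x) `^ s)))).
  apply: mean_le.
  - by apply: bmeas_powR; [exact: ltW|move=> x; exact: normc_ge0|exact: bmeas_expsum].
  - by apply: bmeasM; [exact: bmeas_cst|exact: bmeasD].
  move=> x _; apply: le_trans (powR_add_le _ _ (ltW s0)); rewrite ?normc_ge0 //.
  apply: le_powR2; [exact: ltW|exact: normc_ge0|].
  by rewrite (expsum_decomp x k0 KN' ZN) normcD_le.
rewrite meanZ; last exact: bmeasD.
rewrite meanD // -mulrA ler_wpM2l ?powR_ge0 // mulrDl; exact: lerD.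
Qed.

Lemma inv_nat_lt1 (R : realType) k : (2 <= k)%N -> 0 < (k%:R : R)^-1 < 1.
Proof.
move=> k2; have k0 : 0 < k%:R :> R by rewrite ltr0n (leq_trans _ k2).
by rewrite invr_gt0 k0 invf_lt1 // ltr1n.
Qed.

(** For [s >= 2] the trivial bound [K + 1] for [expsum] reduces the moment to the mean square;
    for [s < 1] the first moment suffices. *)
Theorem moment_upper (R : realType) k (s theta c : R) : (2 <= k)%N -> 0 < s -> s != 1 + k%:R^-1 ->
  theta_bound k s < theta -> 0 < c ->
  exists2 C : R, 0 < C & exists2 N0 : R, 1 <= N0 &
   forall N K, N0 <= N -> 1 <= K -> K <= N -> c * N `^ theta <= K ->
   mean (fun x => nc (expsum k N K x) `^ s) <= C * moment_order k s K.
Proof.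
move=> k2 s0 sk th c0; have /andP[ik0 ik1] := @inv_nat_lt1 R k k2.
have [s2|s2] := ltP s 2; last first.
  exists (2 `^ (s - 1)); first by exact: powR_gt0.
  exists 1 => // N K _ K1 KN _; have K0 : 0 < K by apply: lt_le_trans K1.
  have KN' : 0 <= K <= N by rewrite KN ltW.
  have -> : moment_order k s K = K `^ (s - 1) by rewrite /moment_order ltNge (_ : 1 + k%:R^-1 <= s) //; lra.
  have bS := bmeas_expsum k KN'.
  apply: (@le_trans _ _ (mean (fun x => (K + 1) `^ (s - 2) * nc (expsum k N K x) ^+ 2))).
    apply: mean_le.
    - by apply: bmeas_powR => //; [exact: ltW|move=> x; exact: normc_ge0].
    - by apply: bmeasM; [exact: bmeas_cst|exact: bmeas_sq].
    move=> x _; set a := nc _; have a0 : 0 <= a by exact: normc_ge0.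
    have [->|an] := eqVneq a 0; first by rewrite powR0 ?gt_eqF // expr0n mulr0.
    have -> : a `^ s = a `^ (s - 2) * a ^+ 2.
      by rewrite -powR_mulrn // -powRD ?subrK // an implybT.
    rewrite ler_wpM2r ?sqr_ge0 //; apply: le_powR2 => //; first by lra.
    exact: normc_expsum_le.
  rewrite meanZ; last exact: bmeas_sq.
  apply: (@le_trans _ _ ((K + 1) `^ (s - 2) * (K + 1))).
    by rewrite ler_wpM2l ?powR_ge0 // mean_expsum_sq.
  have -> : (K + 1) `^ (s - 2) * (K + 1) = (K + 1) `^ (s - 1).
    have K10 : 0 < K + 1 by lra.
    rewrite -{2}(powRr1 (ltW K10)) -powRD ?(gt_eqF K10) ?implybT //; congr (_ `^ _); ring.
  rewrite -powRM ?(ltW K0) //; apply: le_powR2; lra.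
have [s1|s1] := leP 1 s; first exact: moment_upper_mid.
have lt1 : s < 1 + k%:R^-1 by lra.
have lt1' : 1 < 1 + k%:R^-1 :> R by lra.
have th1 : theta_bound k 1 < theta by move: th; rewrite /theta_bound lt1 lt1'.
have ne1 : (1 : R) != 1 + k%:R^-1 by rewrite lt_eqF.
have [C C0 [N0 N01 H]] := @moment_upper_mid R k 1 theta c k2 (lexx _) (ltr1n R 2) ne1 th1 c0.
exists (1 + C); first by lra.
exists N0 => // N K hN K1 KN cK.
have := H N K hN K1 KN cK; have K0 : 0 < K by apply: lt_le_trans K1.
have KN' : 0 <= K <= N by rewrite KN ltW.
have bS := bmeas_expsum k KN'.
rewrite /moment_order lt1 lt1' div1r; set D := K `^ _ => h.
have D0 : 0 < D by exact: powR_gt0.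
have Ds : K `^ (s / (k%:R + 1)) = D `^ s by rewrite /D -powRrM mulrC.
have h' : mean (fun x => nc (expsum k N K x)) <= C * D.
  apply: le_trans h; rewrite le_eqVlt; apply/orP; left; apply/eqP; congr mean.
  by apply/funext => x; rewrite powRr1 // normc_ge0.
rewrite Ds; apply: (@le_trans _ _ (mean (fun x => D `^ s + D `^ (s - 1) * nc (expsum k N K x)))).
  apply: mean_le.
  - by apply: bmeas_powR => //; [exact: ltW|move=> x; exact: normc_ge0].
  - by apply: bmeasD; [exact: bmeas_cst|apply: bmeasM => //; exact: bmeas_cst].
  move=> x _; apply: powR_interp01 => //; [exact: normc_ge0|lra].
rewrite meanD; [|exact: bmeas_cst|by apply: bmeasM => //; exact: bmeas_cst].
rewrite mean_cst meanZ // mulrDl mul1r lerD2l.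
apply: (@le_trans _ _ (D `^ (s - 1) * (C * D))); first by rewrite ler_wpM2l ?powR_ge0.
rewrite mulrCA ler_wpM2l ?(ltW C0) // -{2}(powRr1 (ltW D0)) -powRD ?subrK // (gt_eqF D0) implybT //.
Qed.

(** * Arcs *)

Definition arc_ind (R : realType) (a b x : R) : R := (if a <= x <= b then 1 else 0).

Lemma arc_ind_indic (R : realType) (a b : R) : arc_ind a b = \1_(`[a, b]%classic).
Proof. by apply/funext => x; rewrite /arc_ind indicE mem_setE /= in_itv /=; case: (_ && _). Qed.

Lemma bmeas_arc_ind (R : realType) (a b : R) : bmeas (arc_ind a b).
Proof.
split; first by rewrite arc_ind_indic; exact: measurable_indic.
by exists 1 => x; rewrite /arc_ind; case: ifP => _; rewrite ?normr1 ?normr0.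
Qed.

Lemma mean_arc_indM (R : realType) (a b : R) (f : R -> R) : 0 <= a -> b <= 1 ->
  mean (fun x => arc_ind a b x * f x) = Rintegral (@lebesgue_measure R) `[a, b]%classic f.
Proof.
move=> a0 b1; rewrite /mean.
have -> : `[a, b]%classic = (`[0, 1] `&` `[a, b])%classic.
  apply/seteqP; split=> x /=; rewrite !in_itv /=; last by case.
  by move=> /andP[ax xb]; rewrite ax xb (le_trans a0 ax) (le_trans xb b1).
rewrite Rintegral_mkcondr; apply: eq_Rintegral => x _; rewrite patchE /arc_ind mem_setE /= in_itv /=.
by case: (_ && _); rewrite ?mul1r ?mul0r.
Qed.

Lemma mean_arc_ind (R : realType) (a b : R) : 0 <= a -> a <= b -> b <= 1 -> mean (arc_ind a b) = b - a.
Proof.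
move=> a0 ab b1; have := mean_arc_indM (fun=> 1) a0 b1.
under eq_fun do rewrite mulr1; move=> ->.
rewrite Rintegral_cst // mul1r /= lebesgue_measure_itv /= lte_fin.
move: ab; rewrite le_eqVlt => /orP[/eqP ->|ab]; first by rewrite ltxx subrr.
by rewrite ab -EFinD.
Qed.

Lemma cos_ge_half (R : realType) (y : R) : 0 <= y <= pi / 4 -> 2^-1 <= cos y.
Proof.
move=> /andP[y0 y4]; have p0 := pi_gt0 R.
have c4 : 2^-1 <= cos (pi / 4 : R).
  have h : cos (pi / 4 : R) ^+ 2 = 2^-1.
    have : cos (pi / 4 + pi / 4 : R) = 0 by rewrite -[RHS](@cos_pihalf R); congr cos; field.
    rewrite cosD -!expr2; have := cos2Dsin2 (pi / 4 : R); lra.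
  have g : 0 < cos (pi / 4 : R) by apply: cos_gt0_pihalf; apply/andP; split; lra.
  by rewrite leNgt; apply/negP => lt; move: h; rewrite expr2 => h; nra.
apply: (le_trans c4); move: y4; rewrite le_eqVlt => /orP[/eqP -> //|y4].
apply: ltW; rewrite ltr_cos // in_itv /=; apply/andP; split; lra.
Qed.

Lemma continuous_nc_trigpoly (R : realType) B (c : nat -> R) : continuous (fun x => nc (trigpoly B c x)).
Proof.
have hs (g : R -> R) : continuous g ->
    continuous (fun x : R => \sum_(0 <= n < B) c n * g (2 * pi * (n%:R * x))).
  move=> cg; apply: continuous_big; first exact: add_continuous.
  move=> n _ x; apply: cvgM; first exact: cvg_cst.
  by apply: continuous_comp; [apply: cvgMr; apply: cvgMr; exact: cvg_id|exact: cg].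
have E : (fun x => nc (trigpoly B c x)) = (fun x => Num.sqrt (
    (\sum_(0 <= n < B) c n * cos (2 * pi * (n%:R * x))) ^+ 2 +
    (\sum_(0 <= n < B) c n * sin (2 * pi * (n%:R * x))) ^+ 2)).
  by apply/funext => x; rewrite -re_trigpoly -im_trigpoly -sqr_normcE sqrtr_sqr ger0_norm ?normc_ge0.
rewrite E => x; apply: continuous_comp; last exact: sqrt_continuous.
by apply: cvgD; rewrite /= expr2; under eq_fun do rewrite expr2; apply: cvgM; apply: hs;
  first [exact: continuous_cos|exact: continuous_sin].
Qed.

Lemma mean_shift (R : realType) (f : R -> R) (x e : R) : continuous f -> 0 <= x -> 0 <= e -> x + e <= 1 ->
  mean (fun y => arc_ind x (x + e) y * f y) = mean (fun y => arc_ind 0 e y * f (y + x)).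
Proof.
move=> cf x0 e0 xe; rewrite !mean_arc_indM //; last lra.
have E : derive1 (fun y : R => y + x) = cst 1.
  by apply/funext => y; rewrite derive1E deriveD // derive_id derive_cst addr0.
have := @integration_by_substitution_increasing R (fun y => y + x) f 0 e e0.
rewrite E add0r (addrC e) => h; congr fine; rewrite h.
- by apply: eq_integral => y _ /=; rewrite mulr1.
- by move=> a b _ _ ab; rewrite ltrD2r.
- by move=> y _; exact: cvg_cst.
- exact: is_cvg_cst.
- exact: is_cvg_cst.
- have c y : {for y, continuous (fun y : R => y + x)} by apply: cvgD; [exact: cvg_id|exact: cvg_cst].
  split; [by move=> y _; apply: derivableD|apply: cvg_at_right_filter; exact: c|apply: cvg_at_left_filter; exact: c].
- by apply: continuous_subspaceT => y; exact: cf.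
Qed.

(** * Lower bounds above the critical order *)

(** On the arc [0 <= x <= 1 / (8 K)] the terms of a sum over a window of length [K] point
    in directions that differ by less than a quarter of [pi], so nothing cancels. *)
Lemma arc_lower (R : realType) B (c : nat -> R) (A K x : R) : (forall n, 0 <= c n) ->
  (forall n, c n != 0 -> A <= n%:R <= A + K) -> 0 <= x -> 8 * (K * x) <= 1 ->
  2^-1 * \sum_(0 <= n < B) c n <= nc (trigpoly B c x).
Proof.
move=> c0 supp x0 xK; have p0 := pi_gt0 R.
have -> : nc (trigpoly B c x) = nc (trigpoly B c x * expe (- (A * x))).
  by rewrite Normc.normcM normc_expe mulr1.
apply: le_trans (re_le_normc _).
have -> : complex.Re (trigpoly B c x * expe (- (A * x))) = \sum_(0 <= n < B) c n * cos (2 * pi * ((n%:R - A) * x)).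
  rewrite /trigpoly mulr_suml; elim/big_rec2: _ => // n y z _ <-.
  rewrite -mulrA -expeD (_ : n%:R * x + - (A * x) = (n%:R - A) * x); last by ring.
  by case: z => a b /=; rewrite mul0r subr0.
rewrite mulr_sumr; apply: ler_sum => n _; rewrite mulrC.
have [->|cn] := eqVneq (c n) 0; first by rewrite !mul0r.
apply: ler_wpM2l; [exact: c0|apply: cos_ge_half].
have /andP[h1 h2] := supp n cn.
have g0 : 0 <= (n%:R - A) * x by rewrite mulr_ge0 // subr_ge0.
have g1 : (n%:R - A) * x <= K * x by rewrite ler_wpM2r //; lra.
have g2 : 8 * ((n%:R - A) * x) <= 1 by lra.
move: g0 g2; move: ((n%:R - A) * x) => t t0 t1; apply/andP; split; first by rewrite !mulr_ge0 // ltW.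
by have := ler_wpM2l (ltW p0) t1; lra.
Qed.

Lemma expsum_arc_lower (R : realType) (N K x : R) k : 0 <= K <= N -> 0 <= x -> 8 * (K * x) <= 1 ->
  2^-1 * \sum_(0 <= n < (Num.truncn N).+1) kfree_coef N K k n <= nc (expsum k N K x).
Proof.
move=> /andP[K0 KN] x0 xK; rewrite (expsumE K x k (le_trans K0 KN) (leqnn _)).
apply: (@arc_lower _ _ _ (N - K) K) => // n; first exact: kfree_coef_ge0.
rewrite /kfree_coef /win; case: (boolP (_ && _)) => [/andP[h1 h2] _|_]; last by rewrite mul0r eqxx.
by apply/andP; split; [exact: ltW|rewrite subrK].
Qed.

Theorem moment_lower_large (R : realType) k (s theta c : R) : (2 <= k)%N -> 1 + k%:R^-1 < s ->
  delta R k < theta -> 0 < c ->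
  exists2 C : R, 0 < C & exists2 N0 : R, 1 <= N0 &
   forall N K, N0 <= N -> 1 <= K -> K <= N -> c * N `^ theta <= K ->
   C * moment_order k s K <= mean (fun x => nc (expsum k N K x) `^ s).
Proof.
move=> k2 sk th c0; have t0 := lt_trans (@delta_gt0 R k k2) th.
have /andP[ik0 ik1] := @inv_nat_lt1 R k k2; have s1 : 1 < s by lra.
have [N0 N01 H] := @kfree_count R k theta c k2 th t0 c0.
exists (48^-1 `^ s / 8); first by rewrite divr_gt0 // powR_gt0 // invr_gt0.
exists N0 => // N K hN K1 KN hK; have K0 : 0 < K by lra.
have KN' : 0 <= K <= N by rewrite (ltW K0) KN.
have := H N K _ hN K1 KN hK (leqnn _) => hS.
rewrite /moment_order ltNge (ltW sk) /=.
have e1 : 0 < (8 * K)^-1 <= 1 by rewrite invr_gt0 invf_le1; lra.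
have /andP[e0 e1'] := e1.
have -> : 48^-1 `^ s / 8 * K `^ (s - 1) = mean (fun x => (K / 48) `^ s * arc_ind 0 (8 * K)^-1 x).
  rewrite meanZ; last exact: bmeas_arc_ind.
  rewrite mean_arc_ind //; last exact: ltW.
  rewrite powRM ?invr_ge0 ?(ltW K0) // subr0 powRB; last by rewrite gt_eqF.
  by rewrite powRr1 ?(ltW K0) //; field; rewrite gt_eqF.
apply: mean_le.
- by apply: bmeasM; [exact: bmeas_cst|exact: bmeas_arc_ind].
- by apply: bmeas_powR; [lra|move=> x; exact: normc_ge0|exact: bmeas_expsum].
move=> x /andP[x0 x1]; rewrite /arc_ind; case: ifP => [/andP[_ xK]|_]; last by rewrite mulr0 powR_ge0.
rewrite mulr1; apply: le_powR2; [lra|lra|].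
apply: le_trans (expsum_arc_lower k KN' x0 _); first lra.
have E : K * (8 * K)^-1 = 8^-1 by field; rewrite gt_eqF.
by have := ler_wpM2l (ltW K0) xK; rewrite E; lra.
Qed.

(** * Roots of unity *)

Lemma sin_le_id (R : realType) (x : R) : 0 <= x -> sin x <= x.
Proof.
move=> x0.
have d y : y \in `]0, x[%R -> is_derive y (1 : R) sin (cos y) by move=> _; exact: is_derive_sin.
have [c _] := MVT_segment x0 d (continuous_subspaceT (fun y => @continuous_sin R y)).
by rewrite sin0 !subr0 => ->; rewrite ler_piMl // cos_le1.
Qed.

Lemma expe_near1 (R : realType) (t : R) : 0 <= t -> t <= 2^-1 -> nc (1 - expe t) <= 8 * t.
Proof.
move=> t0 t1; have p0 := pi_gt0 R.
have p4 : pi <= 4 :> R by have [/andP[_ h] _] := @pihalf_02_cos_pihalf R; lra.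
have s0 : 0 <= sin (pi * t) by apply: sin_ge0_pi; rewrite mulr_ge0 ?(ltW p0) //= ler_piMr ?(ltW p0) //; lra.
have E : nc (1 - expe t) ^+ 2 = (2 * sin (pi * t)) ^+ 2.
  rewrite sqr_normcE /Defs.expe /= add0r sqrrN.
  have -> : 2 * pi * t = (pi * t) *+ 2 by rewrite mulr2n; ring.
  have h := cos2Dsin2 (pi * t); rewrite sin_mulr2n cos_mulr2n.
  have -> : cos (pi * t) ^+ 2 = 1 - sin (pi * t) ^+ 2 by rewrite -h addrK.
  have e2 : (cos (pi * t) * sin (pi * t) *+ 2) ^+ 2 = 4 * (cos (pi * t) ^+ 2 * sin (pi * t) ^+ 2) by ring.
  by rewrite e2 -[cos (pi * t) ^+ 2](addrK (sin (pi * t) ^+ 2)) h; ring.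
have -> : nc (1 - expe t) = 2 * sin (pi * t).
  by apply/eqP; rewrite -(@eqrXn2 _ 2) // ?normc_ge0 ?mulr_ge0 // E.
have h := sin_le_id (mulr_ge0 (ltW p0) t0).
by have := ler_wpM2r t0 p4; lra.
Qed.

(** Orthogonality of the additive characters modulo [m]. *)
Lemma sum_roots_of_unity (R : realType) (m n : nat) : (0 < m)%N ->
  \sum_(0 <= b < m) expe (n%:R * (b%:R / m%:R) : R) = (m * (m %| n))%N%:R.
Proof.
move=> m0; have mr : m%:R != 0 :> R by rewrite pnatr_eq0 -lt0n.
case: (boolP (m %| n)%N) => [/dvdnP[c ->]|nd].
  rewrite muln1 (eq_bigr (fun=> 1)); first by rewrite big_const_nat subn0 iter_addr_0.
  move=> b _; rewrite natrM (_ : c%:R * m%:R * (b%:R / m%:R) = (c * b)%N%:R :> R) ?expe_nat //.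
  by rewrite natrM; field.
pose z := expe (n%:R / m%:R : R).
have -> : \sum_(0 <= b < m) expe (n%:R * (b%:R / m%:R) : R) = \sum_(b < m) z ^+ b.
  rewrite big_mkord; apply: eq_bigr => b _; rewrite /z -expeMn; congr expe; ring.
have zm : z ^+ m = 1 by rewrite /z -expeMn (_ : m%:R * (n%:R / m%:R) = n%:R) ?expe_nat //; field.
have z1 : z != 1.
  apply/eqP => h.
  have h2 : expe ((n %% m)%N%:R / m%:R : R) = 1.
    rewrite -h /z [in RHS](divn_eq n m) natrD natrM mulrDl mulfK // expeD expe_nat mul1r //.
  have r0 : (0 < n %% m)%N by rewrite lt0n.
  have rm : (n %% m < m)%N by rewrite ltn_mod.
  move: h2; rewrite /Defs.expe => /(congr1 (@complex.Re R)) /=.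
  set y := (n %% m)%N%:R / m%:R.
  have y0 : 0 < y by rewrite divr_gt0 // ltr0n.
  have y1 : y < 1 by rewrite ltr_pdivrMr ?ltr0n // mul1r ltr_nat.
  have p0 := pi_gt0 R.
  have s0 : 0 < sin (pi * y) by apply: sin_gt0_pi; rewrite mulr_gt0 //= gtr_pMr.
  have -> : 2 * pi * y = (pi * y) *+ 2 by rewrite mulr2n; ring.
  by rewrite cos_mulr2n; have := cos2Dsin2 (pi * y); nra.
have := subrX1 z m; rewrite zm subrr => /esym/eqP; rewrite mulf_eq0 subr_eq0 (negbTE z1) /=.
by move=> /eqP ->; rewrite muln0.
Qed.

Lemma sum_dvd_reindex (V : zmodType) (m M : nat) (F : nat -> V) : (0 < m)%N ->
  \sum_(0 <= a < M * m) F a *+ (m %| a)%N = \sum_(0 <= b < M) F (b * m)%N.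
Proof.
move=> m0; rewrite big_nat_mul; apply: eq_bigr => b _.
case: m m0 => // m _; rewrite mulSn [RHS]/= big_ltn; last by rewrite -[X in (X < _)%N]add0n ltn_add2r.
rewrite dvdn_mull // mulr1n big_nat big1 ?Monoid.mulm1 // => i /andP[h1 h2].
case: (boolP (m.+1 %| i)%N) => // /dvdnP[j E]; exfalso; move: h1 h2; rewrite E -mulSn !ltn_pmul2r //.
by rewrite ltnS; move=> h1 h2; have := leq_trans h1 h2; rewrite ltnn.
Qed.

Lemma trigpoly_average (R : realType) B (c : nat -> R) (m : nat) (x : R) : (0 < m)%N ->
  \sum_(0 <= b < m) trigpoly B c (x + b%:R / m%:R) = trigpoly B (fun n => (m * (m %| n))%N%:R * c n) x.
Proof.
move=> m0; rewrite /trigpoly exchange_big /=; apply: eq_bigr => n _.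
rewrite rmorphM /= rmorph_nat -(sum_roots_of_unity R n m0) mulr_suml mulr_suml; apply: eq_bigr => b _.
by rewrite mulrDr expeD; ring.
Qed.

(** * Averages over primitive fractions *)

Lemma trigpoly_sum_seq (R : realType) (B : nat) (r : seq nat) (m : nat -> R) (w : nat -> nat -> R) x :
  \sum_(d <- r) real_complex R (m d) * trigpoly B (w d) x =
  trigpoly B (fun n => \sum_(d <- r) m d * w d n) x.
Proof.
under eq_bigr do rewrite /trigpoly mulr_sumr; rewrite exchange_big /=; apply: eq_bigr => n _.
by rewrite rmorph_sum /= mulr_suml; apply: eq_bigr => d _; rewrite rmorphM mulrA.
Qed.

Lemma sum_floor_multiple (V : zmodType) (m M : nat) (F : nat -> V) : (0 < m)%N ->
  \sum_(0 <= n < M * m) F (n %/ m * m)%N = \sum_(0 <= n < M * m) F n *+ m *+ (m %| n)%N.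
Proof.
move=> m0; rewrite sum_dvd_reindex // big_nat_mul; apply: eq_bigr => j _.
rewrite (eq_big_nat _ _ (F2 := fun=> F (j * m)%N)).
  by rewrite sumr_const_nat mulSn addnK.
move=> i /andP[h1 h2]; congr (F (_ * m)%N); apply/eqP.
by rewrite eqn_leq leq_divRL // h1 andbT -ltnS ltn_divLR.
Qed.

(** The numerators [a] for which [a / q ^ k] is in lowest terms in the sense of [k]th powers. *)
Definition prim (k q a : nat) : bool := all (fun e => (e ^ k %| a)%N ==> (e == 1%N)) (divisors q).

(** Cohen's generalisation of the Ramanujan sum. *)
Definition cohen_sum (R : realType) (k q n : nat) : R :=
  \sum_(e <- divisors q) moebius R e * ((q %/ e) ^ k * ((q %/ e) ^ k %| n))%N%:R.

(** The Moebius function detects the primitive [a], and orthogonality evaluates the sum over all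
    [a] that are divisible by [e ^ k]. *)
Lemma prim_average (R : realType) B (c : nat -> R) k q (x : R) : (0 < q)%N ->
  \sum_(0 <= a < q ^ k) real_complex R (prim k q a)%:R * trigpoly B c (x + a%:R / (q ^ k)%:R) =
  trigpoly B (fun n => cohen_sum R k q n * c n) x.
Proof.
move=> q0.
transitivity (\sum_(e <- divisors q) real_complex R (moebius R e) *
   trigpoly B (fun n => ((q %/ e) ^ k * ((q %/ e) ^ k %| n))%N%:R * c n) x); last first.
  rewrite trigpoly_sum_seq; apply: eq_trigpoly => n _; rewrite /cohen_sum mulr_suml.
  by apply: eq_bigr => e _; rewrite mulrA.
transitivity (\sum_(0 <= a < q ^ k) \sum_(e <- divisors q) real_complex R (moebius R e) *
    (trigpoly B c (x + a%:R / (q ^ k)%:R) *+ (e ^ k %| a)%N)).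
  apply: eq_bigr => a _; rewrite /prim -sum_moebius_kpow // rmorph_sum mulr_suml; apply: eq_bigr => e _.
  by rewrite rmorphM /= rmorph_nat -!mulrA -[X in _ = _ * X]mulr_natl.
rewrite exchange_big /=; apply: eq_big_seq => e; rewrite -dvdn_divisors // => eq.
have e0 := dvdn_gt0 q0 eq; have ek0 : (0 < e ^ k)%N by rewrite expn_gt0 e0.
have r0 : (0 < q %/ e)%N by rewrite divn_gt0 // dvdn_leq.
have rk0 : (0 < (q %/ e) ^ k)%N by rewrite expn_gt0 r0.
rewrite -mulr_sumr; congr (_ * _).
have Eq : (q ^ k = (q %/ e) ^ k * e ^ k)%N by rewrite -expnMn divnK.
rewrite {1}Eq sum_dvd_reindex // -trigpoly_average //; apply: eq_bigr => b _; congr (trigpoly _ _ (_ + _)).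
by rewrite Eq !natrM; field; rewrite !pnatr_eq0 -!lt0n rk0 ek0.
Qed.

(** A [k]-free integer is divisible by no [k]th power except 1, so only [e = q] contributes. *)
Lemma cohen_sum_kfree (R : realType) k q n : (0 < k)%N -> (0 < q)%N -> kfree k n ->
  cohen_sum R k q n = moebius R q.
Proof.
move=> k0 q0 fr; rewrite /cohen_sum (@sum_divisors_only _ _ _ q) //.
  by rewrite divnn q0 exp1n dvd1n mulr1.
move=> e eq ne; have e0 := dvdn_gt0 q0 eq.
case: (boolP ((q %/ e) ^ k %| n)%N) => [h|_]; last by rewrite muln0 mulr0.
have r1 : (1 < q %/ e)%N.
  rewrite ltn_neqAle divn_gt0 // dvdn_leq // andbT eq_sym; apply: contra ne => /eqP E.
  by rewrite -(divnK eq) E mul1n.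
have /negP[] := fr _ (pdiv_prime r1); apply: dvdn_trans h.
by apply: dvdn_exp2r; exact: pdiv_dvd.
Qed.

(** The sum over the multiples of [m] in the window imitates [1 / m] times the full sum near
    [0].  Replace each [n] by the multiple of [m] just below it: the phase turns by at most
    [8 m x], and the condition to lie in the window changes for at most [2 m] integers.  For
    [m > K] both sums are trivially [O(m)]. *)
Lemma win_multiples_near (R : realType) (N K x : R) B m : (0 < m)%N -> 1 <= K -> K <= N -> 0 <= x ->
  8 * (K * x) <= 1 -> ((Num.truncn N).+1 <= B)%N ->
  nc (trigpoly B (fun n => (m * (m %| n))%N%:R * (win N K n)%:R) x - trigpoly B (fun n => (win N K n)%:R) x) <= 4 * m%:R.
Proof.
move=> m0 K1 KN x0 xK hB; have mr0 : 0 < m%:R :> R by rewrite ltr0n.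
have mr1 : 1 <= m%:R :> R by rewrite ler1n.
have KN' : 0 <= K <= N by rewrite KN andbT; lra.
have N0 : 0 <= N by lra.
have wB n : (B <= n)%N -> (win N K n) = false.
  move=> hn; rewrite /win [n%:R <= N]leNgt (_ : N < n%:R) ?andbF //.
  by apply: lt_le_trans (truncnS_gt _) _; rewrite ler_nat (leq_trans hB).
have cnt : m%:R * (count (fun n => win N K n && (m %| n)%N) (iota 0 B))%:R <= K + m%:R.
  have := ler_wpM2l (ltW mr0) (count_win_multiples B KN' m0).
  by rewrite mulrDr mulr1 mulrCA mulfV ?gt_eqF // mulr1.
have sumE (P : pred nat) (f : R) : \sum_(0 <= n < B) f * (P n)%:R = f * (count P (iota 0 B))%:R.
  by rewrite -mulr_sumr sum_count.
have [mK|Km] := leP (m%:R : R) K; last first.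
  apply: le_trans (normcD_le _ _) _; rewrite nc_opp.
  have h1 : nc (trigpoly B (fun n => (m * (m %| n))%N%:R * (win N K n)%:R) x) <= K + m%:R.
    apply: le_trans cnt; rewrite -sumE; apply: le_trans (normc_sum_le _ _ _) _; apply: ler_sum => n _.
    rewrite Normc.normcM normc_expe mulr1 normcR ger0_norm ?mulr_ge0 ?ler0n //.
    by rewrite natrM -mulrA -natrM mulnb andbC.
  have h2 : nc (trigpoly B (fun n => (win N K n)%:R) x) <= K + 1.
    apply: le_trans (count_win_le B KN'); rewrite -sum_count; apply: le_trans (normc_sum_le _ _ _) _.
    by apply: ler_sum => n _; rewrite Normc.normcM normc_expe mulr1 normcR ger0_norm ?ler0n.
  lra.
pose fl n := (n %/ m * m)%N.
have BM : (B <= B * m)%N by rewrite leq_pmulr.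
rewrite (@trigpoly_widen _ _ _ (fun n => (win N K n)%:R) _ BM); last by move=> n /wB ->.
have -> : trigpoly B (fun n => (m * (m %| n))%N%:R * (win N K n)%:R) x =
    \sum_(0 <= n < B * m) real_complex R (win N K (fl n))%:R * expe ((fl n)%:R * x).
  rewrite (@trigpoly_widen _ _ _ _ _ BM); last by move=> n /wB ->; rewrite mulr0.
  rewrite (sum_floor_multiple B (fun n => real_complex R (win N K n)%:R * expe (n%:R * x)) m0).
  apply: eq_bigr => n _; rewrite natrM !rmorphM /= !rmorph_nat -!mulrA.
  by rewrite !mulr_natl mulrnAC.
rewrite /trigpoly -sumrB; apply: le_trans (normc_sum_le _ _ _) _.
pose jump (t : R) n : bool := ((fl n)%:R <= t) && (t < n%:R).
have fln n : (fl n <= n)%N by exact: leq_trunc_div.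
have nfl n : (n < fl n + m)%N by rewrite {1}(divn_eq n m) ltn_add2l ltn_mod.
have step n : nc (real_complex R (win N K (fl n))%:R * expe ((fl n)%:R * x) -
     real_complex R (win N K n)%:R * expe (n%:R * x)) <=
     (win N K (fl n))%:R * (8 * (m%:R * x)) + ((jump (N - K) n)%:R + (jump N n)%:R).
  have fr : (fl n)%:R <= n%:R :> R by rewrite ler_nat.
  have -> : real_complex R (win N K (fl n))%:R * expe ((fl n)%:R * x) -
     real_complex R (win N K n)%:R * expe (n%:R * x) =
     real_complex R (win N K (fl n))%:R * (expe ((fl n)%:R * x) * (1 - expe ((n%:R - (fl n)%:R) * x))) +
     real_complex R ((win N K (fl n))%:R - (win N K n)%:R) * expe (n%:R * x).
    rewrite mulrBr mulr1 -expeD (_ : (fl n)%:R * x + (n%:R - (fl n)%:R) * x = n%:R * x); last by ring.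
    rewrite rmorphB /=; ring.
  apply: le_trans (normcD_le _ _) _; rewrite !Normc.normcM !normc_expe mulr1 mul1r !normcR; apply: lerD.
    rewrite ger0_norm ?ler0n // ler_wpM2l ?ler0n //.
    have d0 : 0 <= (n%:R - (fl n)%:R : R) by rewrite subr_ge0.
    have dm : (n%:R - (fl n)%:R : R) <= m%:R by rewrite lerBlDl -natrD ler_nat ltnW.
    have dx : (n%:R - (fl n)%:R) * x <= m%:R * x by rewrite ler_wpM2r.
    have mx : m%:R * x <= K * x by rewrite ler_wpM2r.
    apply: le_trans (expe_near1 _ _) _; [by rewrite mulr_ge0|lra|lra].
  rewrite /win /jump; have [a|a] := ltP (N - K) (fl n)%:R.
    rewrite (lt_le_trans a fr) /=; have [b|b] := leP n%:R N.
      by rewrite (le_trans fr b) subrr normr0 addr_ge0.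
    by rewrite subr0 normr_nat; case: ((fl n)%:R <= N); rewrite ?andbT ?andbF ?addr0 ?add0r /= ?ler0n.
  rewrite sub0r normrN normr_nat; case: (N - K < n%:R); rewrite /= ?addr_ge0 //.
  by case: (n%:R <= N); rewrite ?addr_ge0 // lerDl.
apply: (@le_trans _ _ (\sum_(0 <= n < B * m) ((win N K (fl n))%:R * (8 * (m%:R * x)) + ((jump (N - K) n)%:R + (jump N n)%:R)))).
  by apply: ler_sum => n _; exact: step.
rewrite !big_split /= -mulr_suml !sum_count.
have jc t : (count (jump t) (iota 0 (B * m)))%:R <= m%:R :> R.
  have := @count_diam R (jump t) (B * m) (m%:R - 1); rewrite (_ : 1 + (m%:R - 1) = m%:R :> R); last by ring.
  apply; first lra.
  move=> a b /andP[_ a2] /andP[b1 _] ab; rewrite lerBrDr natr1 ler_nat.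
  have : (fl b)%:R < a%:R :> R by exact: le_lt_trans a2.
  by rewrite ltr_nat => h; move: (nfl b) h; move: (fl b) => f h1 h2; clear -h1 h2 ab; lia.
have cw : (count (fun n => win N K (fl n)) (iota 0 (B * m)))%:R <= K + m%:R.
  apply: le_trans cnt; rewrite -sum_count (sum_floor_multiple B (fun n => (win N K n)%:R) m0) -sumE.
  rewrite (@big_cat_nat _ _ _ B) //= [X in _ + X <= _]big_nat [X in _ + X <= _]big1 ?addr0.
    apply: ler_sum => n _; case: (win N K n); rewrite ?mul0rn ?mulr0 //=.
    by case: (m %| n)%N; rewrite ?mulr0 ?mulr1 ?mulr1n ?mulr0n.
  by move=> n /andP[/wB -> _]; rewrite !mul0rn.
have h1 := jc (N - K); have h2 := jc N.
have h3 := ler_wpM2r (mulr_ge0 (ler0n R 8) (mulr_ge0 (ltW mr0) x0)) cw.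
have h4 : (K + m%:R) * (8 * (m%:R * x)) <= 2 * m%:R.
  apply: (@le_trans _ _ ((K + K) * (8 * (m%:R * x)))); first by rewrite ler_wpM2r ?lerD2l // !mulr_ge0 // ltW.
  have -> : (K + K) * (8 * (m%:R * x)) = 2 * m%:R * (8 * (K * x)) by ring.
  by rewrite ler_piMr // mulr_ge0 // ltW.
lra.
Qed.

Lemma codivisor_gt0 e q : (0 < q)%N -> (e %| q)%N -> (0 < q %/ e)%N.
Proof. by move=> q0 eq; rewrite divn_gt0 ?(dvdn_gt0 q0 eq) //; exact: dvdn_leq. Qed.

Lemma sum_codivisors_pow (R : realType) k q : (2 <= k)%N -> (0 < q)%N ->
  \sum_(e <- divisors q) ((q %/ e) ^ k)%:R <= 2 * (q ^ k)%:R :> R.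
Proof.
move=> k2 q0.
apply: (@le_trans _ _ (\sum_(e <- divisors q) (q ^ k)%:R * (e%:R : R) ^- 2)).
  rewrite !big_seq; apply: ler_sum => e; rewrite -dvdn_divisors // => eq; have e0 := dvdn_gt0 q0 eq.
  have er0 : 0 < e%:R :> R by rewrite ltr0n.
  rewrite ler_pdivlMr ?exprn_gt0 // -natrX -natrM ler_nat -[X in (_ <= X ^ _)%N](divnK eq) expnMn.
  have r0 := codivisor_gt0 q0 eq.
  by rewrite leq_pmul2l; [exact: leq_pexp2l|rewrite expn_gt0 r0].
rewrite -mulr_sumr mulrC ler_wpM2r ?ler0n //.
apply: (@le_trans _ _ (\sum_(e <- index_iota 1 q.+1) (e%:R : R) ^- 2)).
  apply: sum_sub_uniq => [|||e]; [exact: divisors_uniq|exact: iota_uniq| |by rewrite invr_ge0 exprn_ge0].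
  move=> e; rewrite -dvdn_divisors // mem_index_iota => eq.
  by rewrite (dvdn_gt0 q0 eq) ltnS dvdn_leq.
by apply: le_trans (sum_inv_sq_le _ q0) _; rewrite lerBlDr lerDl invr_ge0.
Qed.

Lemma dvdn_lcm_pow k d r n : (((lcmn d r) ^ k %| n) = (d ^ k %| n) && (r ^ k %| n))%N.
Proof.
apply/idP/andP => [h|[]]; last exact: lcm_pow_dvd.
by split; apply: dvdn_trans h; apply: dvdn_exp2r; rewrite ?dvdn_lcml ?dvdn_lcmr.
Qed.

(** One term of the main part nearly disappears after averaging over primitive translates: each
    sum over multiples is replaced by the full sum up to an error, and the coefficients of
    the full sum add up to zero. *)
Lemma cohen_multiples (R : realType) (N K x : R) B k q d : (2 <= k)%N -> (0 < d < q)%N ->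
  1 <= K -> K <= N -> 0 <= x -> 8 * (K * x) <= 1 -> ((Num.truncn N).+1 <= B)%N ->
  nc (trigpoly B (fun n => cohen_sum R k q n * ((win N K n)%:R * (d ^ k %| n)%N%:R)) x) <= 8 * (q ^ k)%:R.
Proof.
move=> k2 /andP[d0 dq] K1 KN x0 xK hB; have q0 : (0 < q)%N by apply: leq_ltn_trans dq.
have dk0 : 0 < (d ^ k)%:R :> R by rewrite ltr0n expn_gt0 d0.
pose m e := (lcmn d (q %/ e) ^ k)%N; pose G e := (gcdn d (q %/ e) ^ k)%N.
have m0 e : (e %| q)%N -> (0 < m e)%N.
  by move=> eq; rewrite expn_gt0 lcmn_gt0 d0 (codivisor_gt0 q0 eq).
have mG e : (G e)%:R / (d ^ k)%:R * (m e)%:R = ((q %/ e) ^ k)%:R :> R.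
  have E : (G e * m e = d ^ k * (q %/ e) ^ k)%N by rewrite mulnC /m /G -!expnMn muln_lcm_gcd.
  by rewrite mulrAC -natrM E natrM mulrAC mulfV ?gt_eqF // mul1r.
have nd : ~~ (q %| d)%N by rewrite gtnNdvd.
pose A M := trigpoly B (fun n => (M * (M %| n))%N%:R * (win N K n)%:R) x.
pose A1 := trigpoly B (fun n => (win N K n)%:R) x.
have -> : trigpoly B (fun n => cohen_sum R k q n * ((win N K n)%:R * (d ^ k %| n)%N%:R)) x =
    \sum_(e <- divisors q) real_complex R (moebius R e * ((G e)%:R / (d ^ k)%:R)) * (A (m e) - A1).
  under [RHS]eq_bigr do rewrite mulrBr; rewrite sumrB -mulr_suml -rmorph_sum /=.
  under [X in _ - real_complex R X * _]eq_bigr do rewrite mulrA.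
  rewrite -mulr_suml sum_moebius_gcd // mul0r rmorph0 mul0r subr0 trigpoly_sum_seq.
  apply: eq_trigpoly => n _; rewrite /cohen_sum mulr_suml; apply: eq_bigr => e _.
  rewrite /m natrM dvdn_lcm_pow -mG natrM -mulnb natrM; ring.
apply: le_trans (normc_sum_le _ _ _) _.
apply: (@le_trans _ _ (\sum_(e <- divisors q) 4 * ((q %/ e) ^ k)%:R)); last first.
  by rewrite -mulr_sumr; have := sum_codivisors_pow R k2 q0; lra.
rewrite !big_seq; apply: ler_sum => e; rewrite -dvdn_divisors // => eq.
have g0 : 0 <= (G e)%:R / (d ^ k)%:R :> R by rewrite divr_ge0.
rewrite Normc.normcM normcR normrM -mG (ger0_norm g0).
apply: (@le_trans _ _ (1 * ((G e)%:R / (d ^ k)%:R) * (4 * (m e)%:R))); last by rewrite le_eqVlt; apply/orP; left; apply/eqP; ring.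
apply: ler_pM; [by rewrite mulr_ge0|exact: normc_ge0| |].
  by rewrite ler_wpM2r // normr_moebius_le1.
by rewrite /A /A1; apply: win_multiples_near => //; exact: m0.
Qed.

Lemma main_sum_prim_average (R : realType) (N K x : R) B k q Z : (2 <= k)%N -> (Z < q)%N ->
  1 <= K -> K <= N -> 0 <= x -> 8 * (K * x) <= 1 -> ((Num.truncn N).+1 <= B)%N ->
  nc (trigpoly B (fun n => cohen_sum R k q n * main_coef N K k Z n) x) <= Z%:R * (8 * (q ^ k)%:R).
Proof.
move=> k2 Zq K1 KN x0 xK hB.
have -> : trigpoly B (fun n => cohen_sum R k q n * main_coef N K k Z n) x = \sum_(0 <= d < Z.+1) real_complex R (moebius R d) *
    trigpoly B (fun n => cohen_sum R k q n * ((win N K n)%:R * (d ^ k %| n)%N%:R)) x.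
  rewrite trigpoly_sum; apply: eq_trigpoly => n _; rewrite /main_coef !mulr_sumr; apply: eq_bigr => d _; ring.
rewrite big_ltn // moebius0 mul0r add0r; apply: le_trans (normc_sum_le _ _ _) _.
apply: (@le_trans _ _ (\sum_(1 <= d < Z.+1) 8 * (q ^ k)%:R)); last first.
  by rewrite sumr_const_nat subn1 -[X in X <= _]mulr_natl.
rewrite big_nat [X in _ <= X]big_nat; apply: ler_sum => d /andP[d0 dZ].
rewrite Normc.normcM normcR -[X in _ <= X]mul1r; apply: ler_pM; [by []|exact: normc_ge0|exact: normr_moebius_le1|].
by apply: cohen_multiples => //; rewrite d0 (leq_ltn_trans _ Zq).
Qed.

(** Averaging over the primitive translates multiplies the exponential sum by a sign and almost
    kills its main part, so the remainder is large somewhere on these translates. *)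
Lemma rest_on_prim (R : realType) (N K x : R) k q Z : (2 <= k)%N -> (Z < q)%N -> sqfree q ->
  (Z <= Num.truncn N)%N -> 1 <= K -> K <= N -> 0 <= x -> 8 * (K * x) <= 1 ->
  nc (expsum k N K x) - 8 * Z%:R * (q ^ k)%:R <=
  \sum_(0 <= a < q ^ k) (prim k q a)%:R * nc (trigpoly (cutoff N K) (rem_coef N K k Z) (x + a%:R / (q ^ k)%:R)).
Proof.
move=> k2 Zq sq ZN K1 KN x0 xK; have k0 : (0 < k)%N by apply: leq_trans k2.
have q0 : (0 < q)%N by apply: leq_ltn_trans Zq.
have KN' : 0 <= K <= N by rewrite KN andbT; lra.
have N0 : 0 <= N by lra.
have hB := cutoff_ge N K; set B := cutoff N K in hB *.
have -> : \sum_(0 <= a < q ^ k) (prim k q a)%:R * nc (trigpoly B (rem_coef N K k Z) (x + a%:R / (q ^ k)%:R)) =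
   \sum_(0 <= a < q ^ k) nc (real_complex R (prim k q a)%:R * trigpoly B (rem_coef N K k Z) (x + a%:R / (q ^ k)%:R)).
  by apply: eq_bigr => a _; rewrite Normc.normcM normcR ger0_norm ?ler0n.
apply: le_trans (normc_sum_le _ _ _); rewrite prim_average //.
have E : trigpoly B (fun n => cohen_sum R k q n * kfree_coef N K k n) x = real_complex R (moebius R q) * expsum k N K x.
  rewrite (expsumE K x k N0 hB) /trigpoly mulr_sumr; apply: eq_bigr => n _; rewrite mulrA -rmorphM.
  congr (real_complex R _ * _); rewrite /kfree_coef /mu indicE.
  case: (boolP (n \in kfree k)) => [|_]; last by rewrite !mulr0.
  by rewrite inE => fr; rewrite cohen_sum_kfree.
have E2 : expsum k N K x = real_complex R (moebius R q) *
   (trigpoly B (fun n => cohen_sum R k q n * main_coef N K k Z n) x + trigpoly B (fun n => cohen_sum R k q n * rem_coef N K k Z n) x).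
  rewrite -trigpolyD (_ : trigpoly B _ x = trigpoly B (fun n => cohen_sum R k q n * kfree_coef N K k n) x); last first.
    by apply: eq_trigpoly => n _; rewrite -mulrDr -(kfree_sub_main_coef n k0 KN' ZN) [in X in _ * X]addrC subrK.
  by rewrite E mulrA -rmorphM /moebius sq -expr2 sqrr_sign rmorph1 mul1r.
have n1 : `|moebius R q| = 1 by rewrite /moebius sq normrX normrN1 expr1n.
rewrite lerBlDl E2 Normc.normcM normcR n1 mul1r; apply: le_trans (normcD_le _ _) _.
rewrite lerD2r; apply: le_trans (main_sum_prim_average k2 Zq K1 KN x0 xK hB) _.
by rewrite le_eqVlt; apply/orP; left; apply/eqP; ring.
Qed.

(** * Spacing of primitive fractions *)

(** Distinct pairs [(q, a)] with [a] primitive give distinct fractions [a / q ^ k]: after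
    division by the greatest common divisor of [q] and [q'] the remaining factors have to
    divide the numerators to the [k]th power. *)
Lemma prim_fraction_inj k q q' a a' : (0 < k)%N -> (0 < q)%N -> (0 < q')%N -> prim k q a -> prim k q' a' ->
  (a * q' ^ k = a' * q ^ k)%N -> q = q' /\ a = a'.
Proof.
move=> k0 q0 q'0 pa pa' E; pose g := gcdn q q'.
have g0 : (0 < g)%N by rewrite gcdn_gt0 q0.
have gk0 : (0 < g ^ k)%N by rewrite expn_gt0 g0.
have Eq : q = (q %/ g * g)%N by rewrite divnK ?dvdn_gcdl.
have Eq' : q' = (q' %/ g * g)%N by rewrite divnK ?dvdn_gcdr.
have cop : coprime (q %/ g) (q' %/ g).
  by rewrite /coprime -(eqn_pmul2r g0) muln_gcdl -Eq -Eq' mul1n.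
have key b b' u v : coprime u v -> (u %| q)%N || (u %| q')%N = true -> (b * v ^ k = b' * u ^ k)%N -> (u ^ k %| b)%N.
  move=> cuv _ E'; rewrite -(@Gauss_dvdl _ _ (v ^ k)); last by rewrite coprimeXl // coprimeXr.
  by rewrite E' dvdn_mull.
have E' : (a * (q' %/ g) ^ k = a' * (q %/ g) ^ k)%N.
  apply/eqP; rewrite -(eqn_pmul2r gk0) -!mulnA -!expnMn -Eq -Eq'; exact/eqP.
have ug : (q %/ g %| q)%N by apply/dvdnP; exists g; rewrite mulnC.
have vg : (q' %/ g %| q')%N by apply/dvdnP; exists g; rewrite mulnC.
have u1 : (q %/ g)%N = 1%N.
  move/allP: pa => /(_ (q %/ g)%N); rewrite -dvdn_divisors // => /(_ ug) /implyP h.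
  by apply/eqP/h; apply: key E' => //; rewrite ug.
have v1 : (q' %/ g)%N = 1%N.
  move/allP: pa' => /(_ (q' %/ g)%N); rewrite -dvdn_divisors // => /(_ vg) /implyP h.
  by apply/eqP/h; apply: key (esym E'); rewrite 1?coprime_sym // vg orbT.
have qq : q = q' by rewrite Eq Eq' u1 v1.
split => //; move: E; rewrite -qq => /eqP; rewrite eqn_pmul2r ?expn_gt0 ?q0 // => /eqP //.
Qed.

Lemma sum_eq_le1 m n r : (\sum_(m <= i < n) (i == r) <= 1)%N.
Proof.
have -> : (\sum_(m <= i < n) (i == r) = \sum_(m <= i < n | i == r) 1)%N.
  by rewrite [RHS]big_mkcond; apply: eq_bigr => i _; case: (i == r).
by rewrite big_nat1_eq; case: ifP.
Qed.

Lemma sum_mod_eq G u r : (0 < u)%N -> (\sum_(0 <= a < G * u) (a %% u == r %% u) <= G)%N.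
Proof.
move=> u0; rewrite big_nat_mul; apply: (@leq_trans (\sum_(0 <= j < G) 1)); last first.
  by rewrite sum_nat_const_nat muln1 subn0.
apply: leq_sum => j _; rewrite -{1}(add0n (j * u)%N) big_addn mulSn addnK.
apply: leq_trans (sum_eq_le1 0 u (r %% u)%N).
rewrite big_nat [X in (_ <= X)%N]big_nat; apply: leq_sum => i /andP[_ iu].
by rewrite addnC modnMDl (modn_small iu).
Qed.

Lemma sum_dvd G T : (0 < G)%N -> (\sum_(1 <= t < T.+1) G * (G %| t) <= T)%N.
Proof.
move=> G0; rewrite -big_distrr /=; have -> : (\sum_(1 <= t < T.+1) (G %| t) = T %/ G)%N.
  elim: T => [|T IH]; first by rewrite big_geq // div0n.
  by rewrite big_nat_recr //= IH addnC -divnS.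
by rewrite mulnC leq_trunc_div.
Qed.

(** Two solutions have values of [a] that are congruent modulo [Q / gcd(Q, Q')]. *)
Lemma sum_fixed_difference Q Q' t : (0 < Q)%N -> (0 < Q')%N ->
  (\sum_(0 <= a < Q) \sum_(0 <= a' < Q') (a * Q' == a' * Q + t) <= gcdn Q Q' * (gcdn Q Q' %| t))%N.
Proof.
move=> Q0 Q'0; set G := gcdn Q Q'; have G0 : (0 < G)%N by rewrite gcdn_gt0 Q0.
have EQ : Q = (G * (Q %/ G))%N by rewrite mulnC divnK ?dvdn_gcdl.
have EQ' : Q' = (G * (Q' %/ G))%N by rewrite mulnC divnK ?dvdn_gcdr.
have cop : coprime (Q %/ G) (Q' %/ G).
  by rewrite /coprime -(eqn_pmul2l G0) muln_gcdr -EQ -EQ' muln1.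
have u0 : (0 < Q %/ G)%N by rewrite divn_gt0 // dvdn_leq // dvdn_gcdl.
case: (boolP (G %| t)%N) => Gt; last first.
  rewrite muln0 leqn0 big1 // => a _; rewrite big1 // => a' _; case: eqP => // E.
  case/negP: Gt; rewrite -(@dvdn_addr (a' * Q)%N) ?dvdn_mull ?dvdn_gcdl //.
  by rewrite -E dvdn_mull ?dvdn_gcdr.
rewrite muln1.
have [a0 Ha0|none] := pickP (fun a : 'I_Q => [exists a' : 'I_Q', a * Q' == a' * Q + t]%N).
  rewrite [X in index_iota 0 X]EQ; apply: leq_trans (sum_mod_eq G a0 u0).
  apply: leq_sum => a _; have [E|ne] := eqVneq (a %% (Q %/ G))%N (a0 %% (Q %/ G))%N.
    apply: leq_trans (sum_eq_le1 0 Q' ((a * Q' - t) %/ Q)%N); apply: leq_sum => a' _.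
    by case: eqP => // E'; rewrite E' addnK mulnK // eqxx.
  rewrite leqn0 big1 // => a' _; case: eqP => // E; case/eqP: ne.
  case/existsP: Ha0 => b /eqP Eb; move: E Eb; move: (nat_of_ord a0) (nat_of_ord b) => c b' E Eb.
  wlog le : a c a' b' E Eb / (c <= a)%N.
    by move=> H; case: (leqP c a) => h; [exact: H E Eb h|apply/esym; exact: H Eb E (ltnW h)].
  apply/eqP; rewrite eqn_mod_dvd // -(@Gauss_dvdl _ _ (Q' %/ G)) // -(dvdn_pmul2l G0) -EQ.
  rewrite mulnCA -EQ' mulnBl E Eb subnDr -mulnBl dvdn_mull //.
rewrite big_nat big1 // => a /andP[_ aQ]; rewrite big_nat big1 // => a' /andP[_ aQ'].
case: eqP => // E; have := none (Ordinal aQ) => /existsP[]; exists (Ordinal aQ'); exact/eqP.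
Qed.

(** Each nonzero value of [a Q' - a' Q] is a multiple of [gcd(Q, Q')] taken at most
    [gcd(Q, Q')] times, so at most [T] pairs have it in [(0, T]]. *)
Lemma count_small_differences Q Q' T : (0 < Q)%N -> (0 < Q')%N ->
  (\sum_(0 <= a < Q) \sum_(0 <= a' < Q') (0 < a * Q' - a' * Q <= T) <= T)%N.
Proof.
move=> Q0 Q'0; have G0 : (0 < gcdn Q Q')%N by rewrite gcdn_gt0 Q0.
apply: leq_trans (sum_dvd T G0).
apply: (@leq_trans (\sum_(1 <= t < T.+1) \sum_(0 <= a < Q) \sum_(0 <= a' < Q') (a * Q' == a' * Q + t))); last first.
  by apply: leq_sum => t _; exact: sum_fixed_difference.
rewrite [X in (_ <= X)%N]exchange_big; apply: leq_sum => a _ /=.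
rewrite [X in (_ <= X)%N]exchange_big; apply: leq_sum => a' _ /=.
case: (boolP (0 < _ <= T)%N) => // /andP[d0 dT].
rewrite (@big_cat_nat _ _ _ (a * Q' - a' * Q)) //=; last exact: leqW.
rewrite [X in (_ + X)%N]big_ltn // subnKC; first by rewrite eqxx addnCA leq_addr.
by rewrite ltnW // -subn_gt0.
Qed.

Lemma close_pairs (R : realType) Q Q' (e : R) : (0 < Q)%N -> (0 < Q')%N -> 0 <= e ->
  \sum_(0 <= a < Q) \sum_(0 <= a' < Q')
     ((a * Q' != a' * Q)%N && (`|a%:R / Q%:R - a'%:R / Q'%:R| <= e))%:R <= 2 * (e * (Q * Q')%:R).
Proof.
move=> Q0 Q'0 e0; pose T := Num.truncn (e * (Q * Q')%:R).
have Qr : 0 < Q%:R :> R by rewrite ltr0n.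
have Q'r : 0 < Q'%:R :> R by rewrite ltr0n.
have T1 : T%:R <= e * (Q * Q')%:R by rewrite truncn_le // mulr_ge0.
have TR (x y : nat) : (x < y)%N -> `|x%:R - y%:R| <= e * (Q * Q')%:R -> (0 < y - x <= T)%N.
  move=> xy c2; rewrite subn_gt0 xy /T truncn_ge_nat ?mulr_ge0 // natrB ?(ltnW xy) //.
  by apply: le_trans c2; rewrite distrC ler_norm.
pose cl (a a' : nat) : bool := `|a%:R / Q%:R - a'%:R / Q'%:R| <= e.
have ineq a a' : ((a * Q' != a' * Q) && cl a a' <=
    (0 < a * Q' - a' * Q <= T) + (0 < a' * Q - a * Q' <= T))%N.
  case: (boolP (_ && _)) => // /andP[ne c1].
  have c2 : `|(a * Q')%:R - (a' * Q)%:R| <= e * (Q * Q')%:R.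
    have -> : (a * Q')%:R - (a' * Q)%:R = (a%:R / Q%:R - a'%:R / Q'%:R) * (Q * Q')%:R :> R.
      by rewrite !natrM; field; rewrite !gt_eqF.
    by rewrite normrM [X in _ * X]ger0_norm ?ler0n // ler_wpM2r.
  move: ne c2; move: (a * Q')%N (a' * Q)%N => x y; rewrite neq_ltn => /orP[] xy c2.
    by rewrite (TR _ _ xy c2) addn1.
  by rewrite distrC in c2; rewrite (TR _ _ xy c2) add1n.
apply: (@le_trans _ _ (T + T)%:R); last by rewrite natrD; lra.
rewrite (eq_bigr (fun a => (\sum_(0 <= a' < Q') ((a * Q' != a' * Q) && cl a a'))%N%:R)); last first.
  by move=> a _; rewrite natr_sum.
rewrite -natr_sum ler_nat.
apply: (@leq_trans (\sum_(0 <= a < Q) \sum_(0 <= a' < Q') ((0 < a * Q' - a' * Q <= T) + (0 < a' * Q - a * Q' <= T)))).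
  by apply: leq_sum => a _; apply: leq_sum => a' _; exact: ineq.
under eq_bigr do rewrite big_split /=; rewrite big_split /=; apply: leq_add; first exact: count_small_differences.
by rewrite exchange_big; exact: count_small_differences.
Qed.

(** * Arcs at primitive fractions *)

Definition arc_points (k : nat) (qs : seq nat) : seq (nat * nat) :=
  [seq p <- [seq (q, a) | q <- qs, a <- iota 0 (q ^ k)] | prim k p.1 p.2].

Definition arc_start (R : realType) (k : nat) (p : nat * nat) : R := p.2%:R / (p.1 ^ k)%:R.

Definition arc_count (R : realType) (k : nat) (qs : seq nat) (e x : R) : R :=
  \sum_(p <- arc_points k qs) arc_ind (arc_start R k p) (arc_start R k p + e) x.

Lemma arc_points_uniq k qs : uniq qs -> uniq (arc_points k qs).
Proof.
move=> u; apply: filter_uniq; apply: allpairs_uniq_dep => // [q _|]; first exact: iota_uniq.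
by move=> [q a] [q' a'] _ _ /= [-> ->].
Qed.

Lemma sum_arc_points (V : zmodType) k qs (F : nat * nat -> V) :
  \sum_(p <- arc_points k qs) F p = \sum_(q <- qs) \sum_(0 <= a < q ^ k) F (q, a) *+ prim k q a.
Proof.
rewrite big_filter big_mkcond /= big_allpairs_dep; apply: eq_bigr => q _.
rewrite /index_iota subn0; apply: eq_bigr => a _ /=.
by case: (prim k q a).
Qed.

Lemma mem_arc_points k qs p : p \in arc_points k qs -> [/\ p.1 \in qs, (p.2 < p.1 ^ k)%N & prim k p.1 p.2].
Proof.
rewrite mem_filter => /andP[pr /allpairsPdep[q [a [h1 h2 E]]]]; move: pr h1 h2; rewrite E /=.
by rewrite mem_iota.
Qed.

Lemma bmeas_arc_count (R : realType) k qs (e : R) : bmeas (arc_count k qs e).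
Proof. by apply: bmeas_sum => p; exact: bmeas_arc_ind. Qed.

Lemma arc_ind_ge0 (R : realType) (a b x : R) : 0 <= arc_ind a b x.
Proof. by rewrite /arc_ind; case: ifP. Qed.

Lemma arc_count_nat (R : realType) k qs (e x : R) : exists n : nat, arc_count k qs e x = n%:R.
Proof.
rewrite /arc_count; elim/big_ind: _ => [|a b [n ->] [m ->]|p _]; first by exists 0%N.
  by exists (n + m)%N; rewrite natrD.
by rewrite /arc_ind; case: ifP => _; [exists 1%N|exists 0%N].
Qed.

(** Two different arcs meet only when their starting points are close, and by
    [close_pairs] that is rare. *)
Lemma arc_overlap (R : realType) k qs Y (e : R) : (0 < k)%N -> uniq qs ->
  (forall q, q \in qs -> (0 < q <= 2 * Y)%N) -> (size qs <= Y)%N -> 0 < e -> e * ((2 * Y) ^ k)%:R <= 1 ->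
  mean (fun x => arc_count k qs e x ^+ 2) <= mean (arc_count k qs e) +
    2 * (e * (Y%:R * ((2 * Y) ^ k)%:R)) ^+ 2.
Proof.
move=> k0 uq hq sz e0 eY; set s := arc_points k qs.
pose far (p p' : nat * nat) : bool := (p.2 * p'.1 ^ k != p'.2 * p.1 ^ k)%N.
pose cl (p p' : nat * nat) : bool := `|arc_start R k p - arc_start R k p'| <= e.
have pq p : p \in s -> 0 <= arc_start R k p /\ arc_start R k p + e <= 1.
  move=> ps; have [hp1 hp2 _] := mem_arc_points ps.
  have /andP[q0 qY] := hq _ hp1; have Q0 : 0 < (p.1 ^ k)%:R :> R by rewrite ltr0n expn_gt0 q0.
  split; first by rewrite divr_ge0.
  have h : e * (p.1 ^ k)%:R <= 1 by apply: le_trans eY; rewrite ler_wpM2l ?(ltW e0) // ler_nat leq_exp2r.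
  have h2 : p.2%:R + 1 <= (p.1 ^ k)%:R :> R by rewrite natr1 ler_nat.
  by rewrite -(ler_pM2r Q0) mulrDl mulfVK ?gt_eqF // mul1r; lra.
have pt x : arc_count k qs e x ^+ 2 <= arc_count k qs e x +
    \sum_(p <- s) (\sum_(p' <- s) (far p p' && cl p p')%:R) * arc_ind (arc_start R k p) (arc_start R k p + e) x.
  rewrite expr2 /arc_count -/s mulr_suml -big_split /= big_seq [X in _ <= X]big_seq; apply: ler_sum => p ps.
  rewrite {1 3 4}/arc_ind; case: ifP => xp; last by rewrite mul0r mulr0 addr0.
  rewrite mul1r mulr1 [X in _ <= X + _](_ : 1 = \sum_(p' <- s) (p' == p)%:R); last first.
    by rewrite (bigD1_seq p) ?arc_points_uniq //= eqxx big1 ?addr0 // => i /negbTE ->.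
  rewrite -big_split /= big_seq [X in _ <= X]big_seq; apply: ler_sum => p' ps'.
  rewrite /arc_ind; case: ifP => xp'; last by rewrite addr_ge0 ?ler0n.
  have -> : cl p p'.
    rewrite /cl ler_norml; move: xp xp' => /andP[? ?] /andP[? ?]; apply/andP; split; lra.
  rewrite andbT /far; have [->|ne] := eqVneq p' p; first by rewrite lerDl ler0n.
  suff -> : (p.2 * p'.1 ^ k != p'.2 * p.1 ^ k)%N by rewrite add0r.
  (* two primitive points with the same position are the same point *)
  apply: contra ne => /eqP E.
  have [hp1 _ pp] := mem_arc_points ps; have [hp1' _ pp'] := mem_arc_points ps'.
  have /andP[q0 _] := hq _ hp1; have /andP[q0' _] := hq _ hp1'.
  have [E1 E2] := prim_fraction_inj k0 q0 q0' pp pp' E.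
  by rewrite [p]surjective_pairing [p']surjective_pairing E1 E2.
have bA := bmeas_arc_count k qs e.
have bS : bmeas (fun x => \sum_(p <- s) (\sum_(p' <- s) (far p p' && cl p p')%:R) *
     arc_ind (arc_start R k p) (arc_start R k p + e) x).
  by apply: bmeas_sum => p; apply: bmeasM; [exact: bmeas_cst|exact: bmeas_arc_ind].
apply: (@le_trans _ _ (mean (fun x => arc_count k qs e x +
    \sum_(p <- s) (\sum_(p' <- s) (far p p' && cl p p')%:R) * arc_ind (arc_start R k p) (arc_start R k p + e) x))).
  apply: mean_le => [| |x _]; [|exact: bmeasD|exact: pt].
  exact: bmeas_sq.
rewrite meanD // lerD2l mean_sum; last by move=> p; apply: bmeasM; [exact: bmeas_cst|exact: bmeas_arc_ind].
apply: (@le_trans _ _ (\sum_(p <- s) (\sum_(p' <- s) (far p p' && cl p p')%:R) * e)).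
  rewrite !big_seq; apply: ler_sum => p ps; have [h1 h2] := pq p ps.
  rewrite meanZ; last exact: bmeas_arc_ind.
  by rewrite mean_arc_ind ?lerDl ?(ltW e0) // [X in X - _]addrC addrK.
rewrite -mulr_suml.
apply: (@le_trans _ _ (\sum_(q <- qs) \sum_(q' <- qs) (2 * (e * (q ^ k * q' ^ k)%:R)) * e)).
  under [X in _ <= X]eq_bigr do rewrite -mulr_suml.
  rewrite -mulr_suml ler_wpM2r ?(ltW e0) // sum_arc_points big_seq [X in _ <= X]big_seq; apply: ler_sum => q hq1.
  have /andP[q0 _] := hq _ hq1.
  apply: (@le_trans _ _ (\sum_(0 <= a < q ^ k) \sum_(p' <- s) (far (q, a) p' && cl (q, a) p')%:R)).
    by apply: ler_sum => a _; case: (prim k q a) => //; rewrite mulr0n sumr_ge0.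
  rewrite exchange_big sum_arc_points big_seq [X in _ <= X]big_seq; apply: ler_sum => q' hq2.
  have /andP[q0' _] := hq _ hq2.
  apply: (@le_trans _ _ (\sum_(0 <= a' < q' ^ k) \sum_(0 <= a < q ^ k) (far (q, a) (q', a') && cl (q, a) (q', a'))%:R)).
    by apply: ler_sum => a _; case: (prim k q' a) => //; rewrite mulr0n sumr_ge0.
  rewrite exchange_big /=; apply: close_pairs; rewrite ?expn_gt0 ?q0 ?q0' //; exact: ltW.
apply: (@le_trans _ _ (\sum_(q <- qs) \sum_(q' <- qs) (2 * (e * ((2 * Y) ^ k * (2 * Y) ^ k)%:R)) * e)).
  rewrite big_seq [X in _ <= X]big_seq; apply: ler_sum => q hq1.
  rewrite big_seq [X in _ <= X]big_seq; apply: ler_sum => q' hq2.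
  rewrite !ler_pM2r // !ler_pM2l // ler_nat; apply: leq_mul; rewrite leq_exp2r //.
    by have /andP[] := hq _ hq1.
  by have /andP[] := hq _ hq2.
have sr : (size qs)%:R <= Y%:R :> R by rewrite ler_nat.
rewrite !big_const_seq !count_predT !iter_addr_0 -[X in X <= _]mulr_natl -[X in _ * X <= _]mulr_natl natrM.
set P := ((2 * Y) ^ k)%:R; have P0 : 0 <= P by [].
have -> : (size qs)%:R * ((size qs)%:R * (2 * (e * (P * P)) * e)) = 2 * (e * ((size qs)%:R * P)) ^+ 2 by ring.
rewrite ler_wpM2l // lerXn2r ?nnegrE ?mulr_ge0 ?(ltW e0) //.
by rewrite ler_wpM2l ?(ltW e0) // ler_wpM2r.
Qed.

(** For [n >= 2] this is the arithmetic-geometric mean inequality with [n ^ 2 <= 2 (n ^ 2 - n)].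
    Applied to the number [n] of arcs containing a point, only the overlap enters the error. *)
Lemma mul_nat_le (R : realType) (r t : R) (n : nat) : 0 <= r -> 0 < t ->
  r * n%:R <= r + (t / 2 * r ^+ 2 + t^-1 * (n%:R ^+ 2 - n%:R)).
Proof.
move=> r0 t0; have t1 : 0 < t^-1 by rewrite invr_gt0.
have T0 : 0 <= t / 2 * r ^+ 2 by rewrite mulr_ge0 ?sqr_ge0 ?divr_ge0 // ltW.
case: n => [|[|n]].
- by rewrite mulr0 expr0n subrr mulr0 addr0 addr_ge0.
- by rewrite mulr1 expr1n subrr mulr0 addr0 lerDl.
set m := n.+2%:R; have m2 : 2 <= m by rewrite ler_nat.
have h : r * m <= t / 2 * r ^+ 2 + t^-1 * (m ^+ 2 / 2).
  have E : t / 2 * r ^+ 2 + t^-1 * (m ^+ 2 / 2) - r * m = t / 2 * (r - t^-1 * m) ^+ 2 by field; rewrite gt_eqF.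
  by rewrite -subr_ge0 E mulr_ge0 ?sqr_ge0 // divr_ge0 // ltW.
have h2 : m ^+ 2 / 2 <= m ^+ 2 - m by rewrite expr2; nra.
have := ler_wpM2l (ltW t1) h2; lra.
Qed.

(** The remainder is large on the average over the arcs at the primitive points.  Almost
    every point lies in at most one arc, so that its mean value is large, too. *)
Lemma arc_inequality (R : realType) (N K t M : R) k Z Y qs : (2 <= k)%N -> uniq qs ->
  (forall q, q \in qs -> sqfree q /\ (Y < q <= 2 * Y)%N) -> (size qs <= Y)%N -> (Z <= Y)%N ->
  (Z <= Num.truncn N)%N -> 1 <= K -> K <= N -> ((2 * Y) ^ k)%:R <= 8 * K -> 0 < t ->
  M <= 2^-1 * \sum_(0 <= n < (Num.truncn N).+1) kfree_coef N K k n ->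
  (size qs)%:R * ((8 * K)^-1 * (M - 8 * Z%:R * ((2 * Y) ^ k)%:R)) <=
  mean (fun x => nc (trigpoly (cutoff N K) (rem_coef N K k Z) x)) +
  (t / 2 * mean (fun x => nc (trigpoly (cutoff N K) (rem_coef N K k Z) x) ^+ 2) +
  t^-1 * (2 * ((8 * K)^-1 * (Y%:R * ((2 * Y) ^ k)%:R)) ^+ 2)).
Proof.
move=> k2 uq hq sz ZY ZN K1 KN YK t0 hM; have k0 : (0 < k)%N by apply: leq_trans k2.
have KN' : 0 <= K <= N by rewrite KN andbT; lra.
set f := fun x => nc (trigpoly (cutoff N K) (rem_coef N K k Z) x).
have f0 x : 0 <= f x by exact: normc_ge0.
have bf : bmeas f by exact: cbmeas_norm (cbmeas_trigpoly1 _ _).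
have cf : continuous f by exact: continuous_nc_trigpoly.
have bf2 := bmeas_sq bf.
set e := (8 * K)^-1; have e0 : 0 < e by rewrite invr_gt0; lra.
have eK : 8 * (K * e) = 1 by rewrite /e; field; rewrite gt_eqF; lra.
have eY : e * ((2 * Y) ^ k)%:R <= 1.
  by apply: le_trans (ler_wpM2l (ltW e0) YK) _; have := eK; lra.
pose Bc := arc_count k qs e; have bB : bmeas Bc by exact: bmeas_arc_count.
have bB2 := bmeas_sq bB.
have up : mean (fun x => f x * Bc x) <= mean f + (t / 2 * mean (fun x => f x ^+ 2) +
    t^-1 * (2 * (e * (Y%:R * ((2 * Y) ^ k)%:R)) ^+ 2)).
  apply: (@le_trans _ _ (mean (fun x => f x + (t / 2 * f x ^+ 2 + t^-1 * (Bc x ^+ 2 + - Bc x))))).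
    apply: mean_le; first exact: bmeasM.
      by apply: bmeasD => //; apply: bmeasD; apply: bmeasM; rewrite //; [exact: bmeas_cst|exact: bmeas_cst|apply: bmeasD => //; exact: bmeasN].
    by move=> x _; have [n E] := arc_count_nat k qs e x; rewrite /Bc E; exact: mul_nat_le.
  have b1 : bmeas (fun x => t / 2 * f x ^+ 2) by apply: bmeasM => //; exact: bmeas_cst.
  have b2 : bmeas (fun x => Bc x ^+ 2 + - Bc x) by apply: bmeasD => //; exact: bmeasN.
  have b3 : bmeas (fun x => t^-1 * (Bc x ^+ 2 + - Bc x)) by apply: bmeasM => //; exact: bmeas_cst.
  have b4 := bmeasD b1 b3; have b5 := bmeasN bB.
  rewrite (meanD bf b4) (meanD b1 b3) (meanZ _ bf2) (meanZ _ b2) (meanD bB2 b5).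
  rewrite !lerD2l ler_wpM2l ?invr_ge0 ?(ltW t0) //.
  have -> : mean (fun x => - Bc x) = - mean Bc.
    by rewrite -mulN1r -meanZ //; congr mean; apply/funext => x; rewrite mulN1r.
  rewrite lerBlDl; apply: arc_overlap => // q /hq[_ /andP[h1 h2]].
  by rewrite h2 (leq_ltn_trans (leq0n _) h1).
apply: le_trans up; pose g a Q x := arc_ind 0 e x * f (x + a%:R / Q%:R).
have bg a Q : bmeas (g a Q).
  apply: bmeasM; first exact: bmeas_arc_ind.
  by have := bmeas_affine 1 (a%:R / Q%:R) bf cf; congr bmeas; apply/funext => x; rewrite mul1r.
have -> : mean (fun x => f x * Bc x) =
    \sum_(q <- qs) mean (fun x => \sum_(0 <= a < q ^ k) g a (q ^ k)%N x *+ prim k q a).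
  transitivity (\sum_(p <- arc_points k qs) mean (g p.2 (p.1 ^ k)%N)).
    transitivity (mean (fun x => \sum_(p <- arc_points k qs)
        arc_ind (arc_start R k p) (arc_start R k p + e) x * f x)).
      by congr mean; apply/funext => x; rewrite mulrC /Bc /arc_count mulr_suml.
    rewrite mean_sum; last by move=> p; apply: bmeasM => //; exact: bmeas_arc_ind.
    apply: eq_big_seq => p ps; have [hp1 hp2 _] := mem_arc_points ps.
    have [_ /andP[q1 q2]] := hq _ hp1.
    have Q0 : 0 < (p.1 ^ k)%:R :> R by rewrite ltr0n expn_gt0 (leq_ltn_trans (leq0n _) q1).
    apply: mean_shift => //; [by rewrite divr_ge0|exact: ltW|].
    have h : e * (p.1 ^ k)%:R <= 1 by apply: le_trans eY; rewrite ler_wpM2l ?(ltW e0) // ler_nat leq_exp2r.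
    have h2 : p.2%:R + 1 <= (p.1 ^ k)%:R :> R by rewrite natr1 ler_nat.
    by rewrite -(ler_pM2r Q0) mulrDl mulfVK ?gt_eqF // mul1r; lra.
  rewrite sum_arc_points; apply: eq_bigr => q _; rewrite mean_sum.
    by apply: eq_bigr => a _ /=; case: (prim k q a) => //; rewrite !mulr0n mean_cst.
  by move=> a; case: (prim k q a); [exact: bg|exact: bmeas_cst].
set c1 := M - _; rewrite mulrC.
have -> : e * c1 * (size qs)%:R = \sum_(q <- qs) mean (fun x => c1 * arc_ind 0 e x).
  rewrite big_const_seq count_predT iter_addr_0 meanZ; last exact: bmeas_arc_ind.
  rewrite mean_arc_ind ?(ltW e0) //; last by rewrite invf_le1; lra.
  by rewrite subr0 mulr_natr mulrC.
rewrite big_seq [X in _ <= X]big_seq; apply: ler_sum => q hq1; have [sq /andP[q1 q2]] := hq _ hq1.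
apply: mean_le.
- by apply: bmeasM; [exact: bmeas_cst|exact: bmeas_arc_ind].
- by apply: bmeas_sum => a; case: (prim k q a); [exact: bg|exact: bmeas_cst].
move=> x /andP[x0 _]; rewrite /g {1}/arc_ind; case: ifP => [/andP[_ xe]|_]; last first.
  by rewrite mulr0 sumr_ge0 // => a _; rewrite mulrn_wge0 // mulr_ge0 // arc_ind_ge0.
rewrite mulr1; have xK : 8 * (K * x) <= 1.
  by rewrite -[X in _ <= X]eK ler_wpM2l // ler_wpM2l //; lra.
have := rest_on_prim k2 (leq_ltn_trans ZY q1) sq ZN K1 KN x0 xK.
have -> : \sum_(0 <= a < q ^ k) (arc_ind 0 e x * f (x + a%:R / (q ^ k)%:R)) *+ prim k q a =
    \sum_(0 <= a < q ^ k) (prim k q a)%:R * f (x + a%:R / (q ^ k)%:R).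
  by apply: eq_bigr => a _; rewrite /arc_ind x0 xe mul1r [RHS]mulr_natl.
apply: le_trans; rewrite /c1; apply: lerB.
  exact: le_trans hM (expsum_arc_lower k KN' x0 xK).
by rewrite ler_wpM2l ?mulr_ge0 // ler_nat leq_exp2r.
Qed.

(** * The first moment *)

(** Squarefree integers are the 2-free ones, and [delta 2 < 1], so that [kfree_count] applies to
    the window (Y, 2 Y]. *)
Lemma sqfree_supply (R : realType) : exists Y0 : nat, forall Y, (Y0 <= Y)%N ->
  exists qs : seq nat, [/\ uniq qs, forall q, q \in qs -> sqfree q /\ (Y < q <= 2 * Y)%N,
    (size qs <= Y)%N & Y%:R / 24 <= (size qs)%:R :> R].
Proof.
have d2 : delta R 2 < 1 by rewrite /delta eqxx; lra.
have c0 : 0 < 2^-1 :> R by [].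
have [N0 N01 H] := @kfree_count R 2 1 2^-1 (leqnn _) d2 ltr01 c0.
exists (Num.truncn N0).+1 => Y hY; have Y1 : 1 <= Y%:R :> R by rewrite ler1n (leq_trans _ hY).
have hN : N0 <= Y%:R by apply: ltW; apply: lt_le_trans (truncnS_gt N0) _; rewrite ler_nat.
have a1 : N0 <= 2 * Y%:R by lra.
have a2 : Y%:R <= 2 * Y%:R :> R by lra.
have a3 : 2^-1 * (2 * Y%:R) `^ 1 <= Y%:R :> R by rewrite powRr1; lra.
have hS := H _ _ _ a1 Y1 a2 a3 (leqnn _).
exists [seq q <- index_iota Y.+1 (2 * Y).+1 | sqfree q]; split.
- by rewrite filter_uniq // iota_uniq.
- by move=> q; rewrite mem_filter mem_index_iota ltnS => /andP[-> ->].
- by rewrite size_filter; apply: leq_trans (count_size _ _) _; rewrite size_iota subSS mul2n -addnn addnK.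
apply: le_trans hS _; have -> : Num.truncn (2 * Y%:R : R) = (2 * Y)%N by rewrite -natrM natrK.
rewrite size_filter -sum1_count natr_sum [X in _ <= X]big_mkcond [X in X <= _](@big_cat_nat _ _ _ Y.+1) //=; last by rewrite ltnS leq_pmull.
rewrite [X in X + _]big1_seq ?add0r; last first.
  move=> n; rewrite mem_index_iota => /andP[_ /andP[_ nY]]; rewrite /kfree_coef /win. rewrite (_ : 2 * Y%:R - Y%:R = Y%:R :> R); last by ring.
  by rewrite ltr_nat ltnNge -ltnS nY mul0r.
rewrite big_nat [X in _ <= X]big_nat; apply: ler_sum => n /andP[nY _].
rewrite /kfree_coef /mu indicE; case: (boolP (n \in kfree 2)) => [|_]; last by rewrite mulr0; case: ifP.
rewrite inE => fr; have -> : sqfree n by apply/sqfreeP; split; [apply: leq_ltn_trans nY|].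
by rewrite mulr1 lern1; case: (win _ _ _).
Qed.

(** The main term of the mean square of the remainder for [K = D ^ (k + 1)] and [Z] about [z D]. *)
Lemma rest_sq_scale (R : realType) (D K z Zr : R) k : (2 <= k)%N -> 0 < z -> z <= 1 -> 0 < D -> D ^+ k.+1 = K ->
  z * D / 2 <= Zr -> K * Zr ^- k.-1 <= D ^+ 2 / (z / 2) ^+ k.-1.
Proof.
case: k => [|[|k]] // _ z0 z1 D0 DK hZ /=; have w0 : 0 < z * D / 2 by rewrite divr_gt0 // mulr_gt0.
have Z0 : 0 < Zr by apply: lt_le_trans hZ.
have h : (z * D / 2) ^+ k.+1 <= Zr ^+ k.+1 by rewrite lerXn2r ?nnegrE // ltW.
rewrite ler_pdivrMr ?exprn_gt0 // -DK.
have -> : D ^+ k.+3 = D ^+ 2 / (z / 2) ^+ k.+1 * (z * D / 2) ^+ k.+1.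
  rewrite (_ : z * D / 2 = z / 2 * D); last by ring.
  by rewrite [(z / 2 * D) ^+ _]exprMn mulrA mulfVK ?expf_neq0 ?gt_eqF ?divr_gt0 // -exprD.
by rewrite ler_wpM2l // divr_ge0 // exprn_ge0 // ?divr_ge0 // ltW.
Qed.

Lemma arc_main_size (R : realType) (K D c Q Yr X : R) : 0 < K -> c * D / 2 <= Yr -> Yr / 24 <= Q -> 0 <= Q ->
  X <= K / 96 -> 48^-1 * (8^-1 * 96^-1) * (c * D) <= Q * ((8 * K)^-1 * (K / 48 - X)).
Proof.
move=> K0 h1 h2 Q0 h3.
apply: (@le_trans _ _ (Q * ((8 * K)^-1 * (K / 96)))); last first.
  by rewrite ler_wpM2l // ler_wpM2l ?invr_ge0 //; lra.
have -> : (8 * K)^-1 * (K / 96) = 8^-1 * 96^-1 by field; rewrite gt_eqF.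
have h4 : 48^-1 * (c * D) <= Q by lra.
by have := ler_wpM2r (_ : 0 <= 8^-1 * 96^-1 :> R) h4; lra.
Qed.

(** The error from overlapping arcs is smaller than the main term by a factor of order [c ^ 2]:
    [(2 c) ^ (2 k)] is [4 c ^ 2] times a power that cancels against
    [((kap c) ^ 2 / 2) ^ (k - 1)] up to a constant. *)
Lemma arc_overlap_size (R : realType) (K D c kap rho V : R) k : (2 <= k)%N -> 0 < K -> 0 < D -> 0 < c -> 0 < kap -> 0 < rho ->
  25 * (8 / kap ^+ 2) ^+ k.-1 * c ^+ 2 <= rho ^+ 2 -> 0 <= V -> V <= c * (2 * c) ^+ k * K ->
  (rho * c * ((kap * c) ^+ 2 / 2) ^+ k.-1 / (50 * D))^-1 * (2 * ((8 * K)^-1 * V) ^+ 2) <= rho * c * D / 4.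
Proof.
case: k => [|[|k]] // _ K0 D0 c0 kap0 rho0 /= hH V0 hV.
set tau := ((kap * c) ^+ 2 / 2) ^+ k.+1.
have tau0 : 0 < tau by rewrite exprn_gt0 // divr_gt0 // exprn_gt0 // mulr_gt0.
have h1 : 0 <= (8 * K)^-1 * V by rewrite mulr_ge0 // invr_ge0; lra.
have h2 : (8 * K)^-1 * V <= c * (2 * c) ^+ k.+2 / 8.
  rewrite mulrC ler_pdivrMr; last lra.
  by apply: le_trans hV _; rewrite (_ : _ / 8 * _ = c * (2 * c) ^+ k.+2 * K) //; field.
have h3 : ((8 * K)^-1 * V) ^+ 2 <= (c * (2 * c) ^+ k.+2 / 8) ^+ 2 by rewrite lerXn2r ?nnegrE // (le_trans h1).
have E : ((2 * c) ^+ k.+2) ^+ 2 = 4 * c ^+ 2 * ((8 / kap ^+ 2) ^+ k.+1 * tau).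
  rewrite /tau -exprMn -exprM mulnC exprM exprS; congr (_ * _); first by ring.
  by congr (_ ^+ _); field; rewrite gt_eqF.
set H := (8 / kap ^+ 2) ^+ k.+1 in hH E.
have T0 : 0 < (rho * c * tau / (50 * D))^-1 by rewrite invr_gt0 !divr_gt0 ?mulr_gt0.
apply: (@le_trans _ _ ((rho * c * tau / (50 * D))^-1 * (2 * (c * (2 * c) ^+ k.+2 / 8) ^+ 2))).
  by rewrite ler_wpM2l ?(ltW T0) // ler_wpM2l.
have -> : (rho * c * tau / (50 * D))^-1 * (2 * (c * (2 * c) ^+ k.+2 / 8) ^+ 2) = (25 * H * c ^+ 2) * (c * D / (4 * rho)).
  have -> : (c * (2 * c) ^+ k.+2 / 8) ^+ 2 = c ^+ 2 / 64 * ((2 * c) ^+ k.+2) ^+ 2 by field.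
  rewrite E; field; rewrite !gt_eqF //.
have -> : rho * c * D / 4 = rho ^+ 2 * (c * D / (4 * rho)) by field; rewrite gt_eqF.
by rewrite ler_wpM2r // divr_ge0 // mulr_ge0 // ltW.
Qed.

(** First [kap] is chosen so small that the mean value of the main part, [C kap c D], is
    negligible against [c D]; then [c] so small that the overlap of the arcs is negligible, too. *)
Lemma arc_constants (R : realType) k (C : R) : 0 < C -> exists kap c : R,
  [/\ 0 < kap <= 1, C * kap <= 48^-1 * (8^-1 * 96^-1) / 4, 0 < c, 32 * c <= 1 &
   25 * (8 / kap ^+ 2) ^+ k.-1 * c ^+ 2 <= (48^-1 * (8^-1 * 96^-1)) ^+ 2].
Proof.
move=> C0; set rho := 48^-1 * _; have rho0 : 0 < rho by rewrite !mulr_gt0.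
have rho1 : rho <= 1 by rewrite /rho; lra.
pose kap := rho / (4 * (C + 1)); have kap0 : 0 < kap by rewrite divr_gt0 //; lra.
pose H := 25 * (8 / kap ^+ 2) ^+ k.-1.
have H0 : 0 < H by rewrite mulr_gt0 // exprn_gt0 // divr_gt0 // exprn_gt0.
pose c := rho / (32 + H); have c0 : 0 < c by rewrite divr_gt0 //; lra.
have cE : c * (32 + H) = rho by rewrite /c mulfVK // gt_eqF //; lra.
have cH : 0 < c * H by rewrite mulr_gt0.
have kE : kap * (4 * (C + 1)) = rho by rewrite /kap mulfVK // gt_eqF //; lra.
have kC : 0 < kap * C by rewrite mulr_gt0.
exists kap, c; split => //.
- by rewrite kap0 /=; lra.
- lra.
- lra.
rewrite -/H expr2 mulrA; have h1 : H * c <= rho by lra.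
have h2 : c <= rho by lra.
by rewrite expr2; apply: ler_pM => //; [rewrite mulr_ge0 // ltW|exact: ltW].
Qed.

(** Take [q] between [c D] and [2 c D] and [Z] about [(kap c) ^ 2 D].  The remainder then has mean
    value at least [rho c D / 2], and the main part at most [rho c D / 4]. *)
Theorem mean_expsum_lower (R : realType) k (theta c0 : R) : (2 <= k)%N -> (k%:R + 1) / 2 * delta R k < theta -> 0 < c0 ->
  exists2 L : R, 0 < L & exists2 N0 : R, 1 <= N0 &
   forall N K, N0 <= N -> 1 <= K -> K <= N -> c0 * N `^ theta <= K ->
   L * K `^ (k%:R + 1)^-1 <= mean (fun x => nc (expsum k N K x)).
Proof.
move=> k2 th c00; have k0 : (0 < k)%N by apply: leq_trans k2.
have kr2 : 2 <= k%:R :> R by rewrite ler_nat.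
have d0 := @delta_gt0 R k k2.
have d1 : delta R k < theta by apply: le_lt_trans th; rewrite ler_peMl ?(ltW d0) // ler_pdivlMr; lra.
have t0 := lt_trans d0 d1.
have tw : delta R k < theta * (2 / (k%:R + 1)).
  by rewrite mulrA ltr_pdivlMr; move: th; lra.
have [C0 C00 HV] := @mean_main_sum R k k2.
have [kap [c [/andP[kap0 kap1] kC cp c32 hH]]] := @arc_constants R k C0 C00.
move: kC hH; set rho := 48^-1 * _ => kC hH; have rho0 : 0 < rho by rewrite !mulr_gt0.
set z := (kap * c) ^+ 2; have kc0 : 0 < kap * c by rewrite mulr_gt0.
have z0 : 0 < z by rewrite exprn_gt0.
have kcc : kap * c <= c by rewrite ler_piMl // ltW.
have zc : 32 * z <= c.
  rewrite /z expr2; have := ler_pM (ltW kc0) (ltW kc0) kcc kcc; have := ler_wpM2r (ltW cp) c32; lra.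
have [Y0 HY] := @sqfree_supply R.
have [Na Na1 Hcount] := @kfree_count R k theta c0 k2 d1 t0 c00.
have [Nb Nb1 Hrest] := @rest_small R k (2 / (k%:R + 1)) theta c0 k2 (lexx _) tw t0 c00.
(* [D >= D0] makes [Y] at least [Y0] and [Z] at least 1 *)
pose D0 := Y0.+1%:R / c + z^-1; have D00 : 0 < D0 by rewrite addr_gt0 ?divr_gt0 ?invr_gt0 // ltr0n.
have [Nc Nc1 Hlarge] := @eventually_large R c0 theta (D0 ^+ k.+1) c00 t0.
exists (rho * c / 4); first by rewrite divr_gt0 // mulr_gt0.
exists (Num.max Na (Num.max Nb Nc)); first by rewrite le_max Na1.
move=> N K; rewrite !ge_max => /andP[hNa /andP[hNb hNc]] K1 KN hK.
have K0 : 0 < K by lra.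
have KN' : 0 <= K <= N by rewrite KN andbT ltW.
have [D1 DK] := @root_scale R K k K1; set D := K `^ _ in D1 DK *.
have Dp : 0 < D by lra.
have DD0 : D0 <= D.
  have := le_trans (Hlarge N hNc) hK; by rewrite -DK ler_pXn2r ?nnegrE ?(ltW D00) ?(ltW Dp).
have zD : 1 <= z * D.
  have h : z^-1 <= D by apply: le_trans DD0; rewrite lerDr divr_ge0 // ltW.
  by have := ler_wpM2l (ltW z0) h; rewrite mulfV ?gt_eqF.
have cD : Y0.+1%:R <= c * D.
  have h : Y0.+1%:R / c <= D by apply: le_trans DD0; rewrite lerDl invr_ge0 ltW.
  by move: h; rewrite ler_pdivrMr // mulrC.
have cD1 : 1 <= c * D by apply: le_trans cD; rewrite ler1n.
have [Z0 ZD Z2] := truncn_half zD; set Z := Num.truncn _ in Z0 ZD Z2.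
have [Y1 YD Y2] := truncn_half cD1; set Y := Num.truncn _ in Y1 YD Y2.
have YY0 : (Y0 <= Y)%N by rewrite /Y truncn_ge_nat ?(le_trans _ cD) //; last lra; apply: le_trans cD; rewrite ler_nat.
have DleK : D <= K by rewrite -DK exprS ler_peMr ?(ltW Dp) // exprn_ege1.
have zcD := ler_wpM2r (ltW Dp) zc.
have cDD := ler_wpM2r (ltW Dp) c32.
have ZD' : Z%:R <= D by move: ZD zcD cDD Dp; clear; lra.
have ZN : (Z <= Num.truncn N)%N by rewrite truncn_ge_nat ?(le_trans _ KN) ?(ltW K0) //; move: ZD' DleK KN; clear; lra.
have ZY : (Z <= Y)%N by rewrite -(ler_nat R); move: ZD zcD Y2 cDD cD1; clear; lra.
have [qs [uq hq sz sz2]] := HY Y YY0.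
set P := ((2 * Y) ^ k)%:R : R.
have P0 : 0 <= P by [].
have P1 : P <= (2 * c) ^+ k * D ^+ k.
  rewrite /P natrX -exprMn lerXn2r ?nnegrE //; first by rewrite !mulr_ge0 // ltW.
  by rewrite natrM; move: YD; clear; lra.
have Dk0 : 0 < D ^+ k by rewrite exprn_gt0.
have ck1 : (2 * c) ^+ k <= 1 by apply: exprn_ile1; move: cp c32; clear; lra.
have P2 : P <= D ^+ k by apply: le_trans P1 _; rewrite ler_piMl // ltW.
have DKk : D * D ^+ k = K by rewrite -DK exprS.
have YK : P <= 8 * K.
  have : D ^+ k <= K by rewrite -DKk ler_peMl // ltW.
  by move: P2 K0; clear; lra.
have X1 : 8 * Z%:R * P <= K / 96.
  have h : Z%:R * P <= z * D * D ^+ k by apply: ler_pM.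
  have h2 : z * D * D ^+ k = z * K by rewrite -mulrA DKk.
  have h3 := ler_wpM2r (ltW K0) zc; have h4 := ler_wpM2r (ltW K0) c32.
  by rewrite h2 in h; move: h h3 h4 K0; rewrite -!mulrA; clear; lra.
have V1 : Y%:R * P <= c * (2 * c) ^+ k * K.
  apply: le_trans (ler_pM _ _ YD P1) _ => //.
  by rewrite -DKk le_eqVlt; apply/orP; left; apply/eqP; ring.
set tau := (z / 2) ^+ k.-1.
have tau0 : 0 < tau by rewrite exprn_gt0 // divr_gt0.
have z1 : z <= 1 by move: zc c32 z0; clear; lra.
have tau1 : tau <= 1 by apply: exprn_ile1; move: z0 z1; clear; lra.
(* with this [t] the mean square of the remainder contributes exactly [rho c D / 4] *)
pose t := rho * c * tau / (50 * D); have tp0 : 0 < t by rewrite divr_gt0 ?mulr_gt0.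
have hM : K / 48 <= 2^-1 * \sum_(0 <= n < (Num.truncn N).+1) kfree_coef N K k n.
  by have := Hcount N K _ hNa K1 KN hK (leqnn _); clear; lra.
have arc := arc_inequality k2 uq hq sz ZY ZN K1 KN YK tp0 hM.
have T2 := arc_overlap_size k2 K0 Dp cp kap0 rho0 hH (mulr_ge0 (ler0n R Y) P0) V1.
have lhs := @arc_main_size R K D c (size qs)%:R Y%:R _ K0 _ sz2 _ X1.
have rsq := Hrest N K Z hNb K1 KN hK Z0.
have rsc := @rest_sq_scale R D K z Z%:R k k2 z0 z1 Dp DK _.
have Kw : K `^ (2 / (k%:R + 1)) = D ^+ 2.
  by rewrite /D -powR_mulrn ?powR_ge0 // -powRrM mulrC.
have T1 : t / 2 * mean (fun x => nc (trigpoly (cutoff N K) (rem_coef N K k Z) x) ^+ 2) <= rho * c * D / 4.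
  have h1 : mean (fun x => nc (trigpoly (cutoff N K) (rem_coef N K k Z) x) ^+ 2) <= 25 * (D ^+ 2 / tau).
    apply: le_trans rsq _; rewrite Kw; have h : D ^+ 2 <= D ^+ 2 / tau.
      by rewrite ler_pdivlMr // ler_piMr // sqr_ge0.
    have z2 : z * D / 2 <= Z%:R by move: Z2; clear; lra.
    by move: (rsc z2) h; clear; rewrite /tau; lra.
  apply: le_trans (ler_wpM2l _ h1) _; first by rewrite divr_ge0 // ltW.
  by rewrite le_eqVlt; apply/orP; left; apply/eqP; rewrite /t; field; rewrite !gt_eqF.
have mR : rho * c * D / 2 <= mean (fun x => nc (trigpoly (cutoff N K) (rem_coef N K k Z) x)).
  have y2 : c * D / 2 <= Y%:R by move: Y2; clear; lra.
  have := le_trans (lhs y2 (ler0n R _)) arc; rewrite -/rho mulrA.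
  by move: T1 T2; rewrite -/P -/z -/tau -/t; clear; lra.
have mV : mean (fun x => nc (main_sum N K k Z (cutoff N K) x)) <= rho * c * D / 4.
  apply: le_trans (HV N K D Z K1 KN erefl Z0 ZD') _.
  have sq : Num.sqrt (Z%:R * D) <= kap * c * D.
    have p0 : 0 <= kap * c * D by rewrite mulr_ge0 // ltW.
    rewrite -(ger0_norm p0) -sqrtr_sqr ler_wsqrtr //.
    have -> : (kap * c * D) ^+ 2 = z * D * D by rewrite /z; ring.
    by rewrite ler_wpM2r // ltW.
  apply: le_trans (ler_wpM2l (ltW C00) sq) _.
  have h := ler_wpM2r (le_trans ler01 cD1) kC; rewrite -!mulrA in h *; move: h; clear; lra.
have bR : bmeas (fun x => nc (trigpoly (cutoff N K) (rem_coef N K k Z) x)) by exact: cbmeas_norm (cbmeas_trigpoly1 _ _).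
have bV := bmeas_main_sum N K k Z (cutoff N K); have bE := bmeas_expsum k KN'.
have : mean (fun x => nc (trigpoly (cutoff N K) (rem_coef N K k Z) x)) <=
    mean (fun x => nc (expsum k N K x)) + mean (fun x => nc (main_sum N K k Z (cutoff N K) x)).
  rewrite -meanD //; apply: mean_le => // [|x _]; first exact: bmeasD.
  rewrite (expsum_decomp x k0 KN' ZN) -[X in _ <= _ + X]nc_opp; apply: le_trans (normcD_le _ _).
  by rewrite addrAC subrr add0r.
by move: mR mV; clear; lra.
Qed.

(** * Lower bounds below the critical order and conclusion *)

(** If [a <= l] the first term suffices, otherwise the second. *)
Lemma powR_split_le (R : realType) (a l s s2 : R) : 0 <= a -> 0 < l -> s <= 1 -> 1 <= s2 ->
  a <= l `^ (1 - s) * a `^ s + l `^ (1 - s2) * a `^ s2.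
Proof.
move=> a0 l0 s1 s21; have [->|an] := eqVneq a 0; first by rewrite addr_ge0 // mulr_ge0 // powR_ge0.
have ap : 0 < a by rewrite lt0r an.
have p1 := powR_ge0 l (1 - s); have p2 := powR_ge0 a s.
have p3 := powR_ge0 l (1 - s2); have p4 := powR_ge0 a s2.
have E r : a = a `^ (1 - r) * a `^ r by rewrite -powRD ?subrK ?powRr1 // an implybT.
have [al|la] := leP a l.
  have h : a `^ (1 - s) <= l `^ (1 - s) by apply: le_powR2; lra.
  by rewrite {1}(E s); apply: (le_trans (ler_wpM2r p2 h)); rewrite lerDl mulr_ge0.
have h : a `^ (1 - s2) <= l `^ (1 - s2).
  rewrite -[1 - s2]opprB !powRN lef_pV2 ?posrE ?powR_gt0 //; apply: le_powR2; lra.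
by rewrite {1}(E s2); apply: (le_trans (ler_wpM2r p4 h)); rewrite lerDr mulr_ge0.
Qed.

Lemma powR_complement (R : realType) (D t : R) : 0 < D -> D `^ (1 - t) * D `^ t = D.
Proof. by move=> D0; rewrite -powRD ?subrK ?powRr1 ?(ltW D0) // (gt_eqF D0) implybT. Qed.

Lemma powR_rescale (R : realType) (A D C t : R) : 0 < A -> 0 < D ->
  (A * D) `^ (1 - t) * (C * D `^ t) = A `^ (1 - t) * C * D.
Proof.
by move=> A0 D0; rewrite powRM ?(ltW A0) ?(ltW D0) // mulrACA powR_complement.
Qed.

Lemma powR_cancel (R : realType) (A C t : R) : 0 < A -> A `^ (1 - t) * (C * A `^ (t - 1)) = C.
Proof. by move=> A0; rewrite mulrCA -[t - 1]opprB powRN mulfV ?mulr1 // gt_eqF // powR_gt0. Qed.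

(** For [s >= 1] the first moment bounds the [s]th one from below.  For [s < 1] a moment of
    order slightly above [1], which has the same order of magnitude relative to the
    first one, shows that the mass of the first moment does not come from large values. *)
Theorem moment_lower_small (R : realType) k (s theta c : R) : (2 <= k)%N -> 0 < s -> s < 1 + k%:R^-1 ->
  theta_bound k s < theta -> 0 < c ->
  exists2 C : R, 0 < C & exists2 N0 : R, 1 <= N0 &
   forall N K, N0 <= N -> 1 <= K -> K <= N -> c * N `^ theta <= K ->
   C * moment_order k s K <= mean (fun x => nc (expsum k N K x) `^ s).
Proof.
move=> k2 s0 sk th c0; have /andP[ik0 ik1] := @inv_nat_lt1 R k k2.
have th' : (k%:R + 1) / 2 * delta R k < theta by move: th; rewrite /theta_bound sk.
have [L L0 [N1 N11 HL]] := @mean_expsum_lower R k theta c k2 th' c0.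
have moE (s' K : R) : 1 <= K -> s' < 1 + k%:R^-1 -> moment_order k s' K = (K `^ (k%:R + 1)^-1) `^ s'.
  by move=> K1 h; rewrite /moment_order h -powRrM mulrC.
have bp (N K p : R) : 0 <= K <= N -> 0 <= p -> bmeas (fun x => nc (expsum k N K x) `^ p).
  by move=> KN p0; apply: bmeas_powR => //; [move=> x; exact: normc_ge0|exact: bmeas_expsum].
have [s1|s1] := leP 1 s.
  exists ((L / 2) `^ s); first by apply: powR_gt0; rewrite divr_gt0.
  exists N1 => // N K hN K1 KN hK; have KN' : 0 <= K <= N by rewrite KN andbT; lra.
  have := HL N K hN K1 KN hK; rewrite moE //; set D := K `^ _ => low.
  have D0 : 0 < D by apply: powR_gt0; exact: lt_le_trans K1.
  pose l := L / 2 * D; have l0 : 0 < l by rewrite !mulr_gt0 ?invr_gt0.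
  have up : mean (fun x => nc (expsum k N K x)) <= l + l `^ (1 - s) * mean (fun x => nc (expsum k N K x) `^ s).
    rewrite -meanZ; last by apply: bp => //; exact: ltW.
    rewrite -[X in _ <= X + _]mean_cst -meanD; [|exact: bmeas_cst|by apply: bmeasM; [exact: bmeas_cst|apply: bp => //; exact: ltW]].
    apply: mean_le => [||x _]; [exact: bmeas_expsum| |].
      by apply: bmeasD; [exact: bmeas_cst|apply: bmeasM; [exact: bmeas_cst|apply: bp => //; exact: ltW]].
    have := powR_split_le (normc_ge0 (expsum k N K x)) l0 ler01 s1.
    by rewrite subr0 powRr1 ?(ltW l0) // powRr0 mulr1.
  have h : l <= l `^ (1 - s) * mean (fun x => nc (expsum k N K x) `^ s).
    by move: low up; rewrite /l; clear; lra.
  rewrite -powRM ?divr_ge0 ?(ltW L0) ?(ltW D0) // -/l.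
  have p0 : 0 < l `^ (1 - s) by rewrite powR_gt0.
  rewrite -(ler_pM2l p0); apply: le_trans h.
  by rewrite powR_complement.
pose s2 : R := 1 + k%:R^-1 / 2.
have s2k : s2 < 1 + k%:R^-1 by rewrite /s2; lra.
have s20 : 0 < s2 by rewrite /s2; lra.
have s21 : 1 < s2 by rewrite /s2; lra.
have th2 : theta_bound k s2 < theta by rewrite /theta_bound s2k.
have [C2 C20 [N2 N21 HU]] := @moment_upper R k s2 theta c k2 s20 (negbT (lt_eqF s2k)) th2 c0.
(* at the height [A D] the moment of order [s2] accounts for at most half of the first one *)
pose A := (2 * C2 / L) `^ (s2 - 1)^-1.
have q0 : 0 < 2 * C2 / L by rewrite divr_gt0 // mulr_gt0.
have A0 : 0 < A by rewrite powR_gt0.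
have AE : A `^ (1 - s2) * C2 = L / 2.
  rewrite /A -powRrM -[1 - s2]opprB mulrN mulVf; last by rewrite gt_eqF; lra.
  by rewrite powRN powRr1 ?(ltW q0) //; field; rewrite !gt_eqF.
exists (L / 2 * A `^ (s - 1)); first by rewrite mulr_gt0 ?powR_gt0 // divr_gt0.
exists (Num.max N1 N2); first by rewrite le_max N11.
move=> N K; rewrite ge_max => /andP[hN1 hN2] K1 KN hK; have KN' : 0 <= K <= N by rewrite KN andbT; lra.
have := HL N K hN1 K1 KN hK; have := HU N K hN2 K1 KN hK; rewrite !moE //; set D := K `^ _ => up2 low.
have D0 : 0 < D by apply: powR_gt0; exact: lt_le_trans K1.
pose l := A * D; have l0 : 0 < l by rewrite mulr_gt0.
have b1 := bp N K s KN' (ltW s0); have b2 := bp N K s2 KN' (ltW s20).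
have up : mean (fun x => nc (expsum k N K x)) <= l `^ (1 - s) * mean (fun x => nc (expsum k N K x) `^ s) +
   l `^ (1 - s2) * mean (fun x => nc (expsum k N K x) `^ s2).
  have b1' := bmeasM (bmeas_cst (l `^ (1 - s))) b1; have b2' := bmeasM (bmeas_cst (l `^ (1 - s2))) b2.
  rewrite -(meanZ _ b1) -(meanZ _ b2) -meanD //.
  apply: mean_le => [||x _]; [exact: bmeas_expsum|exact: bmeasD|].
  by apply: powR_split_le; [exact: normc_ge0| |exact: ltW|exact: ltW].
have E2 : l `^ (1 - s2) * (C2 * D `^ s2) = L / 2 * D.
  by rewrite (powR_rescale C2 s2 A0 D0) AE.
have h2 : l `^ (1 - s2) * mean (fun x => nc (expsum k N K x) `^ s2) <= L / 2 * D.
  by rewrite -E2 ler_wpM2l ?powR_ge0.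
have h : L / 2 * D <= l `^ (1 - s) * mean (fun x => nc (expsum k N K x) `^ s).
  by move: low up h2; clear; lra.
have p0 : 0 < l `^ (1 - s) by rewrite powR_gt0.
rewrite -(ler_pM2l p0); apply: le_trans h.
by rewrite (powR_rescale _ s A0 D0) (powR_cancel _ s A0).
Qed.

Theorem admissible_above (R : realType) k (s theta : R) : (2 <= k)%N -> 0 < s -> s != 1 + k%:R^-1 ->
  theta_bound k s < theta -> admissible k s theta.
Proof.
move=> k2 s0 sk th c c0.
have [C2 C20 [N2 N21 up]] := @moment_upper R k s theta c k2 s0 sk th c0.
have [C1 C10 [N1 N11 low]] : exists2 C : R, 0 < C & exists2 N0 : R, 1 <= N0 &
   forall N K, N0 <= N -> 1 <= K -> K <= N -> c * N `^ theta <= K ->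
   C * moment_order k s K <= mean (fun x => nc (expsum k N K x) `^ s).
  have [h|h|h] := ltgtP s (1 + k%:R^-1); first exact: moment_lower_small.
    apply: moment_lower_large => //; exact: le_lt_trans (theta_bound_ge_delta k2 s0) th.
  by rewrite h eqxx in sk.
exists C1, C2, (Num.max N1 N2); split => // N K; rewrite ge_max => /andP[h1 h2] K1 KN hK.
have KN' : 0 <= K <= N by rewrite KN andbT; lra.
by rewrite momentE ?(ltW s0) // !lee_fin low ?up.
Qed.

Theorem theorem1p1 (R : realType) (k : nat) (s : R)
    (hk : (2 <= k)%N) (hs : 0 < s) (hsk : s != 1 + k%:R^-1) :
  (theta_inf k s <= (theta_bound k s)%:E)%E /\
  ((3 <= k)%N -> delta R k < 1 / (k%:R + 1)).
Proof.
split; last exact: delta_lt.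
apply/lee_addgt0Pr => e e0; rewrite -EFinD; apply: ereal_inf_lbound.
by exists (theta_bound k s + e) => //; apply: admissible_above => //; rewrite ltrDl.
Qed.
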